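(* Let $(U,\rho)$ be a complete separable metric space, let $g\in W(\mathbb{R},U)$, and let $\mu[\,\cdot\,;\,\cdot\,]\in W_1(\mathbb{R},\mathcal{M}(U))$, i.e. $t\mapsto \mu[\,\cdot\,;t]$ is a Weyl almost periodic measure-valued function of order 1. Then for any $\delta\in(0,1)$ there exists a function $f_\delta\in W(\mathbb{R},U)$ such that $\mathrm{Mod}\, f_\delta\subseteq \mathrm{Mod}\, g+\mathrm{Mod}\,\mu[\,\cdot\,;\,\cdot\,]$, $f_\delta(t)\in \mathrm{supp}\,\mu[\,\cdot\,;t]$ for almost every $t\in\mathbb{R}$, and $$\rho(f_\delta(t),g(t))<r_\delta(g(t),\mu[\,\cdot\,;t])+\delta\quad\text{for almost every } t\in\mathbb{R}.$$
   Context: Let $(V,\sigma)$ be a complete metric space with a fixed point $v_0\in V$, and let $p\geq 1$. $M_p(\mathbb{R},V)=M_p(\mathbb{R},(V,\sigma))$ is the set of (strongly) measurable functions $f:\mathbb{R}\to V$ with $\sup_{\xi\in\mathbb{R}}\int_\xi^{\xi+1}\sigma^p(f(t),v_0)\,dt<+\infty$. For $f,g\in M_p(\mathbb{R},V)$ and $l>0$ put $$D^{(\sigma)}_{p,l}(f,g)=\Bigl(\sup_{\xi\in\mathbb{R}}\frac1l\int_\xi^{\xi+l}\sigma^p(f(t),g(t))\,dt\Bigr)^{1/p},\qquad D^{(\sigma)}_p(f,g)=\lim_{l\to+\infty}D^{(\sigma)}_{p,l}(f,g).$$ A number $\tau\in\mathbb{R}$ is an $(\varepsilon,D^{(\sigma)}_{p,l})$-almost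 period of $f$ if $D^{(\sigma)}_{p,l}(f(\cdot),f(\cdot+\tau))<\varepsilon$. A set $T\subseteq\mathbb{R}$ is relatively dense if there is $a>0$ such that $[\xi,\xi+a]\cap T\neq\emptyset$ for all $\xi\in\mathbb{R}$. The space $W_p(\mathbb{R},V)=W_p(\mathbb{R},(V,\sigma))$ of Weyl almost periodic functions of order $p$ consists of all $f\in M_p(\mathbb{R},V)$ such that for any $\varepsilon>0$ there is $l=l(\varepsilon,f)>0$ for which the set of $(\varepsilon,D^{(\sigma)}_{p,l})$-almost periods of $f$ is relatively dense. With $\sigma'(x,y)=\min\{1,\sigma(x,y)\}$, put $W(\mathbb{R},V)=W_1(\mathbb{R},(V,\sigma'))$. One has $W_p(\mathbb{R},V)\subseteq W_1(\mathbb{R},V)\subseteq W(\mathbb{R},V)$. For $f\in W(\mathbb{R},V)$, a sequence $\{\tau_j\}_{j\in\mathbb{N}}\subset\mathbb{R}$ is $f$-returning if $D^{(\sigma')}_1(f(\cdot),f(\cdot+\tau_j))\to0$ as $j\to+\infty$, and $\mathrm{Mod}\,f$ denotes the additive group of all $\lambda\in\mathbb{R}$ such that $e^{\mathrm{i}\lambda\tau_j}\to1$ as $j\to+\infty$ for all $f$-returning sequences $\{\tau_j\}$. The sum of two such groups is $A+B=\{a+b:a\in A,\ b\in B\}$. $(\mathcal{M}(U),d)$ is the (complete separable) metric space of Borel probability measures on $(U,\rho)$ with the Lévy–Prokhorov metric $d$; $W_1(\mathbb{R},\mathcal{M}(U))=W_1(\mathbb{R},(\mathcal{M}(U),d))$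 is the space of functions $\mathbb{R}\ni t\mapsto\mu[\,\cdot\,;t]\in\mathcal{M}(U)$ belonging to $M_1(\mathbb{R},(\mathcal{M}(U),d))$ such that for any $\varepsilon>0$ there is $l>0$ for which the set of $\tau\in\mathbb{R}$ with $D^{(d)}_{1,l}(\mu[\,\cdot\,;\cdot],\mu[\,\cdot\,;\cdot+\tau])=\sup_{\xi\in\mathbb{R}}\frac1l\int_\xi^{\xi+l}d(\mu[\,\cdot\,;t],\mu[\,\cdot\,;t+\tau])\,dt<\varepsilon$ is relatively dense; and $\mathrm{Mod}\,\mu[\,\cdot\,;\,\cdot\,]$ is the additive group of all $\lambda\in\mathbb{R}$ such that $e^{\mathrm{i}\lambda\tau_j}\to1$ as $j\to+\infty$ for all sequences $\{\tau_j\}_{j\in\mathbb{N}}\subset\mathbb{R}$ with $\lim_{l\to+\infty}\sup_{\xi\in\mathbb{R}}\frac1l\int_\xi^{\xi+l}d'(\mu[\,\cdot\,;t],\mu[\,\cdot\,;t+\tau_j])\,dt\to0$ as $j\to+\infty$, where $d'=\min\{1,d\}$. The spaces for $U$ are taken with $(V,\sigma)=(U,\rho)$. For $\mu\in\mathcal{M}(U)$, $x\in U$ and $\delta\in(0,1)$: $r_\delta(x,\mu)=\inf\{r>0:\mu[U_r(x)]>\delta\}$, where $U_r(x)=\{y\in U:\rho(x,y)<r\}$; $\mathrm{supp}\,\mu$ is the (closed) support of $\mu$. *)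

(* Defs.v *)
(* MathComp-Analysis *)
From HB Require Import structures.
From mathcomp Require Import all_boot all_order all_algebra.
From mathcomp Require Import all_classical all_reals all_analysis.
From mathcomp Require Import complex.

Set Implicit Arguments.
Unset Strict Implicit.
Unset Printing Implicit Defensive.

Import Order.TTheory GRing.Theory Num.Theory.
Import numFieldNormedType.Exports.

Local Open Scope classical_set_scope.
Local Open Scope ring_scope.

#[short(type="completeMetricType")]
HB.structure Definition CompleteMetric (K : numDomainType) :=
  {T of Complete T & Metric K T}.

Definition separable (T : topologicalType) : Prop :=
  exists2 S : set T, countable S & dense S.

(* A metric is passed as a bare function [sigma], so that the definitions below
   apply to a distance [mdist], to its truncation and to the Lévy–Prokhorov
   distance alike. *)
Section Weyl.
Context {R : realType} {V : Type}.
Implicit Types (sigma : V -> V -> R) (p l eps tau : R) (f g : R -> V).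

(* The almost-everywhere limit makes this measurability with respect to the
   Lebesgue sigma-algebra, although the simple functions are Borel. *)
Definition strongly_measurable sigma f : Prop :=
  exists s : nat -> R -> V,
    [/\ forall n, finite_set (range (s n)),
        forall n v, measurable (s n @^-1` [set v] : set (measurableTypeR R)) &
        {ae @lebesgue_measure R, forall t,
           sigma (s n t) (f t) @[n --> \oo] --> (0 : R)}].

(* For strongly measurable arguments the integrands below are nonnegative and
   Lebesgue measurable, hence a.e. equal to Borel functions; their integral
   against [lebesgue_measure] is a supremum over Borel simple functions and so
   coincides with the Lebesgue integral. *)
Definition Mp sigma (v0 : V) p : set (R -> V) :=
  [set f | strongly_measurable sigma f /\
    (ereal_sup [set \int[@lebesgue_measure R]_(t in `[xi, (xi + 1)%R])
                      ((sigma (f t) v0) `^ p)%:E | xi in [set: R]] < +oo)%E].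

Definition Dpl sigma p l f g : \bar R :=
  ((ereal_sup [set (l^-1)%:E * \int[@lebesgue_measure R]_(t in `[xi, (xi + l)%R])
                      ((sigma (f t) (g t)) `^ p)%:E | xi in [set: R]])
     `^ p^-1)%E.

Definition Dp sigma p f g : \bar R := lim (Dpl sigma p l f g @[l --> +oo]).

Definition translate f tau : R -> V := fun t => f (t + tau).

Definition almost_periods sigma p l eps f : set R :=
  [set tau | (Dpl sigma p l f (translate f tau) < eps%:E)%E].

Definition relatively_dense (T : set R) : Prop :=
  exists2 a : R, 0 < a & forall xi : R, `[xi, xi + a] `&` T !=set0.

Definition Wp sigma (v0 : V) p : set (R -> V) :=
  [set f | Mp sigma v0 p f /\
    forall eps : R, 0 < eps ->
      exists2 l : R, 0 < l & relatively_dense (almost_periods sigma p l eps f)].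

Definition trunc_dist sigma : V -> V -> R := fun x y => Num.min 1 (sigma x y).

Definition W sigma (v0 : V) : set (R -> V) := Wp (trunc_dist sigma) v0 1.

Definition returning sigma f (tau : nat -> R) : Prop :=
  Dp (trunc_dist sigma) 1 f (translate f (tau j)) @[j --> \oo] --> 0%E.

End Weyl.

Definition expi {R : realType} (x : R) : R[i] := (cos x +i* sin x)%C.

Definition Mod {R : realType} {V : Type} (sigma : V -> V -> R) (f : R -> V) :
    set R :=
  [set lambda | forall tau : nat -> R, returning sigma f tau ->
     expi (lambda * tau j) @[j --> \oo] --> (1 : (R[i] : numFieldType))].

Definition sum_set {R : realType} (A B : set R) : set R :=
  [set a + b | a in A & b in B].

Definition borel (T : ptopologicalType) := g_sigma_algebraType (@open T).

Section BorelProbabilities.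
Context {R : realType} {U : completeMetricType R}.

(* An element is a function on all subsets of [U], constrained only on the
   Borel ones, so a Borel probability measure has several representatives.
   Everything below reads its values on Borel sets only. *)
Definition borel_probability := probability (borel U) R.

Implicit Types m : borel_probability.

Definition thicken (A : set U) (eps : R) : set U := \bigcup_(x in A) ball x eps.

Definition levy_prokhorov m1 m2 : R :=
  inf [set eps : R | 0 < eps /\
    forall A : set (borel U), measurable A ->
      (m1 A <= m2 (thicken A eps) + eps%:E)%E /\
      (m2 A <= m1 (thicken A eps) + eps%:E)%E].

Definition r_ (delta : R) (x : U) m : R :=
  inf [set r : R | 0 < r /\ (delta%:E < m (ball x r))%E].

Definition supp m : set U :=
  [set x | forall O : set U, open O -> O x -> (0 < m O)%E].

End BorelProbabilities.

Arguments borel_probability {R} U.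

(* Main.v *)
Require Import Defs.
From HB Require Import structures.
From mathcomp Require Import all_boot all_order all_algebra.
From mathcomp Require Import all_classical all_reals all_analysis.
From mathcomp Require Import complex measurable_realfun ring lra.
Import Order.TTheory GRing.Theory Num.Theory.
Import numFieldNormedType.Exports.
Set Implicit Arguments.
Unset Strict Implicit.
Unset Printing Implicit Defensive.
Local Open Scope classical_set_scope.
Local Open Scope ring_scope.

(** The theorem holds because a selection can be made in steps each of which
    depends on the pair [z t = (g t, mu t)] almost continuously, in the mean.

    On pairs let [sigma] be the maximum of the truncated distance and of the
    Levy-Prokhorov distance. After a change on a null set, [z] is a Borel function
    with separable range. The translations of a Weyl almost periodic function are
    totally bounded in the mean, so that [g] and [mu] have common almost periods
    ([weyl_ap_max]). A function [f] inherits them, with a controlled loss, if the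
    mean distance between [f] and a translate of [f] is small whenever that
    between [z] and its translate is small ([controlled]).

    The selection is a limit of functions whose values lie in a countable dense
    set. Each step chooses a smaller ball that has its centre in the dense set, meets
    the previous ball and still carries mass of [mu t], namely the first one in an
    enumeration. The first choice is taken near [g t], at a distance bounded by
    [r_ delta] up to a fraction of [delta]. Whether a ball carries a given mass
    depends discontinuously on [z t]. But if the requirement is relaxed by a
    parameter [s], then the density of the set of times that satisfy it is a
    monotone function of [s]. At a continuity point of this function few times are
    close to the boundary of the set, and the set is almost periodic
    ([exists_controlled_level]). By tightness only finitely many balls matter, up to
    a set of times of small density ([uniform_heavy_ball], [rare_exhaustion]), so the
    first admissible ball is almost periodic too ([discrete_selection]). The radii
    decrease geometrically; hence the centres converge uniformly, the limit is
    controlled by [z], and it lies in the support since all its neighbourhoods carry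
    mass ([exists_controlled_selection]).

    For the frequencies, the distance [phi tau] between a function and its
    translate by [tau] is even, subadditive, and small near 0, and it is an infimum
    over all window lengths ([Dp_weyl_length]). Let [phi1] and [phi2] belong to [g] and
    [mu]. The character of a frequency [lam] of [f] is close to 1 at every [tau] at
    which [phi1] and [phi2] are small ([control_uniform]). To write [lam] as [a + b],
    correlate a bump around the zeros of [phi1] with a bump around the zeros of
    [phi2] twisted by that character, on a finite cyclic group that approximates the
    line. The common almost periods make the correlation large in quadratic mean; by
    Parseval some wave is then significant for both functions ([common_wave]). A wave
    that is significant for a function is nearly invariant under the almost periods
    of this function
    ([fourier_almost_period]). So there is a frequency [y] such that [y] is controlled
    by [phi1] and [y - lam] by [phi2], and a cluster point of these [y], for finer and
    finer groups, is the required [a] ([split_frequency]). *)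

(** * Integrals over windows *)

Section Windows.
Context {R : realType}.
Implicit Types (b c : R -> R) (xi l A B tau : R) (E : set R).

(** Boundedness makes integrals over windows finite, so that [window] can take
    real values. *)
Definition weight b : Prop :=
  measurable_fun [set: R] b /\ exists B, forall t, 0 <= b t <= B.

Definition window b xi l : R :=
  fine (\int[@lebesgue_measure R]_(t in `[xi, (xi + l)%R]) (b t)%:E).

Lemma weight_ge0 b t : weight b -> 0 <= b t.
Proof. by move=> [_ [B /(_ t)/andP[]]]. Qed.

Lemma weight_itv b xi l : weight b ->
  measurable_fun (`[xi, xi + l] : set R) (fun t => (b t)%:E).
Proof. by move=> [mb _]; apply/measurable_EFinP; exact: measurable_funTS. Qed.

Lemma windowE b xi l : weight b -> 0 <= l ->
  (window b xi l)%:E =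
  (\int[@lebesgue_measure R]_(t in `[xi, (xi + l)%R]) (b t)%:E)%E.
Proof.
move=> wb l0; have [mb [B bB]] := wb.
rewrite fineK// ge0_fin_numE; last first.
  by apply: integral_ge0 => t _; rewrite lee_fin weight_ge0.
apply: (@le_lt_trans _ _ (\int[@lebesgue_measure R]_(t in `[xi, (xi + l)%R])
  cst B%:E t)%E).
  apply: ge0_le_integral => //.
  - by move=> t _; rewrite lee_fin weight_ge0.
  - exact: weight_itv.
  - by move=> t _; rewrite lee_fin; case/andP: (bB t).
rewrite integral_cst//= lebesgue_measure_itv/=.
by case: ifPn => _; rewrite ?mule0 ?ltry// -EFinD -EFinM ltry.
Qed.

Lemma window_ge0 b xi l : weight b -> 0 <= window b xi l.
Proof.
by move=> wb; apply/fine_ge0/integral_ge0 => t _; rewrite lee_fin weight_ge0.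
Qed.

Lemma le_window_in b c xi l : weight b -> weight c -> 0 <= l ->
  (forall t, xi <= t <= xi + l -> b t <= c t) -> window b xi l <= window c xi l.
Proof.
move=> wb wc l0 bc; rewrite -lee_fin !windowE//.
apply: ge0_le_integral => //.
- by move=> t _; rewrite lee_fin weight_ge0.
- exact: weight_itv.
- exact: weight_itv.
Qed.

Lemma le_window b c xi l : weight b -> weight c -> 0 <= l ->
  (forall t, b t <= c t) -> window b xi l <= window c xi l.
Proof. by move=> wb wc l0 bc; apply: le_window_in. Qed.

Lemma weight_cst A : 0 <= A -> weight (cst A).
Proof. by move=> A0; split => //; exists A => t /=; rewrite A0 lexx. Qed.

Lemma weightD b c : weight b -> weight c -> weight (b \+ c).
Proof.
move=> [mb [B hB]] [mc [C hC]]; split; first exact: measurable_funD.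
exists (B + C) => t /=; have := hB t; have := hC t; lra.
Qed.

Lemma weightZ A b : 0 <= A -> weight b -> weight (fun t => A * b t).
Proof.
move=> A0 [mb [B hB]]; split; first exact: measurable_funM.
exists (A * B) => t /=; have /andP[b0 bB] := hB t.
by rewrite mulr_ge0//= ler_wpM2l.
Qed.

Lemma weight_sum (I : Type) (s : seq I) (F : I -> R -> R) :
  (forall i, weight (F i)) -> weight (fun t => \sum_(i <- s) F i t).
Proof.
move=> wF; elim: s => [|i s IH].
  by under [X in weight X]funext do rewrite big_nil; exact: weight_cst.
by under [X in weight X]funext do rewrite big_cons; exact: weightD.
Qed.

Lemma weight_shift b tau : weight b -> weight (fun t => b (t + tau)).
Proof.
move=> [mb [B hB]]; split; last by exists B => t.
apply: (measurableT_comp mb); exact: measurable_funD.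
Qed.

Lemma weight_indic E : measurable E -> weight (\1_E : R -> R).
Proof.
move=> mE; split; first exact: measurable_indic.
by exists 1 => t; rewrite indicE; case: (_ \in _); rewrite lexx ler01.
Qed.

Lemma weight_max b c : weight b -> weight c ->
  weight (fun t => Num.max (b t) (c t)).
Proof.
move=> [mb [B hB]] [mc [C hC]]; split; first exact: measurable_maxr.
exists (Num.max B C) => t; have /andP[b0 bB] := hB t; have /andP[c0 cC] := hC t.
by rewrite le_max b0 ge_max !le_max bB cC orbT.
Qed.

Lemma windowD b c xi l : weight b -> weight c -> 0 <= l ->
  window (b \+ c) xi l = window b xi l + window c xi l.
Proof.
move=> wb wc l0; apply: EFin_inj.
rewrite EFinD !windowE//; last exact: weightD.
under eq_integral do rewrite EFinD.
apply: ge0_integralD => //; try exact: weight_itv.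
- by move=> t _; rewrite lee_fin weight_ge0.
- by move=> t _; rewrite lee_fin weight_ge0.
Qed.

Lemma windowZ A b xi l : 0 <= A -> weight b -> 0 <= l ->
  window (fun t => A * b t) xi l = A * window b xi l.
Proof.
move=> A0 wb l0; apply: EFin_inj; rewrite EFinM !windowE//; last exact: weightZ.
under eq_integral do rewrite EFinM.
rewrite ge0_integralZl_EFin//; last exact: weight_itv.
by move=> t _; rewrite lee_fin weight_ge0.
Qed.

Lemma window_cst A xi l : 0 <= A -> 0 <= l -> window (cst A) xi l = A * l.
Proof.
move=> A0 l0; apply: EFin_inj; rewrite windowE//; last exact: weight_cst.
rewrite (@integral_cst _ _ _ _ _ _ A%:E)//= lebesgue_measure_itv/= lte_fin ltrDl.
case: ltP => [_|l0']; first by rewrite -EFinD addrC addrA addNr add0r.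
by rewrite (@le_anti _ _ l 0) ?l0 ?l0'// mule0 mulr0.
Qed.

Lemma window_sum (I : Type) (s : seq I) (F : I -> R -> R) xi l :
  (forall i, weight (F i)) -> 0 <= l ->
  window (fun t => \sum_(i <- s) F i t) xi l = \sum_(i <- s) window (F i) xi l.
Proof.
move=> wF l0; elim: s => [|i s IH].
  under [X in window X]funext do rewrite big_nil.
  by rewrite big_nil (@window_cst 0)// mul0r.
under [X in window X]funext do rewrite big_cons.
by rewrite big_cons -IH -windowD//; exact: weight_sum.
Qed.

Lemma window_split b xi l1 l2 : weight b -> 0 <= l1 -> 0 <= l2 ->
  window b xi (l1 + l2) = window b xi l1 + window b (xi + l1) l2.
Proof.
move=> wb l10 l20; apply: EFin_inj.
have l12 : 0 <= l1 + l2 by exact: addr_ge0.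
rewrite EFinD !windowE// -(@integral_itv_bndo_bndc _ _ (xi + l1)); last first.
  by apply/measurable_EFinP; apply: measurable_funTS; case: wb.
rewrite -ge0_integral_setU//=.
- congr (integral _ _ _); apply/seteqP; split => t /=; rewrite !in_itv/=.
    move=> /andP[h1 h2]; have [h|h] := ltP t (xi + l1); first by left; rewrite h1.
    by right; apply/andP; split => //; lra.
  by case=> /andP[h1 h2]; apply/andP; split => //; lra.
- by apply/measurable_EFinP; apply: measurable_funTS; case: wb.
- by move=> t _; rewrite lee_fin weight_ge0.
- rewrite disj_set2E; apply/eqP; rewrite -subset0 => t [/=]; rewrite !in_itv/=.
  lra.
Qed.

(** The two measures agree on half-open intervals. *)
Lemma lebesgue_measure_shift tau E : measurable E ->
  lebesgue_measure [set t | E (t + tau)] = lebesgue_measure E.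
Proof.
move=> mE; have mphi : measurable_fun [set: measurableTypeR R]
    ((fun t => t + tau) : measurableTypeR R -> measurableTypeR R).
  exact: measurable_funD.
pose mphi_mixin := isMeasurableFun.Build _ _ _ _ _ mphi.
pose mphi_pack : {mfun (measurableTypeR R) >-> (measurableTypeR R)} :=
  HB.pack ((fun t => t + tau) : measurableTypeR R -> measurableTypeR R) mphi_mixin.
rewrite [RHS](@lebesgue_measure_unique R
  (pushforward (@lebesgue_measure R) mphi_pack)) => //= _ [[a c]] _ <-.
rewrite /pushforward/= (_ : _ @^-1` _ = `]a - tau, c - tau]%classic); last first.
  by apply/seteqP; split => t /=; rewrite !in_itv/=; lra.
rewrite !lebesgue_measure_itv/= !lte_fin ltrD2r.
by case: ifP => // _; rewrite -!EFinB; congr EFin; lra.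
Qed.

Lemma window_shift b xi l tau : weight b -> 0 <= l ->
  window (fun t => b (t + tau)) xi l = window b (xi + tau) l.
Proof.
move=> wb l0; have mphi : measurable_fun [set: measurableTypeR R]
    ((fun t => t + tau) : measurableTypeR R -> measurableTypeR R).
  exact: measurable_funD.
have := @ge0_integral_pushforward _ _ _ _ _ _ mphi (@lebesgue_measure R)
  (`[xi + tau, (xi + tau + l)%R] : set R) (fun t => (b t)%:E).
have -> : ((fun t => t + tau) : measurableTypeR R -> measurableTypeR R) @^-1`
    `[xi + tau, xi + tau + l]%classic = `[xi, xi + l]%classic :> set R.
  by apply/seteqP; split => t /=; rewrite !in_itv/=; lra.
move=> h; rewrite /window; congr fine; rewrite -h//; last 2 first.
- exact: weight_itv.
- by move=> t _; rewrite lee_fin weight_ge0.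
apply: eq_measure_integral => /= E mE _.
exact: lebesgue_measure_shift.
Qed.

End Windows.

(** * Uniform means, and translation of indicator functions *)

Section Means.
Context {R : realType}.
Implicit Types (b c : R -> R) (xi l A B tau e h t u s : R) (E F : set R).

Definition mean_le b l A : Prop := forall xi, window b xi l <= A * l.

Lemma mean_le_ge0 b l A : weight b -> 0 < l -> mean_le b l A -> 0 <= A.
Proof.
move=> wb l0 /(_ 0) h; rewrite -(pmulr_lge0 _ l0).
exact: le_trans (window_ge0 _ _ wb) h.
Qed.

Lemma mean_leW b l A B : 0 <= l -> A <= B -> mean_le b l A -> mean_le b l B.
Proof. by move=> l0 AB h xi; apply: le_trans (h xi) _; exact: ler_wpM2r. Qed.

Lemma le_mean_le b c l A : weight b -> weight c -> 0 <= l ->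
  (forall t, b t <= c t) -> mean_le c l A -> mean_le b l A.
Proof. by move=> wb wc l0 bc h xi; apply: le_trans (h xi); exact: le_window. Qed.

Lemma mean_leD b c l A B : weight b -> weight c -> 0 <= l ->
  mean_le b l A -> mean_le c l B -> mean_le (b \+ c) l (A + B).
Proof.
by move=> wb wc l0 hb hc xi; rewrite windowD// mulrDl; apply: lerD.
Qed.

Lemma mean_le_shift b l A tau : weight b -> 0 <= l ->
  mean_le b l A -> mean_le (fun t => b (t + tau)) l A.
Proof. by move=> wb l0 hb xi; rewrite window_shift. Qed.

Lemma window_sub b x l y m : weight b -> 0 <= l ->
  y <= x -> x + l <= y + m -> window b x l <= window b y m.
Proof.
move=> wb l0 yx xl; have -> : m = (x - y) + (l + (m - (x - y) - l)) by ring.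
rewrite window_split//; [|lra|lra].
rewrite subrKC [window b x (l + _)]window_split//; last lra.
have := window_ge0 y (x - y) wb.
have := window_ge0 (x + l) (m - (x - y) - l) wb; lra.
Qed.

(** Consecutive windows of length [l1], of total length at most [l + l1], cover
    the given one. *)
Lemma mean_le_window b l1 A xi l : weight b -> 0 < l1 -> 0 <= l ->
  mean_le b l1 A -> window b xi l <= A * (l + l1).
Proof.
move=> wb l10 l0 hb; have A0 := mean_le_ge0 wb l10 hb.
have H n x : window b x (n%:R * l1) <= A * (n%:R * l1).
  elim: n x => [|n IH] x.
    by rewrite mul0r mulr0 /window addr0 set_itv1 integral_set1.
  rewrite -natr1 mulrDl mul1r window_split//; [|by apply: mulr_ge0 => //; lra|lra].
  by rewrite mulrDr; apply: lerD.
pose n := (Num.truncn (l / l1)).+1.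
have /andP[n1 n2] : n%:R * l1 <= l + l1 <= n%:R * l1 + l1.
  have /truncn_itv/andP[h1 h2] : 0 <= l / l1 by rewrite divr_ge0// ltW.
  move: h1 h2; rewrite /n ler_pdivlMr// ltr_pdivrMr// -natr1; lra.
apply: le_trans (_ : window b xi (n%:R * l1) <= _).
  by apply: window_sub => //; lra.
by apply: le_trans (H n xi) _; apply: ler_wpM2l.
Qed.

Lemma mean_le_double b l1 A l : weight b -> 0 < l1 -> l1 <= l ->
  mean_le b l1 A -> mean_le b l (2 * A).
Proof.
move=> wb l10 l1l hb xi; have A0 := mean_le_ge0 wb l10 hb.
have /le_trans := mean_le_window xi wb l10 (ltW (lt_le_trans l10 l1l)) hb.
by apply; nra.
Qed.

(** The excess [A * l1] in the bound of [mean_le_window] is at most [e * l] once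
    [l] is large. *)
Lemma mean_le_eventually b l1 A e : weight b -> 0 < l1 -> 0 < e ->
  mean_le b l1 A -> exists2 L, 0 < L & forall l, L <= l -> mean_le b l (A + e).
Proof.
move=> wb l10 e0 hb; have A0 := mean_le_ge0 wb l10 hb.
have A1 : 0 < A + 1 by lra.
exists ((A + 1) * l1 / e) => [|l]; first by rewrite !mulr_gt0// invr_gt0.
rewrite ler_pdivrMr// => hl xi; have l0 : 0 < l by nra.
have /le_trans := mean_le_window xi wb l10 (ltW l0) hb; apply; nra.
Qed.

Lemma window_indic E xi l : measurable E -> 0 <= l ->
  (window (\1_E) xi l)%:E = lebesgue_measure (E `&` `[xi, xi + l]).
Proof.
move=> mE l0; rewrite windowE//; last exact: weight_indic.
by rewrite integral_indic.
Qed.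

Lemma le_indic (E F : set R) t : (E t -> F t) -> \1_E t <= (\1_F t : R).
Proof.
move=> EF; rewrite !indicE; have [Et|nEt] := pselect (E t).
  by rewrite !mem_set//; exact: EF.
by rewrite memNset//; case: (_ \in _).
Qed.

Lemma indicT E t : E t -> \1_E t = 1 :> R.
Proof. by move=> Et; rewrite indicE mem_set. Qed.

Lemma indicF E t : ~ E t -> \1_E t = 0 :> R.
Proof. by move=> Et; rewrite indicE memNset. Qed.

Lemma indic01 E t : 0 <= (\1_E t : R) <= 1.
Proof. by rewrite indicE; case: (_ \in _); rewrite lexx ler01. Qed.

(** Continuity from above of the Lebesgue measure on a bounded window. *)
Lemma window_decreasing (F : (set R)^nat) xi l e : (forall n, measurable (F n)) ->
  (forall n m, (n <= m)%N -> F m `<=` F n) -> \bigcap_n F n = set0 ->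
  0 <= l -> 0 < e -> exists n, window (\1_(F n)) xi l <= e.
Proof.
move=> mF dF F0 l0 e0; pose G n := F n `&` `[xi, xi + l].
have mG n : measurable (G n) by apply: measurableI.
have : (lebesgue_measure \o G) n @[n --> \oo] --> lebesgue_measure (\bigcap_n G n).
  apply: nonincreasing_cvg_mu => //.
  - apply: (@le_lt_trans _ _ (lebesgue_measure (`[xi, xi + l]%classic : set R))).
      apply: le_measure; rewrite ?inE//=; [exact: mG|exact: subIsetr].
    by rewrite lebesgue_measure_itv/=; case: ifP => _; rewrite -?EFinD ltry.
  - exact: bigcapT_measurable.
  - by move=> n m nm; apply/subsetPset => t [/(dF _ _ nm) Ft ht]; split.
have -> : \bigcap_n G n = set0.
  rewrite -subset0 -F0 => t Gt n _; by case: (Gt n I).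
rewrite measure0 => /fine_cvgP[_ /cvgrPdist_le/(_ _ e0)[N _ hN]].
exists N; have := hN N (leqnn N); rewrite /= sub0r normrN -window_indic//=.
by apply: le_trans; rewrite ler_norm.
Qed.

Lemma le_indicB E F t u : (E t <-> F u) -> `|\1_E t - \1_F u : R| = 0.
Proof.
move=> EF; have [Et|nEt] := pselect (E t).
  by rewrite !indicT ?subrr ?normr0//; apply/EF.
by rewrite !indicF ?subrr ?normr0// => /EF.
Qed.

Lemma indicB_le1 E F t u : `|\1_E t - \1_F u : R| <= 1.
Proof. by have := indic01 E t; have := indic01 F u; rewrite ler_norml; lra. Qed.

Lemma weight_indicB E s : measurable E ->
  weight (fun t => `|\1_E t - \1_E (t + s)| : R).
Proof.
move=> mE; split.
  apply: measurableT_comp => //; apply: measurable_funB.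
    exact: measurable_indic.
  by have [] := weight_shift s (weight_indic mE).
by exists 1 => t; rewrite normr_ge0 indicB_le1.
Qed.

Lemma window_near (x e xi l : R) : 0 <= l -> 0 <= e ->
  window (\1_(`[x - e, x + e] : set R)) xi l <= 2 * e.
Proof.
move=> l0 e0; rewrite -lee_fin window_indic//.
apply: (@le_trans _ _ (lebesgue_measure (`[x - e, x + e]%classic : set R))).
  apply: le_measure; rewrite ?inE//; exact: measurableI.
rewrite lebesgue_measure_itv/=; case: ifP => _; last by rewrite lee_fin; lra.
by rewrite -EFinD lee_fin; lra.
Qed.

Lemma common_scale (P : nat -> R -> Prop) N :
  (forall k, exists2 h, 0 < h & forall s, `|s| <= h -> P k s) ->
  exists2 h, 0 < h <= 1 &
    forall k, (k < N)%N -> forall s, `|s| <= h -> P k s.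
Proof.
move=> hP; elim: N => [|n [h /andP[h0 h1] hh]].
  by exists 1; rewrite ?ltr01 ?lexx.
have [h' h'0 hh'] := hP n.
exists (Num.min h h') => [|k]; first by rewrite lt_min h0 h'0 ge_min h1.
rewrite ltnS leq_eqVlt => /predU1P[->|kn] s; rewrite le_min => /andP[sh sh'].
  exact: hh'.
exact: hh.
Qed.

(** The sets with this property form a sigma-algebra, and intervals have it
    because their indicators change only near the endpoints. *)
Lemma indic_translation_continuous E xi l e : measurable E -> 0 <= l -> 0 < e ->
  exists2 h, 0 < h & forall s, `|s| <= h ->
    window (fun t => `|\1_E t - \1_E (t + s)|) xi l <= e.
Proof.
move=> mE; move: xi l e.
pose G : set (set R) := [set F | measurable F /\ forall xi l e, 0 <= l -> 0 < e ->
  exists2 h, 0 < h & forall s, `|s| <= h ->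
    window (fun t => `|\1_F t - \1_F (t + s)|) xi l <= e].
suff: G E by case.
move: E mE; apply: (@smallest_sub _ _ _ G); last first.
  move=> _ [[a c] _ <-]; split; first by [].
  move=> xi l e l0 e0; exists (e / 4) => [|s sh]; first lra.
  set I := [set` _]; have mI : measurable I by exact: measurable_itv.
  (* A shift by at most [e / 4] matters only within [e / 4] of an endpoint. *)
  have wI x : weight (\1_(`[x - e / 4, x + e / 4] : set R) : R -> R).
    exact: weight_indic.
  apply: le_trans (_ : window (\1_(`[a - e / 4, a + e / 4] : set R) \+
     \1_(`[c - e / 4, c + e / 4] : set R)) xi l <= _).
    apply: le_window => //; [exact: weight_indicB|exact: weightD|].
    move=> t /=.
    have [ta|ta] := pselect (`[a - e / 4, a + e / 4]%classic t).
      rewrite [X in _ <= X + _]indicT//; have := indicB_le1 I I t (t + s).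
      by have := indic01 (`[c - e / 4, c + e / 4] : set R) t; lra.
    have [tc|tc] := pselect (`[c - e / 4, c + e / 4]%classic t).
      rewrite [X in _ <= _ + X]indicT//; have := indicB_le1 I I t (t + s).
      by have := indic01 (`[a - e / 4, a + e / 4] : set R) t; lra.
    rewrite le_indicB; first (by rewrite addr_ge0).
    move: ta tc sh; rewrite /I/= !in_itv/= ler_norml.
    move=> /negP ta /negP tc /andP[s1 s2]; move: ta tc.
    rewrite !negb_and -!ltNge => ta tc; split => /andP[h1 h2]; apply/andP; split.
    + by case/orP: ta => ?; lra.
    + by case/orP: tc => ?; lra.
    + by case/orP: ta => ?; lra.
    + by case/orP: tc => ?; lra.
  rewrite windowD//.
  have e40 : 0 <= e / 4 by lra.
  have := window_near a xi l0 e40; have := window_near c xi l0 e40; lra.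
split.
- split=> // xi l e l0 e0; exists 1 => // s _.
  apply: le_trans (_ : window (cst 0) xi l <= _).
    by apply: le_window => //; [exact: weight_indicB|exact: weight_cst|] => t;
      rewrite le_indicB.
  by rewrite window_cst// mul0r ltW.
- move=> F [mF hF]; rewrite setTD; split; first exact: measurableC.
  move=> xi l e l0 e0; have [h h0 hh] := hF xi l e l0 e0; exists h => // s /hh.
  apply: le_trans; apply: le_window => //; try exact: weight_indicB.
    by apply: weight_indicB; exact: measurableC.
  move=> t; have C u : \1_(~` F) u = 1 - \1_F u :> R.
    have [Fu|nFu] := pselect (F u); first by rewrite (indicT Fu) subrr indicF.
    by rewrite (indicF nFu) subr0 indicT.
  rewrite !C; have -> : 1 - \1_F t - (1 - \1_F (t + s)) =
      - (\1_F t - \1_F (t + s)) :> R by ring.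
  by rewrite normrN.
- move=> F0 hF0; have [F [hF ->]] : exists F : nat -> set R,
      (forall n, G (F n)) /\ \bigcup_n F0 n = \bigcup_n F n :> set R.
    by exists F0.
  have mF n : measurable (F n) by case: (hF n).
  have mU : measurable (\bigcup_n F n) by apply: bigcup_measurable => k _.
  split => // xi l e l0 e0.
  (* Near the window the union differs from the union of the first [N] sets by
     a set of small measure; the margin 1 leaves room for the shift. *)
  pose T n := (\bigcup_k F k) `\` \bigcup_(k in `I_n) F k.
  have mT n : measurable (T n).
    by apply: measurableD => //; apply: bigcup_measurable => k _.
  have [N hN] : exists n, window (\1_(T n)) (xi - 1) (l + 2) <= e / 4.
    apply: window_decreasing => //; [| |lra|lra].
      move=> n m nm t [Ut nt]; split=> // -[k /= kn Fk]; apply: nt.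
      by exists k => //=; exact: leq_trans kn nm.
    rewrite -subset0 => t Tt; have [[n _ Fn] _] := Tt 0%N I.
    by have [_] := Tt n.+1 I; apply; exists n => /=.
  have [h /andP[h0 h1] hh] := common_scale N (fun k => (hF k).2 xi l
    (e / 4 / N.+1%:R) l0 (divr_gt0 (divr_gt0 e0 (ltr0n _ 4)) (ltr0n _ N.+1))).
  exists h => // s sh.
  apply: le_trans (_ : window ((fun t => \sum_(k < N) `|\1_(F k) t - \1_(F k) (t + s)|)
    \+ (\1_(T N) \+ (fun t => \1_(T N) (t + s)))) xi l <= _).
    apply: le_window => //.
    + exact: weight_indicB.
    + apply: weightD; first by apply: weight_sum => k; exact: weight_indicB.
      apply: weightD; first exact: weight_indic.
      exact/weight_shift/weight_indic.
    move=> t /=; have wf : 0 <= \sum_(k < N) `|\1_(F k) t - \1_(F k) (t + s) : R|.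
      by apply: sumr_ge0.
    have i1 := indic01 (T N) t; have i2 := indic01 (T N) (t + s).
    have i3 := indicB_le1 (\bigcup_n F n) (\bigcup_n F n) t (t + s).
    have [Tt|nTt] := pselect (T N t); first by rewrite (indicT Tt); lra.
    have [Ts|nTs] := pselect (T N (t + s)); first by rewrite (indicT Ts); lra.
    have fin u : ~ T N u -> (\bigcup_n F n) u -> exists2 k, (k < N)%N & F k u.
      move=> nT Uu; have [//|nk] := pselect (exists2 k, (k < N)%N & F k u).
      by exfalso; apply: nT; split => // -[k kN Fk]; apply: nk; exists k.
    have key : (exists2 k, (k < N)%N & ~ (F k t <-> F k (t + s))) ->
        1 <= \sum_(k < N) `|\1_(F k) t - \1_(F k) (t + s) : R|.
      move=> [k kN nF]; rewrite (bigD1 (Ordinal kN))//=.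
      apply: le_trans (_ : `|\1_(F k) t - \1_(F k) (t + s) : R| <= _); last first.
        by rewrite lerDl sumr_ge0.
      have [Ft|nFt] := pselect (F k t).
        rewrite (indicT Ft) indicF ?subr0 ?normr1// => Fs.
        by apply: nF.
      rewrite (indicF nFt) indicT ?sub0r ?normrN1//; apply: contrapT => nFs.
      by apply: nF.
    have [Ut|nUt] := pselect ((\bigcup_n F n) t);
      have [Us|nUs] := pselect ((\bigcup_n F n) (t + s)).
    + by rewrite le_indicB//; lra.
    + suff : 1 <= \sum_(k < N) `|\1_(F k) t - \1_(F k) (t + s) : R| by lra.
      have [k kN Fk] := fin _ nTt Ut; apply: key; exists k => // -[/(_ Fk) Fks _].
      by apply: nUs; exists k.
    + suff : 1 <= \sum_(k < N) `|\1_(F k) t - \1_(F k) (t + s) : R| by lra.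
      have [k kN Fk] := fin _ nTs Us; apply: key; exists k => // -[_ /(_ Fk) Fks].
      by apply: nUt; exists k.
    + by rewrite le_indicB//; lra.
  have wT := weight_indic (mT N); have wTs := weight_shift s wT.
  rewrite windowD//; [|by apply: weight_sum => k; exact: weight_indicB|exact: weightD].
  rewrite windowD// window_sum//; last by move=> k; exact: weight_indicB.
  rewrite window_shift//.
  have T1 : window (\1_(T N)) xi l <= e / 4.
    by apply: le_trans hN; apply: window_sub => //; lra.
  have T2 : window (\1_(T N)) (xi + s) l <= e / 4.
    apply: le_trans hN; move: sh; rewrite ler_norml => /andP[s1 s2].
    by apply: window_sub => //; lra.
  have S1 : \sum_(k < N) window (fun t => `|\1_(F k) t - \1_(F k) (t + s) : R|) xi l
      <= e / 4.
    apply: le_trans (_ : \sum_(k < N) e / 4 / N.+1%:R <= _).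
      by apply: ler_sum => k _; apply: hh.
    rewrite sumr_const card_ord -[_ *+ N]mulr_natr.
    have N1 : (N.+1%:R)^-1 * N%:R <= 1 :> R.
      by rewrite mulrC ler_pdivrMr// mul1r ler_nat.
    have : 0 < e / 4 by lra.
    move=> e4; rewrite -[_ * N%:R]mulrA -[leRHS]mulr1.
    by apply: ler_wpM2l => //; exact: ltW.
  by lra.
Qed.

End Means.

(** * Weyl almost periodicity for a bounded pseudometric *)

Section RealMeasurability.
Context {R : realType}.
Implicit Types (b c : R -> R).

Lemma measurable_sublevels b :
  (forall x, measurable [set t | b t < x]) -> measurable_fun [set: R] b.
Proof.
move=> hb _; apply: (measurability _ (RGenInftyO.measurableE R)) => //.
move=> _ [_ [x ->] <-]; rewrite setTI.
by rewrite (_ : _ @^-1` _ = [set t | b t < x])//; apply/seteqP; split => t /=;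
  rewrite in_itv.
Qed.

Lemma measurable_sublevel b x : measurable_fun [set: R] b ->
  measurable [set t | b t < x].
Proof.
move=> mb; have := mb measurableT `]-oo, x[%classic (measurable_itv _).
by rewrite setTI; congr measurable; apply/seteqP; split => t /=; rewrite in_itv.
Qed.

Lemma measurable_lt b c : measurable_fun [set: R] b -> measurable_fun [set: R] c ->
  measurable [set t | b t < c t].
Proof.
move=> mb mc; have -> : [set t | b t < c t] = [set t | (b \- c) t < 0].
  by apply/seteqP; split => t /=; rewrite subr_lt0.
by apply: measurable_sublevel; exact: measurable_funB.
Qed.

Lemma measurable_shift (E : set R) tau : measurable E ->
  measurable [set t | E (t + tau)].
Proof.
move=> mE; have mphi : measurable_fun [set: R] (fun t : R => t + tau).
  exact: measurable_funD.
by have := mphi measurableT E mE; rewrite setTI.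
Qed.

End RealMeasurability.

Section Pseudometric.
Context {R : realType} {V : Type}.
Implicit Types (sigma : V -> V -> R) (f : R -> V) (v : nat -> V).
Implicit Types (xi l A B tau e h t s : R).

(** Not a metric, because [levy_prokhorov] identifies measures that agree on the
    Borel sets. *)
Definition bounded_pseudometric sigma : Prop :=
  [/\ forall x, sigma x x = 0, forall x y, sigma x y = sigma y x,
      forall x y z, sigma x z <= sigma x y + sigma y z &
      forall x y, 0 <= sigma x y <= 1].

(** The form of strong measurability used below: the sequence [v] is dense in
    the range of [f], and the distances of [f] to it are Borel. *)
Definition borel_separable sigma f v : Prop :=
  (forall k, measurable_fun [set: R] (fun t => sigma (f t) (v k))) /\
  (forall t e, 0 < e -> exists k, sigma (f t) (v k) < e).

Definition period_le sigma f l A tau : Prop :=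
  mean_le (fun t => sigma (f t) (f (t + tau))) l A.

Definition weyl_ap sigma f : Prop :=
  forall e, 0 < e ->
    exists2 l, 0 < l & relatively_dense [set tau | period_le sigma f l e tau].

Section Fixed.
Variables (sigma : V -> V -> R) (f : R -> V) (v : nat -> V).
Hypotheses (psigma : bounded_pseudometric sigma) (fv : borel_separable sigma f v).

Let sxx x : sigma x x = 0. Proof. by case: psigma. Qed.
Let ssym x y : sigma x y = sigma y x. Proof. by case: psigma. Qed.
Let stri y x z : sigma x z <= sigma x y + sigma y z. Proof. by case: psigma. Qed.
Let sge0 x y : 0 <= sigma x y.
Proof. by case: psigma => _ _ _ /(_ x y)/andP[]. Qed.
Let sle1 x y : sigma x y <= 1.
Proof. by case: psigma => _ _ _ /(_ x y)/andP[]. Qed.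

(** The distance of two values of [f] is an infimum over the sequence [v]. *)
Lemma weight_period tau : weight (fun t => sigma (f t) (f (t + tau))).
Proof.
case: fv => mf df; split; last by exists 1 => t; rewrite sge0 sle1.
apply: measurable_sublevels => x.
have -> : [set t | sigma (f t) (f (t + tau)) < x] =
    \bigcup_k [set t | sigma (f t) (v k) + sigma (f (t + tau)) (v k) < x].
  apply/seteqP; split => t /=; last first.
    move=> [k _ /=]; apply: le_lt_trans; rewrite [sigma (f (t + tau)) (v k)]ssym; exact: stri.
  move=> ltx; have [|k hk] := df t ((x - sigma (f t) (f (t + tau))) / 2); first lra.
  exists k => //=; have := stri (f t) (f (t + tau)) (v k).
  rewrite [sigma (f (t + tau)) (f t)]ssym; lra.
apply: bigcup_measurable => k _; apply: measurable_sublevel.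
apply: measurable_funD; first exact: mf.
apply: (measurableT_comp (mf k)); exact: measurable_funD.
Qed.

(** Only countably many of the balls around the points [v k] with rational
    radii are needed to exhaust an open set. *)
Lemma measurable_open_pullback (E : set R) :
  (forall t, E t -> exists2 e, 0 < e & forall s, sigma (f t) (f s) < e -> E s) ->
  measurable E.
Proof.
case: fv => mf df oE.
pose good := [set p : nat * nat |
  [set t | sigma (f t) (v p.1) < p.2.+1%:R^-1] `<=` E].
have -> : E = \bigcup_(p in good) [set t | sigma (f t) (v p.1) < p.2.+1%:R^-1].
  apply/seteqP; split => t; last by move=> [p gp /gp].
  move=> /oE[e e0 he]; have [m m0] : exists m, (m.+1%:R^-1 : R) < e / 2.
    have e20 : 0 < e / 2 by lra.
    by have [m _ /(_ m (leqnn m)) hm] := near_infty_natSinv_lt (PosNum e20); exists m.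
  have m1 : 0 < (m.+1%:R^-1 : R) by rewrite invr_gt0.
  have [k hk] := df t _ m1.
  exists (k, m) => //= s /= hs; apply: he.
  have := stri (v k) (f t) (f s); rewrite [sigma (v k) _]ssym.
  by move: m0 hk hs; set x := _^-1 => m0 hk hs; lra.
rewrite bigcup_mkcond; apply: countable_bigcupT_measurable => // p.
by case: ifP => // _; exact: measurable_sublevel.
Qed.

Lemma period_leN l A tau : 0 <= l -> period_le sigma f l A tau ->
  period_le sigma f l A (- tau).
Proof.
move=> l0 h; have := mean_le_shift (- tau) (weight_period tau) l0 h.
apply: le_mean_le => //; first exact: weight_period.
  exact: (weight_shift (- tau) (weight_period tau)).
by move=> t; rewrite subrK ssym.
Qed.

Lemma period_leD l A B tau tau' : 0 <= l -> period_le sigma f l A tau ->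
  period_le sigma f l B tau' -> period_le sigma f l (A + B) (tau + tau').
Proof.
move=> l0 h h'; have w := weight_shift tau (weight_period tau').
apply: le_mean_le (mean_leD (weight_period tau) w l0 h (mean_le_shift _ _ _ h')) => //.
- exact: weight_period.
- by apply: weightD => //; exact: weight_period.
- by move=> t /=; rewrite addrA; exact: stri.
- exact: weight_period.
Qed.

Lemma period_leB l A B tau tau' : 0 <= l -> period_le sigma f l A tau ->
  period_le sigma f l B tau' -> period_le sigma f l (A + B) (tau - tau').
Proof. by move=> l0 h h'; apply: period_leD => //; exact: period_leN. Qed.

(** By separability [f] is, up to a set of small measure, a function with
    finitely many values; for these translation is continuous. *)
Lemma window_translation_continuous xi l e : 0 <= l -> 0 < e ->
  exists2 h, 0 < h & forall s, `|s| <= h ->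
    window (fun t => sigma (f t) (f (t + s))) xi l <= e.
Proof.
case: fv => mf df l0 e0; pose d := e / (8 * (l + 1)).
have d0 : 0 < d by rewrite /d divr_gt0// mulr_gt0//; lra.
have dl : 2 * d * l <= e / 4.
  have : d * (8 * (l + 1)) = e by rewrite /d mulfVK// lt0r_neq0//; lra.
  nra.
pose E k := [set t | sigma (f t) (v k) < d].
have mE k : measurable (E k) by exact: measurable_sublevel.
pose T n := ~` (\bigcup_(k in `I_n) E k).
have mT n : measurable (T n).
  by apply: measurableC; apply: bigcup_measurable => k _.
have [N hN] : exists n, window (\1_(T n)) xi l <= e / 4.
  apply: window_decreasing => //; [| |lra].
    move=> n m nm t nt [k /= kn Ek]; apply: nt; exists k => //=.
    exact: leq_trans kn nm.
  rewrite -subset0 => t Tt; have [k hk] := df t _ d0.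
  by apply: (Tt k.+1 I); exists k => /=.
have e1 : 0 < e / 4 / N.+1%:R by rewrite !divr_gt0.
have [h /andP[h0 _] hh] := common_scale N (fun k =>
  @indic_translation_continuous _ _ xi _ _ (mE k) l0 e1).
(* Outside the small set [T N] a time lies in some [E k]; if its translate lies in
   the same set, then the two values are within [2 * d] of each other. *)
exists h => // s sh.
have wE k : weight (fun t => `|\1_(E k) t - \1_(E k) (t + s)| : R).
  exact: weight_indicB.
apply: le_trans (_ : window (cst (2 * d) \+ (\1_(T N) \+
  (fun t => \sum_(k < N) `|\1_(E k) t - \1_(E k) (t + s)|))) xi l <= _).
  apply: le_window => //; first exact: weight_period.
    apply: weightD; first by apply: weight_cst; lra.
    by apply: weightD; [exact: weight_indic|apply: weight_sum].
  move=> t /=; have := sle1 (f t) (f (t + s)); have := indic01 (T N) t.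
  have S0 : 0 <= \sum_(k < N) `|\1_(E k) t - \1_(E k) (t + s) : R|.
    exact: sumr_ge0.
  have [Tt|/contrapT[k /= kN Ekt]] := pselect (T N t).
    by rewrite indicT//; lra.
  have [Eks|nEks] := pselect (E k (t + s)).
    have := stri (v k) (f t) (f (t + s)); move: Ekt Eks; rewrite /E/=.
    by rewrite [sigma (f (t + s)) _]ssym; lra.
  suff : 1 <= \sum_(k < N) `|\1_(E k) t - \1_(E k) (t + s) : R| by lra.
  rewrite (bigD1 (Ordinal kN))//= (indicT Ekt) (indicF nEks) subr0 normr1.
  by rewrite lerDl sumr_ge0.
rewrite windowD//; last 2 first.
- by apply: weight_cst; lra.
- by apply: weightD; [exact: weight_indic|apply: weight_sum].
rewrite windowD//; last 2 first.
- exact: weight_indic.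
- exact: weight_sum.
rewrite window_cst//; last lra.
rewrite window_sum//.
have : \sum_(k < N) window (fun t => `|\1_(E k) t - \1_(E k) (t + s) : R|) xi l
    <= e / 4.
  apply: le_trans (_ : \sum_(k < N) e / 4 / N.+1%:R <= _).
    by apply: ler_sum => k _; apply: hh.
  rewrite sumr_const card_ord -[_ *+ N]mulr_natr.
  have N1 : (N.+1%:R)^-1 * N%:R <= 1 :> R.
    by rewrite mulrC ler_pdivrMr// mul1r ler_nat.
  rewrite -[_ * N%:R]mulrA -[leRHS]mulr1.
  by apply: ler_wpM2l => //; lra.
lra.
Qed.

Hypothesis apf : weyl_ap sigma f.

(** An almost period carries every window into one fixed bounded window, where
    local continuity of translation applies. *)
Lemma weyl_translation_continuous e : 0 < e ->
  exists2 l, 0 < l & exists2 h, 0 < h & forall s, `|s| <= h -> period_le sigma f l e s.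
Proof.
move=> e0; have e40 : 0 < e / 4 by lra.
have [l l0 [a a0 dense]] := apf e40.
have [||h h0 hh] := @window_translation_continuous 0 (l + a) (e / 4 * l).
- by lra.
- by apply: mulr_gt0.
exists l => //; exists h => // s /hh hs xi.
have [tau /= [xitau ptau]] := dense (- xi).
have wtau := weight_period tau; have ws := weight_period s.
have wtaus := weight_shift s wtau; have wstau := weight_shift tau ws.
apply: le_trans (_ : window ((fun t => sigma (f t) (f (t + tau))) \+
   ((fun t => sigma (f (t + tau)) (f (t + tau + s))) \+
    (fun t => sigma (f (t + s)) (f (t + s + tau))))) xi l <= _).
  apply: le_window => //; [|exact: ltW|].
    by apply: weightD => //; exact: weightD.
  move=> t /=; have := stri (f (t + tau)) (f t) (f (t + s)).
  have := stri (f (t + tau + s)) (f (t + tau)) (f (t + s)).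
  by rewrite [sigma (f (t + tau + s)) _]ssym -[t + s + tau]addrA [s + tau]addrC addrA; lra.
rewrite windowD//; [|exact: weightD|exact: ltW].
rewrite windowD//; last exact: ltW.
rewrite (window_shift _ _ ws (ltW l0)) (window_shift _ _ wtau (ltW l0)).
have h1 := ptau xi; have h2 := ptau (xi + s).
have h3 : window (fun t => sigma (f t) (f (t + s))) (xi + tau) l <= e / 4 * l.
  apply: le_trans hs; move: xitau; rewrite in_itv/= => /andP[x1 x2].
  by apply: window_sub => //; lra.
have : 0 < e * l by apply: mulr_gt0.
lra.
Qed.

(** An almost period brings any translation into a bounded interval, on which, by
    continuity, finitely many translations suffice. *)
Lemma weyl_totally_bounded e : 0 < e ->
  exists2 l, 0 < l & exists r : nat -> R, exists n, forall L, l <= L ->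
    forall tau, exists2 i, (i < n)%N & period_le sigma f L e (tau - r i).
Proof.
move=> e0; have e40 : 0 < e / 4 by lra.
have [l1 l10 [a a0 dense]] := apf e40.
have [l2 l20 [h h0 hh]] := weyl_translation_continuous e40.
exists (Num.max l1 l2); first by rewrite lt_max l10.
exists (fun i => i%:R * h); exists (Num.truncn (a / h)).+1 => L.
rewrite ge_max => /andP[L1 L2] tau.
have [t [/= ht pt]] := dense (tau - a); move: ht; rewrite in_itv/= => /andP[t1 t2].
have u0 : 0 <= (tau - t) / h by apply: divr_ge0; lra.
have /andP[i1 i2] := truncn_itv u0.
exists (Num.truncn ((tau - t) / h)).
  rewrite ltnS le_truncn// ler_pM2r ?invr_gt0//; lra.
move: i1 i2; set i := Num.truncn _; rewrite ler_pdivlMr// ltr_pdivrMr// -natr1 => i1 i2.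
have -> : tau - i%:R * h = t + (tau - t - i%:R * h) by ring.
have -> : e = 2 * (e / 4) + 2 * (e / 4) by field.
apply: period_leD; first lra.
- by apply: mean_le_double pt => //; exact: weight_period.
- apply: mean_le_double (hh _ _) => //; first exact: weight_period.
  by rewrite ger0_norm; lra.
Qed.

End Fixed.
End Pseudometric.

Section Product.
Context {R : realType} {V1 V2 : Type}.
Variables (sigma1 : V1 -> V1 -> R) (f1 : R -> V1) (v1 : nat -> V1).
Variables (sigma2 : V2 -> V2 -> R) (f2 : R -> V2) (v2 : nat -> V2).
Hypotheses (p1 : bounded_pseudometric sigma1) (fv1 : borel_separable sigma1 f1 v1).
Hypotheses (p2 : bounded_pseudometric sigma2) (fv2 : borel_separable sigma2 f2 v2).

Definition max_dist (x y : V1 * V2) : R :=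
  Num.max (sigma1 x.1 y.1) (sigma2 x.2 y.2).

Lemma bounded_pseudometric_max : bounded_pseudometric max_dist.
Proof.
case: p1 => x1 s1 t1 b1; case: p2 => x2 s2 t2 b2; split.
- by move=> x; rewrite /max_dist x1 x2 maxxx.
- by move=> x y; rewrite /max_dist s1 s2.
- move=> x y z; rewrite /max_dist ge_max.
  have := t1 x.1 y.1 z.1; have := t2 x.2 y.2 z.2.
  have h (a b : R) : a <= Num.max a b /\ b <= Num.max a b.
    by rewrite !le_max !lexx orbT.
  have [] := h (sigma1 x.1 y.1) (sigma2 x.2 y.2).
  have [] := h (sigma1 y.1 z.1) (sigma2 y.2 z.2).
  by move=> *; apply/andP; split; lra.
- move=> x y; rewrite /max_dist le_max ge_max.
  by case/andP: (b1 x.1 y.1) => -> ->; case/andP: (b2 x.2 y.2) => _ ->.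
Qed.

Lemma borel_separable_max : exists v,
  borel_separable max_dist (fun t => (f1 t, f2 t)) v.
Proof.
case: fv1 => m1 d1; case: fv2 => m2 d2.
exists (fun k => let p := odflt (0, 0)%N (unpickle k) in (v1 p.1, v2 p.2)); split.
  by move=> k; rewrite /max_dist/=; apply: measurable_maxr; [exact: m1|exact: m2].
move=> t e e0; have [i hi] := d1 t e e0; have [j hj] := d2 t e e0.
by exists (pickle (i, j)); rewrite pickleK/= /max_dist/= gt_max hi.
Qed.

(** Common almost periods exist because differences of two translations in the
    same cell of both finite nets are almost periods of both functions. *)
Lemma weyl_ap_max : weyl_ap sigma1 f1 -> weyl_ap sigma2 f2 ->
  weyl_ap max_dist (fun t => (f1 t, f2 t)).
Proof.
move=> a1 a2 e e0; have e40 : 0 < e / 4 by lra.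
have [l1 l10 [r1 [n1 h1]]] := weyl_totally_bounded p1 fv1 a1 e40.
have [l2 l20 [r2 [n2 h2]]] := weyl_totally_bounded p2 fv2 a2 e40.
pose L := Num.max l1 l2; have L0 : 0 < L by rewrite /L lt_max l10.
exists L => //.
have {}h1 : forall tau, exists2 i, (i < n1)%N & period_le sigma1 f1 L (e / 4) (tau - r1 i).
  by apply: h1; rewrite /L le_max lexx.
have {}h2 : forall tau, exists2 i, (i < n2)%N & period_le sigma2 f2 L (e / 4) (tau - r2 i).
  by apply: h2; rewrite /L le_max lexx orbT.
(* [P p] is a cell of the product of the two nets, [T p] a point chosen in it. *)
pose P (p : 'I_n1 * 'I_n2) t := period_le sigma1 f1 L (e / 4) (t - r1 p.1) /\
  period_le sigma2 f2 L (e / 4) (t - r2 p.2).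
have [T hT] : {T : 'I_n1 * 'I_n2 -> R & forall p t, P p t -> P p (T p)}.
  apply: (@choice _ _ (fun p y => forall t, P p t -> P p y)) => p; have [[t Pt]|nP] := pselect (exists t, P p t).
    by exists t.
  by exists 0 => t Pt; exfalso; apply: nP; exists t.
pose a := 1 + \sum_p `|T p|.
have a0 : 0 < a by rewrite ltr_wpDr// sumr_ge0.
exists (2 * a) => [|xi]; first lra.
have [i i1 hi] := h1 (xi + a); have [j j2 hj] := h2 (xi + a).
pose p := (Ordinal i1, Ordinal j2).
have [q1 q2] : P p (T p) by apply: (hT p (xi + a)).
exists (xi + a - T p); split.
  have : `|T p| <= a.
    by rewrite /a (bigD1 p)//= addrCA lerDl addr_ge0// sumr_ge0.
  by rewrite /= in_itv/= ler_norml; lra.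
have w1 := weight_period p1 fv1 (xi + a - T p).
have w2 := weight_period p2 fv2 (xi + a - T p).
have H1 := period_leB p1 fv1 (ltW L0) hi q1.
have H2 := period_leB p2 fv2 (ltW L0) hj q2.
rewrite /period_le/=; apply: (@le_mean_le _ _ ((fun t => sigma1 (f1 t)
  (f1 (t + (xi + a - T p)))) \+ (fun t => sigma2 (f2 t) (f2 (t + (xi + a - T p)))))).
- exact: weight_max.
- exact: weightD.
- exact: ltW.
- move=> t; rewrite /max_dist/= ge_max.
  by rewrite lerDl lerDr (weight_ge0 _ w1) (weight_ge0 _ w2).
have -> : e = (e / 4 + e / 4) + (e / 4 + e / 4) by field.
apply: mean_leD => //; first exact: ltW.
- by move: H1; congr (period_le _ _ _ _ _); rewrite /=; ring.
- by move: H2; congr (period_le _ _ _ _ _); rewrite /=; ring.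
Qed.

End Product.

(** * Controlled level sets *)

Section Levels.
Context {R : realType}.
Implicit Types (xi l A B tau e h t s : R) (H : R -> R).

(** A monotone function has countably many discontinuities. *)
Lemma monotone_continuity_point H a b : {homo H : x y / x <= y} -> a < b ->
  exists2 s, a < s < b & forall e, 0 < e ->
    exists2 eta, 0 < eta & H (s + eta) - H (s - eta) < e.
Proof.
move=> ndH ab.
have cD := @discontinuity_countable _ a b H (fun x y _ _ xy => ndH x y xy).
have : ~ (`]a, b[%classic `<=` [set x | x \in (`]a, b[) /\ discontinuity H x]).
  move=> sub; have := sub_countable (subset_card_le sub) cD.
  move=> /countable_lebesgue_measure0; rewrite lebesgue_measure_itv/= lte_fin ab.
  by rewrite -EFinB => -[]; lra.
move=> /existsNP[s /not_implyP[sab nd]].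
have abs : a < s < b by move: sab; rewrite /= in_itv.
exists s => // e e0.
have cl : cvg (H x @[x --> s^'-]).
  apply: nondecreasing_at_left_is_cvgr; near=> x.
    by move=> y z _ _; exact: ndH.
  by exists (H s) => _ [y /= + <-]; rewrite in_itv/= => /andP[_ /ltW]; exact: ndH.
have cr : cvg (H x @[x --> s^'+]).
  apply: nondecreasing_at_right_is_cvgr; near=> x.
    by move=> y z _ _; exact: ndH.
  by exists (H s) => _ [y /= + <-]; rewrite in_itv/= => /andP[/ltW + _]; exact: ndH.
have lr : lim (H x @[x --> s^'-]) = lim (H x @[x --> s^'+]).
  by apply/eqP; apply/negPn/negP => lr; apply: nd; split => //; rewrite inE.
have e20 : 0 < e / 2 by lra.
move/cvgrPdist_lt : cl => /(_ _ e20); move/cvgrPdist_lt : cr => /(_ _ e20).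
rewrite lr; set c := lim _ => /= hr hl.
have hr0 : \forall eta \near (0 : R)^'+, `|c - H (s + eta)| < e / 2.
  by have /nbhs_right0P := hr.
have hl0 : \forall eta \near (0 : R)^'+, `|c - H (s - eta)| < e / 2.
  by have /nbhs_left0P := hl.
near (0 : R)^'+ => eta; exists eta; first by near: eta; exact: nbhs_right_gt.
have : `|c - H (s + eta)| < e / 2 by near: eta.
have : `|c - H (s - eta)| < e / 2 by near: eta.
by rewrite !ltr_norml; lra.
Unshelve. all: by end_near.
Qed.

End Levels.

Section Controlled.
Context {R : realType} {V : Type}.
Implicit Types (xi l A B tau e h t s : R) (E : set R) (K : R -> R -> R).
Variables (sigma : V -> V -> R) (f : R -> V) (v : nat -> V).
Hypotheses (psigma : bounded_pseudometric sigma) (fv : borel_separable sigma f v).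
Hypothesis apf : weyl_ap sigma f.

Let beta t s := sigma (f t) (f s).
Let stri y x z : sigma x z <= sigma x y + sigma y z. Proof. by case: psigma. Qed.
Let ssym x y : sigma x y = sigma y x. Proof. by case: psigma. Qed.
Let wp := weight_period psigma fv.

(** [K] stands for the distance between the values at two times of a function
    derived from [f]; that function inherits the almost periods of [f], with a
    quality that depends on [K] only. *)
Definition controlled_by K e : Prop :=
  exists2 gamma, 0 < gamma & exists2 L, 0 < L &
    forall l tau, L <= l -> period_le sigma f l gamma tau ->
      mean_le (fun t => K t (t + tau)) l e.

Definition controlled K : Prop := forall e, 0 < e -> controlled_by K e.

Definition asymptotic_le (b : R -> R) e : Prop :=
  exists2 L, 0 < L & forall l, L <= l -> mean_le b l e.

Definition rare E e : Prop := asymptotic_le (\1_E) e.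

Definition indic_dist E t s : R := `|\1_E t - \1_E s|.

(** Replacing [G s] by the union of the earlier ones makes the sets open. *)
Definition open_level (G : R -> set R) s : set R := [set t | exists2 s', s' < s & G s' t].

(** Moving by less than [eta] for [beta] costs at most [eta] in the level. *)
Definition expanding (G : R -> set R) : Prop :=
  {homo G : x y / x <= y >-> x `<=` y} /\
  forall s t t' eta, 0 < eta <= 1 -> beta t t' < eta -> G s t -> G (s + eta) t'.

Section Level.
Variable G : R -> set R.
Hypothesis eG : expanding G.
Let G' := open_level G.

Lemma open_level_expanding : expanding G'.
Proof.
case: eG => mG xG; split.
  by move=> x y xy t [s' s'x Gt]; exists s' => //; exact: lt_le_trans s'x xy.
move=> s t t' eta h ltb [s' s's Gt]; exists (s' + eta); first by rewrite ltrD2r.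
exact: xG Gt.
Qed.

Lemma open_level_measurable s : measurable (G' s).
Proof.
apply: (measurable_open_pullback psigma fv) => t [s' s's Gt].
exists (Num.min 1 ((s - s') / 2)); first by rewrite lt_min ltr01/=; lra.
move=> u hu; exists (s' + Num.min 1 ((s - s') / 2)).
  have : Num.min 1 ((s - s') / 2) <= (s - s') / 2 by rewrite ge_min lexx orbT.
  lra.
apply: (eG.2 _ _ _ _ _ hu Gt).
by rewrite lt_min ltr01 ge_min lexx/=; lra.
Qed.

(** The upper asymptotic density of the level set. *)
Let H s : R := inf [set A | exists2 L, 0 < L & mean_le (\1_(G' s)) L A].

Let wG s : weight (\1_(G' s) : R -> R).
Proof. by apply: weight_indic; exact: open_level_measurable. Qed.

Let H_nonempty s : [set A | exists2 L, 0 < L & mean_le (\1_(G' s)) L A] 1.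
Proof.
exists 1 => // xi; apply: le_trans (_ : window (cst 1) xi 1 <= _).
  apply: le_window => //; first exact: weight_cst.
  by move=> t; case/andP: (indic01 (G' s) t).
by rewrite window_cst.
Qed.

Let H_lbound s : has_lbound [set A | exists2 L, 0 < L & mean_le (\1_(G' s)) L A].
Proof. by exists 0 => A [L L0 hA]; exact: mean_le_ge0 hA. Qed.

Let H_mono : {homo H : x y / x <= y}.
Proof.
move=> x y xy; apply: lb_le_inf; first by exists 1; exact: H_nonempty.
move=> A [L L0 hA]; apply: ge_inf; first exact: H_lbound.
exists L => //; apply: le_mean_le hA => //; first exact: ltW.
by move=> t; apply: le_indic; apply: open_level_expanding.1.
Qed.

Let H_upper s e : 0 < e -> exists2 L, 0 < L & forall l, L <= l ->
  mean_le (\1_(G' s)) l (H s + e).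
Proof.
move=> e0; have e20 : 0 < e / 2 by lra.
have hi : has_inf [set A | exists2 L, 0 < L & mean_le (\1_(G' s)) L A].
  by split; [exists 1; exact: H_nonempty|exact: H_lbound].
have [A [l1 l10 hA] ltA] := inf_adherent e20 hi.
have [L L0 hL] := mean_le_eventually (wG s) l10 e20 hA.
exists L => // l Ll; apply: mean_leW (hL l Ll).
  exact: ltW (lt_le_trans L0 Ll).
by rewrite -/(H s) in ltA; lra.
Qed.

(** A window where [G' s] is dense is carried by almost periods close to any
    other window, at the price of enlarging the level. *)
Let H_lower s eta e : 0 < eta <= 1 -> 0 < e -> exists2 L, 0 < L & forall l xi, L <= l ->
  (H s - e) * l <= window (\1_(G' (s + eta))) xi l.
Proof.
move=> eta01 e0; pose gamma := eta * e / 8.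
have gamma0 : 0 < gamma by rewrite /gamma; have := eta01; nra.
have [l1 l10 [a a0 dense]] := apf gamma0.
exists (Num.max l1 (4 * a / e)) => [|l xi]; first by rewrite lt_max l10.
rewrite ge_max ler_pdivrMr// => /andP[l1l al].
have l0 : 0 < l by exact: lt_le_trans l1l.
have l0' := ltW l0.
(* A window where the density is nearly attained. *)
have [xi0 hxi0] : exists xi0, (H s - e / 4) * l < window (\1_(G' s)) xi0 l.
  apply: contrapT => nx.
  have : H s <= H s - e / 4; last by lra.
  apply: ge_inf; first exact: H_lbound.
  by exists l => // xi0; rewrite leNgt; apply/negP => hx; apply: nx; exists xi0.
have [tau [/= htau ptau]] := dense (xi - xi0).
have {}ptau : period_le sigma f l (2 * gamma) tau.
  by apply: mean_le_double ptau => //; exact: wp.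
have eta0 : 0 < eta by case/andP: eta01.
have wG1 := weight_shift tau (wG (s + eta)).
have wb := weightZ (ltW (_ : 0 < eta^-1)) (wp tau).
have le1 : window (\1_(G' s)) xi0 l <=
    window (\1_(G' (s + eta))) (xi0 + tau) l + eta^-1 * (2 * gamma * l).
  rewrite -(window_shift _ _ (wG (s + eta)) l0').
  apply: le_trans (_ : window ((fun t => \1_(G' (s + eta)) (t + tau) : R) \+
    (fun t => eta^-1 * sigma (f t) (f (t + tau)))) xi0 l <= _).
    apply: le_window => //.
      by apply: weightD => //; apply: wb; rewrite invr_gt0.
    move=> t /=; have [Gt|nGt] := pselect (G' s t); last first.
      by rewrite (indicF nGt) addr_ge0// (weight_ge0 t (wb _))// invr_gt0.
    rewrite (indicT Gt); have [bt|bt] := ltP (beta t (t + tau)) eta.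
      rewrite indicT; last exact: (open_level_expanding.2 _ _ _ _ eta01 bt Gt).
      by rewrite lerDl (weight_ge0 t (wb _))// invr_gt0.
    have : 1 <= eta^-1 * sigma (f t) (f (t + tau)) by rewrite mulrC ler_pdivlMr// mul1r.
    have := indic01 (G' (s + eta)) (t + tau); lra.
  rewrite windowD//; last by apply: wb; rewrite invr_gt0.
  have i0' : 0 <= eta^-1 by rewrite invr_ge0 ltW.
  by rewrite windowZ// lerD2l ler_wpM2l.
have e1 : eta^-1 * (2 * gamma * l) = e / 4 * l.
  by rewrite /gamma; field; rewrite lt0r_neq0.
rewrite e1 in le1.
move: htau; rewrite in_itv/= => /andP[t1 t2].
have le2 : window (\1_(G' (s + eta))) (xi0 + tau) l <=
    window (\1_(G' (s + eta))) xi l + a.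
  apply: le_trans (_ : window (\1_(G' (s + eta))) xi (l + a) <= _).
    by apply: window_sub => //; lra.
  rewrite (window_split _ _ l0' (ltW a0))// lerD2l.
  apply: le_trans (_ : window (cst 1) (xi + l) a <= _).
    apply: le_window => //; [exact: weight_cst|exact: ltW|].
    by move=> t; case/andP: (indic01 (G' (s + eta)) t).
  by rewrite window_cst ?mul1r// ltW.
lra.
Qed.

(** The band between two nearby levels is rare when the level is a continuity
    point of the asymptotic density [H]; outside the band, two times that are
    on different sides of the level are far apart for [beta]. *)
Lemma exists_controlled_level a b : a < b ->
  exists2 s, a < s < b & controlled (indic_dist (G' s)).
Proof.
(* The density enters through these three properties only. *)
move: (H_mono) (H_upper) (H_lower); generalize H => D mono upper lower ab.
have [s sab cs] := monotone_continuity_point mono ab.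
exists s => // e e0.
have e80 : 0 < e / 8 by lra.
have [eta' eta'0 heta'] := cs _ e80.
have [eta eta01 eta2] : exists2 eta, 0 < eta <= 1 & 2 * eta <= eta'.
  exists (Num.min 1 (eta' / 2)).
    by rewrite lt_min ge_min lexx ltr01/= andbT divr_gt0.
  by rewrite mulrC -ler_pdivlMr// ge_min lexx orbT.
have {}heta : D (s + eta) - D (s - 2 * eta) < e / 8.
  have h1 : D (s + eta) <= D (s + eta') by apply: mono; lra.
  have h2 : D (s - eta') <= D (s - 2 * eta) by apply: mono; lra.
  lra.
have [L1 L10 hL1] := upper (s + eta) _ e80.
have [L2 L20 hL2] := lower (s - 2 * eta) _ _ eta01 e80.
have eta0 : 0 < eta by case/andP: eta01.
have gamma0 : 0 < eta * (e / 8) by apply: mulr_gt0.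
exists (eta * (e / 8)) => //; exists (Num.max L1 L2) => [|l tau].
  by rewrite lt_max L10.
rewrite ge_max => /andP[l1 l2] ptau xi.
have l0 : 0 < l by exact: lt_le_trans l1.
have l0' := ltW l0.
(* The band: two times on different sides of level [s] that are [eta]-close
   both lie in it. *)
pose B := G' (s + eta) `\` G' (s - eta).
have mB : measurable B by apply: measurableD; exact: open_level_measurable.
have hB : window (\1_B) xi l <= 3 * (e / 8) * l.
  have sub : G' (s - eta) `<=` G' (s + eta) by apply: open_level_expanding.1; lra.
  have : window (\1_(G' (s + eta))) xi l =
      window (\1_B) xi l + window (\1_(G' (s - eta))) xi l.
    rewrite -windowD//; last exact: weight_indic.
    congr (window _ _ _); apply/funext => t /=.
    have [Gm|nGm] := pselect (G' (s - eta) t).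
      rewrite (indicT Gm) (indicT (sub _ Gm)) indicF ?add0r//.
      by case.
    rewrite (indicF nGm) addr0; have [Gp|nGp] := pselect (G' (s + eta) t).
      by rewrite (indicT Gp) indicT.
    by rewrite (indicF nGp) indicF// => -[].
  have := hL1 l l1 xi; have := hL2 l xi l2.
  have -> : s - 2 * eta + eta = s - eta by ring.
  nra.
have wb := weightZ (ltW (_ : 0 < eta^-1)) (wp tau).
have i0 : 0 < eta^-1 by rewrite invr_gt0.
apply: le_trans (_ : window ((\1_B) \+
   (fun t => eta^-1 * sigma (f t) (f (t + tau)))) xi l <= _).
  apply: le_window.
  - by apply: weight_indicB; exact: open_level_measurable.
  - by apply: weightD; [exact: weight_indic|exact: wb].
  - exact: ltW.
  move=> t /=; rewrite /indic_dist.
  have := indicB_le1 (G' s) (G' s) t (t + tau); have := indic01 B t.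
  have [bt|bt] := ltP (beta t (t + tau)) eta; last first.
    have : 1 <= eta^-1 * sigma (f t) (f (t + tau)) by rewrite mulrC ler_pdivlMr// mul1r.
    lra.
  have := weight_ge0 t (wb i0) => /= w0.
  have [tt|ntt] := pselect (G' s t <-> G' s (t + tau)).
    by rewrite le_indicB//; lra.
  rewrite [\1_B t]indicT; first by rewrite /= in w0; lra.
  have sub x y : x <= y -> G' x `<=` G' y by exact: open_level_expanding.1.
  have tx := open_level_expanding.2 _ _ _ _ eta01 bt.
  have bt' : beta (t + tau) t < eta by rewrite /beta ssym.
  have xt := open_level_expanding.2 _ _ _ _ eta01 bt'.
  split; [apply: contrapT => nG|move=> Gm]; apply: ntt; split.
  - by move=> Gt; exfalso; apply: nG; apply: sub Gt; lra.
  - by move=> Gt; exfalso; apply: nG; exact: xt.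
  - by move=> _; rewrite -[s](subrK eta); exact: tx.
  - by move=> _; apply: sub Gm; lra.
have i0' := ltW i0.
rewrite windowD//; [|exact: weight_indic|exact: wb].
rewrite windowZ//.
have h2 : eta^-1 * window (fun t => sigma (f t) (f (t + tau))) xi l <=
    eta^-1 * (eta * (e / 8) * l).
  by apply: ler_wpM2l (ptau xi); exact: ltW.
have h3 : eta^-1 * (eta * (e / 8) * l) = e / 8 * l.
  by field; rewrite lt0r_neq0.
have : 0 < e * l by apply: mulr_gt0.
lra.
Qed.

End Level.

(** Up to a rare set the range of [f] is totally bounded: in one bounded window
    finitely many small balls suffice up to a small measure, and almost periods
    carry this to every window. Finitely many balls lie in a single [A n]. *)
Lemma rare_exhaustion (A : nat -> set R) eta e : 0 < eta -> 0 < e ->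
  (forall n, measurable (A n)) -> (forall n m, (n <= m)%N -> A n `<=` A m) ->
  (forall t, exists n, forall t', beta t t' < eta -> A n t') ->
  exists n, rare (~` A n) e.
Proof.
move=> eta0 e0 mA ndA cA.
case: (fv) => mf df.
pose E k := [set t | sigma (f t) (v k) < eta / 4].
have mE k : measurable (E k) by exact: measurable_sublevel.
pose gamma := eta * e / 32.
have gamma0 : 0 < gamma by rewrite /gamma; nra.
have [l l0 [a a0 dense]] := apf gamma0.
pose T n := ~` (\bigcup_(k in `I_n) E k).
have mT n : measurable (T n).
  by apply: measurableC; apply: bigcup_measurable => k _.
have [N hN] : exists n, window (\1_(T n)) 0 (l + a) <= e / 4 * l.
  apply: window_decreasing => //; [| |lra|nra].
    move=> n m nm t nt [k /= kn Ek]; apply: nt; exists k => //=.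
    exact: leq_trans kn nm.
  rewrite -subset0 => t Tt; have eta4 : 0 < eta / 4 by lra.
  have [k hk] := df t _ eta4.
  by apply: (Tt k.+1 I); exists k => /=.
have [n hn] : exists n, forall k, (k < N)%N -> forall t t', E k t ->
    beta t' t < eta / 4 -> A n t'.
  clear hN; elim: N => [|N [n hn]]; first by exists 0%N.
  have [[u Eu]|nE] := pselect (exists u, E N u); last first.
    exists n => k; rewrite ltnS leq_eqVlt => /predU1P[->|/hn//] t t' Et.
    by exfalso; apply: nE; exists t.
  have [m hm] := cA u; exists (maxn n m) => k.
  rewrite ltnS leq_eqVlt => /predU1P[->|kN] t t' Et bt; last first.
    by apply: (ndA n); [exact: leq_maxl|exact: hn kN t t' Et bt].
  apply: (ndA m); [exact: leq_maxr|apply: hm].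
  move: Eu Et bt; rewrite /E/beta/= => Eu Et bt.
  have := stri (v N) (f u) (f t'); have := stri (f t) (v N) (f t').
  by rewrite [sigma (v N) (f t)]ssym [sigma (f t) (f t')]ssym; lra.
exists n; exists l => // l' ll'.
have mAn : measurable (~` A n) by exact: measurableC.
have -> : e = 2 * (e / 2) by field.
apply: mean_le_double (ll') _ => //; first exact: weight_indic.
move=> xi; have [tau [/= htau ptau]] := dense (- xi).
move: htau; rewrite in_itv/= => /andP[t1 t2].
have wb := weightZ (ltW (_ : 0 < (eta / 4)^-1)) (wp tau).
have i0 : 0 < (eta / 4)^-1 by rewrite invr_gt0; lra.
have wT := weight_indic (mT N); have wTs := weight_shift tau wT.
apply: le_trans (_ : window ((fun t => \1_(T N) (t + tau)) \+
   (fun t => (eta / 4)^-1 * sigma (f t) (f (t + tau)))) xi l <= _).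
  apply: le_window.
  - exact: weight_indic.
  - by apply: weightD; [|exact: wb].
  - exact: ltW.
  move=> t /=; have w0 := weight_ge0 t (wb i0).
  have := indic01 (T N) (t + tau); have := indic01 (~` A n) t => h1 h2.
  have [bt|bt] := ltP (beta t (t + tau)) (eta / 4); last first.
    have : 1 <= (eta / 4)^-1 * sigma (f t) (f (t + tau)).
      by rewrite mulrC ler_pdivlMr ?mul1r//; lra.
    lra.
  have [Tt|/contrapT[k /= kN Ekt]] := pselect (T N (t + tau)).
    by rewrite (indicT Tt); rewrite /= in w0; lra.
  rewrite [X in X <= _]indicF; first by rewrite /= in w0; lra.
  by apply; apply: hn kN _ _ Ekt bt.
have l0' := ltW l0; have i0' := ltW i0.
rewrite windowD//; last exact: wb.
rewrite windowZ// (window_shift _ _ wT)//.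
have h1 : window (\1_(T N)) (xi + tau) l <= e / 4 * l.
  by apply: le_trans hN; apply: window_sub => //; lra.
have h2 : (eta / 4)^-1 * window (fun t => sigma (f t) (f (t + tau))) xi l <=
    (eta / 4)^-1 * (gamma * l).
  by apply: ler_wpM2l (ptau xi); exact: ltW.
have h3 : (eta / 4)^-1 * (gamma * l) = e / 8 * l.
  by rewrite /gamma; field; rewrite lt0r_neq0.
have : 0 < e * l by apply: mulr_gt0.
lra.
Qed.

End Controlled.

(** * Almost periodic selection of a code *)

Section Selection.
Context {R : realType} {V : Type}.
Implicit Types (xi l A B tau e h t s u : R) (E F : set R) (K : R -> R -> R).
Implicit Types (b : R -> R).
Variables (sigma : V -> V -> R) (f : R -> V) (v : nat -> V).
Hypotheses (psigma : bounded_pseudometric sigma) (fv : borel_separable sigma f v).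
Hypothesis apf : weyl_ap sigma f.

Let beta t s := sigma (f t) (f s).

Lemma asymptotic_le_sum (I : Type) (r : seq I) (F : I -> R -> R) (B : I -> R) :
  (forall i, weight (F i)) -> (forall i, asymptotic_le (F i) (B i)) ->
  asymptotic_le (fun t => \sum_(i <- r) F i t) (\sum_(i <- r) B i).
Proof.
move=> wF hF; elim: r => [|i r [L L0 hL]].
  exists 1 => // l l1 xi; rewrite big_nil mul0r.
  under [X in window X]funext do rewrite big_nil.
  by rewrite (window_cst xi (lexx 0))//; [rewrite mul0r|lra].
have [L' L'0 hL'] := hF i; exists (Num.max L L'); first by rewrite lt_max L0.
move=> l; rewrite ge_max => /andP[l1 l2].
under [X in mean_le X]funext do rewrite big_cons.
rewrite big_cons; apply: mean_leD; [exact: wF|exact: weight_sum| | |].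
- exact: ltW (lt_le_trans L0 l1).
- exact: hL'.
- exact: hL.
Qed.

Lemma asymptotic_leD b c e e' : weight b -> weight c ->
  asymptotic_le b e -> asymptotic_le c e' -> asymptotic_le (b \+ c) (e + e').
Proof.
move=> wb wc [L L0 hL] [L' L'0 hL']; exists (Num.max L L').
  by rewrite lt_max L0.
move=> l; rewrite ge_max => /andP[l1 l2]; apply: mean_leD => //.
- exact: ltW (lt_le_trans L0 l1).
- exact: hL.
- exact: hL'.
Qed.

Lemma le_asymptotic_le b c e : weight b -> weight c -> (forall t, b t <= c t) ->
  asymptotic_le c e -> asymptotic_le b e.
Proof.
move=> wb wc bc [L L0 hL]; exists L => // l Ll; apply: le_mean_le (hL l Ll) => //.
exact: ltW (lt_le_trans L0 Ll).
Qed.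

Local Notation controlled_by := (controlled_by sigma f).

Definition weight2 K : Prop := forall tau, weight (fun t => K t (t + tau)).

Lemma controlled_byD K K' e e' : weight2 K -> weight2 K' ->
  controlled_by K e -> controlled_by K' e' ->
  controlled_by (fun t u => K t u + K' t u) (e + e').
Proof.
move=> wK wK' [g g0 [L L0 hL]] [g' g'0 [L' L'0 hL']].
exists (Num.min g g'); first by rewrite lt_min g0.
exists (Num.max L L'); first by rewrite lt_max L0.
move=> l tau; rewrite ge_max => /andP[l1 l2] ptau.
have l0 : 0 <= l by exact: ltW (lt_le_trans L0 l1).
apply: (mean_leD (wK tau) (wK' tau) l0); [apply: hL => //|apply: hL' => //].
  by apply: mean_leW ptau => //; rewrite ge_min lexx.
by apply: mean_leW ptau => //; rewrite ge_min lexx orbT.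
Qed.

Lemma controlled_by_sum (I : Type) (r : seq I) (K : I -> R -> R -> R) (B : I -> R) :
  (forall i, weight2 (K i)) -> (forall i, controlled_by (K i) (B i)) ->
  controlled_by (fun t u => \sum_(i <- r) K i t u) (\sum_(i <- r) B i).
Proof.
move=> wK hK; elim: r => [|i r IH].
  exists 1 => //; exists 1 => // l tau l1 _ xi; rewrite big_nil mul0r.
  under [X in window X]funext do rewrite big_nil.
  by rewrite (window_cst xi (lexx 0))//; [rewrite mul0r|lra].
have -> : (fun t u => \sum_(j <- i :: r) K j t u) =
    (fun t u => K i t u + \sum_(j <- r) K j t u).
  by apply/funext => t; apply/funext => u; rewrite big_cons.
rewrite big_cons; apply: controlled_byD => // tau.
by apply: weight_sum => j; exact: (wK j tau).
Qed.

Lemma controlled_by_asymptotic b e : asymptotic_le b e ->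
  controlled_by (fun t _ => b t) e.
Proof. by move=> [L L0 hL]; exists 1 => //; exists L => // l tau /hL. Qed.

Lemma le_controlled_by K K' e : weight2 K -> weight2 K' ->
  (forall t u, K t u <= K' t u) -> controlled_by K' e -> controlled_by K e.
Proof.
move=> wK wK' KK' [g g0 [L L0 hL]]; exists g => //; exists L => // l tau Ll pt.
apply: le_mean_le (hL l tau Ll pt) => //; exact: ltW (lt_le_trans L0 Ll).
Qed.

Section NatValued.
Implicit Types P Q : R -> nat.

Definition nat_dist P t u : R := (P t != P u)%:R.

(** Weyl almost periodicity of a function with countably many values, relative
    to [f]; the last clause says that finitely many values suffice up to a
    rare set. *)
Definition discrete_ap P : Prop :=
  [/\ forall p, measurable [set t | P t = p],
      controlled sigma f (nat_dist P) &
      forall e, 0 < e -> exists p, rare [set t | (p < P t)%N] e].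

Lemma measurable_nat_preimage P (S : set nat) :
  (forall p, measurable [set t | P t = p]) -> measurable [set t | S (P t)].
Proof.
move=> mP; have -> : [set t | S (P t)] = \bigcup_(p in S) [set t | P t = p].
  by apply/seteqP; split => t /=; [exists (P t)|move=> [p Sp /= ->]].
exact: bigcup_measurable.
Qed.

Lemma weight2_nat_dist P : (forall p, measurable [set t | P t = p]) ->
  weight2 (nat_dist P).
Proof.
move=> mP tau; rewrite /nat_dist.
have mD : measurable (\bigcup_p ([set t | P t = p] `\` [set t | P (t + tau) = p])).
  apply: bigcup_measurable => p _; apply: measurableD => //.
  exact: (measurable_shift tau (mP p)).
have := weight_indic mD; congr weight; apply/funext => t.
case: eqVneq => [Ptt|/eqP Ptt].
  by rewrite indicF// => -[p _ [/= <-]]; rewrite Ptt.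
by rewrite indicT//; exists (P t) => //; split => //= h; exact: Ptt.
Qed.

Lemma weight2_indic_dist E : measurable E -> weight2 (indic_dist E).
Proof. by move=> mE tau; exact: weight_indicB. Qed.

Lemma discrete_ap_cst p : discrete_ap (fun=> p).
Proof.
split.
- move=> q; have [->|/eqP pq] := eqVneq p q.
    by rewrite (_ : mkset _ = setT)//; apply/seteqP; split.
  by rewrite (_ : mkset _ = set0)//; apply/seteqP; split.
- move=> e e0; exists 1 => //; exists 1 => // l tau l1 _ xi.
  rewrite /nat_dist eqxx/= (window_cst xi (lexx 0)) ?mul0r ?mulr_ge0//; lra.
- move=> e e0; exists p, 1 => // l l1 xi; rewrite ltnn.
  rewrite (_ : mkset _ = set0); last by apply/seteqP; split.
  rewrite indic0 (window_cst xi (lexx 0)) ?mul0r ?mulr_ge0//; lra.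
Qed.

Section Step.
Variables (P : R -> nat) (G : nat -> nat -> R -> set R) (b : nat -> nat -> R).
Hypotheses (apP : discrete_ap P) (eG : forall p n, expanding sigma f (G p n)).
Hypothesis b0 : forall p n, 0 < b p n.
Hypothesis cover : forall p, exists2 eta, 0 < eta & forall t, exists N,
  forall t', beta t t' < eta -> P t' = p -> exists2 n, (n <= N)%N & G p n 0 t'.

(** Choosing, at each time, the first admissible code. The levels are chosen so
    that admissibility is controlled; only finitely many admissibility tests
    matter up to a rare set, which makes the first admissible code almost
    periodic. *)
Lemma discrete_selection : exists Q, discrete_ap Q /\
  forall t, G (P t) (Q t) (b (P t) (Q t)) t /\
    forall n, (n < Q t)%N -> ~ G (P t) n 0 t.
Proof.
have [s hs] : {s : nat * nat -> R & forall q, 0 < s q < b q.1 q.2 /\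
    controlled sigma f (indic_dist (open_level (G q.1 q.2) (s q)))}.
  apply: (@choice _ _ (fun q x => 0 < x < b q.1 q.2 /\
    controlled sigma f (indic_dist (open_level (G q.1 q.2) x)))) => q.
  have [x x1 x2] := exists_controlled_level psigma fv apf (eG q.1 q.2) (b0 q.1 q.2).
  by exists x.
case: apP => mP cP tP.
pose G' p n := open_level (G p n) (s (p, n)).
have mG p n : measurable (G' p n) by exact: (open_level_measurable psigma fv (eG p n)).
have G0 p n t : G p n 0 t -> G' p n t.
  by move=> Gt; exists 0 => //; case/andP: (hs (p, n)).1.
have Gb p n t : G' p n t -> G p n (b p n) t.
  move=> [x xs Gx]; apply: (eG p n).1 Gx; apply: ltW.
  by case/andP: (hs (p, n)).1 => _; exact: lt_trans.
have exG t : exists n, `[< G' (P t) n t >].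
  have [eta eta0 /(_ t)[N hN]] := cover (P t).
  have [|//|n _ Gn] := hN t _ _; first by case: psigma => sxx _ _ _; rewrite /beta sxx.
  by exists n; apply/asboolP; exact: G0.
pose Q t := ex_minn (exG t).
have Qin t : G' (P t) (Q t) t.
  by rewrite /Q; case: ex_minnP => n /asboolP.
have Qmin t n : G' (P t) n t -> (Q t <= n)%N.
  by move=> Gn; rewrite /Q; case: ex_minnP => m _; apply; apply/asboolP.
have mQ n : measurable [set t | Q t = n].
  have -> : [set t | Q t = n] = \bigcup_p ([set t | P t = p] `&`
      (G' p n `\` \bigcup_(m in `I_n) G' p m)).
    apply/seteqP; split => t /=.
      move=> <-; exists (P t) => //; split => //; split; first exact: Qin.
      by move=> [m /= mQ /Qmin]; rewrite leqNgt mQ.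
    move=> [p _ [/= <- [Gn nG]]]; apply/eqP; rewrite eqn_leq Qmin//= leqNgt.
    by apply/negP => Qn; apply: nG; exists (Q t) => //; exact: Qin.
  apply: bigcup_measurable => p _; apply: measurableI => //.
  by apply: measurableD => //; apply: bigcup_measurable.
(* [~` A p n] collects the times with previous code [p] at which no code up to
   [n] is admissible. *)
pose A p n := [set t | P t = p -> exists2 m, (m <= n)%N & G' p m t].
have mA p n : measurable (A p n).
  have -> : A p n = ~` ([set t | P t = p] `\` \bigcup_(m in `I_n.+1) G' p m).
    apply/seteqP; split => t /=.
      by move=> At [Pt]; apply; have [m mn Gm] := At Pt; exists m.
    move=> nt Pt; apply: contrapT => nA; by apply: nt; split.
  apply: measurableC; apply: measurableD => //.
  by apply: bigcup_measurable.
have ndA p n m : (n <= m)%N -> A p n `<=` A p m.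
  by move=> nm t At /At[k kn Gk]; exists k => //; exact: leq_trans kn nm.
have rA p e : 0 < e -> exists n, rare (~` A p n) e.
  move=> e0; have [eta eta0 heta] := cover p.
  apply: (rare_exhaustion psigma fv apf eta0 e0 (mA p)); first exact: ndA.
  move=> t; have [N hN] := heta t; exists N => t' bt Pt.
  by have [n nN Gn] := hN t' bt Pt; exists n => //; exact: G0.
(* Outside [B p0 N] only finitely many pairs of codes occur. *)
pose B p0 N := [set t | (p0 < P t)%N \/ (N < Q t)%N].
have mB p0 N : measurable (B p0 N).
  have -> : B p0 N = [set t | [set p | (p0 < p)%N] (P t)] `|`
      [set t | [set n | (N < n)%N] (Q t)] by [].
  by apply: measurableU; exact: measurable_nat_preimage.
have rB e : 0 < e -> exists p0 N, rare (B p0 N) e.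
  move=> e0; have e20 : 0 < e / 2 by lra.
  have [p0 rP] := tP _ e20.
  have e1 : 0 < e / 2 / p0.+1%:R by rewrite divr_gt0.
  have [Nf hNf] : {Nf : nat -> nat & forall p, rare (~` A p (Nf p)) (e / 2 / p0.+1%:R)}.
    by apply: (@choice _ _ (fun p n => rare (~` A p n) (e / 2 / p0.+1%:R))) => p; exact: rA.
  pose N := \max_(p < p0.+1) Nf p; exists p0, N.
  have wA p : weight (\1_(~` A p (Nf p)) : R -> R).
    by apply: weight_indic; apply: measurableC.
  have mP0 : measurable [set t | (p0 < P t)%N].
    exact: (@measurable_nat_preimage P [set p | (p0 < p)%N]).
  have : asymptotic_le ((\1_[set t | (p0 < P t)%N] : R -> R) \+
      (fun t => \sum_(p < p0.+1) \1_(~` A p (Nf p)) t))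
      (e / 2 + \sum_(p < p0.+1) (e / 2 / p0.+1%:R)).
    apply: asymptotic_leD => //; first exact: weight_indic.
      by apply: weight_sum.
    by apply: asymptotic_le_sum => // p; exact: hNf.
  have -> : e / 2 + \sum_(p < p0.+1) (e / 2 / p0.+1%:R) = e.
    rewrite sumr_const card_ord -[_ *+ p0.+1]mulr_natr divfK ?pnatr_eq0//.
    by field.
  apply: le_asymptotic_le; first exact: weight_indic.
    by apply: weightD; [exact: weight_indic|exact: weight_sum].
  move=> t /=; have S0 : 0 <= \sum_(p < p0.+1) \1_(~` A p (Nf p)) t :> R.
    by apply: sumr_ge0.
  have := indic01 [set t | (p0 < P t)%N] t; have := indic01 (B p0 N) t => i1 i2.
  have [Bt|nB] := pselect (B p0 N t); last by rewrite (indicF nB); lra.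
  rewrite (indicT Bt); have [Pt|Pt] := ltnP p0 (P t).
    by rewrite [X in _ <= X + _]indicT//; lra.
  suff : 1 <= \sum_(p < p0.+1) \1_(~` A p (Nf p)) t :> R by lra.
  have Pt' : (P t < p0.+1)%N by [].
  rewrite (bigD1 (Ordinal Pt'))//= indicT ?lerDl ?sumr_ge0//.
  move=> /(_ erefl)[m mN /Qmin Qm]; case: Bt; first by rewrite ltnNge Pt.
  rewrite ltnNge (leq_trans Qm)// (leq_trans mN)//.
  exact: (leq_bigmax (Ordinal Pt')).
exists Q; split; last first.
  by move=> t; split; [exact/Gb/Qin|move=> n nQ /G0/Qmin; rewrite leqNgt nQ].
split => //; last first.
  move=> e /rB[p0 [N rN]]; exists N; apply: le_asymptotic_le rN.
  - by apply: weight_indic; exact: (@measurable_nat_preimage Q [set p | (N < p)%N]).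
  - exact: weight_indic.
  - by move=> t; apply: le_indic => h; right.
move=> e e0; have e40 : 0 < e / 4 by lra.
have [p0 [N rN]] := rB _ e40.
(* If [P] agrees at two times outside [B p0 N] while [Q] differs, then one of
   the finitely many admissibility tests gives different answers. *)
pose M : R := (p0.+1 * N.+1)%:R.
have M0 : 0 < e / 4 / M by rewrite divr_gt0 // ltr0n.
have wI (i : 'I_p0.+1 * 'I_N.+1) : weight2 (indic_dist (G' i.1 i.2)).
  exact: weight2_indic_dist.
have wS : weight2 (fun t u => \sum_(i : 'I_p0.+1 * 'I_N.+1)
    indic_dist (G' i.1 i.2) t u).
  by move=> tau; apply: weight_sum => i; exact: (wI i tau).
have wB : weight2 (fun t _ => \1_(B p0 N) t) by move=> tau; exact: weight_indic.
have wPd := weight2_nat_dist mP.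
have : controlled_by (fun t u => nat_dist P t u + (\1_(B p0 N) t +
    \sum_(i : 'I_p0.+1 * 'I_N.+1) indic_dist (G' i.1 i.2) t u))
    (e / 4 + (e / 4 + \sum_(i : 'I_p0.+1 * 'I_N.+1) e / 4 / M)).
  apply: controlled_byD => //; [|exact: cP|].
    by move=> tau; apply: weightD; [exact: wB|exact: wS].
  apply: controlled_byD => //; first exact: controlled_by_asymptotic.
  by apply: controlled_by_sum => // i; apply: (hs (val i.1, val i.2)).2.
have -> : e / 4 + (e / 4 + \sum_(i : 'I_p0.+1 * 'I_N.+1) e / 4 / M) = 3 * (e / 4).
  rewrite sumr_const card_prod !card_ord -[_ *+ (_ * _)]mulr_natr divfK.
    by field.
  by rewrite pnatr_eq0.
move=> ctl; have {ctl} : controlled_by (fun t u => nat_dist P t u + (\1_(B p0 N) t +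
    \sum_(i : 'I_p0.+1 * 'I_N.+1) indic_dist (G' i.1 i.2) t u)) e.
  have [g g0 [L L0 hL]] := ctl; exists g => //; exists L => // l tau Ll pt.
  apply: mean_leW (hL l tau Ll pt); [exact: ltW (lt_le_trans L0 Ll)|lra].
apply: le_controlled_by; first exact: weight2_nat_dist.
  move=> tau; apply: weightD; first exact: wPd.
  by apply: weightD; [exact: wB|exact: wS].
move=> t u; set S := (X in _ <= _ + (_ + X)).
have S0 : 0 <= S by apply: sumr_ge0 => i _; exact: normr_ge0.
have nd01 (W : R -> nat) : 0 <= nat_dist W t u <= 1.
  by rewrite /nat_dist; case: (_ != _); rewrite ?lexx ?ler01.
have := nd01 P; have := nd01 Q; have := indic01 (B p0 N) t => i1 i2 i3.
have [PP|PP] := eqVneq (P t) (P u); last first.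
  have -> : nat_dist P t u = 1 by rewrite /nat_dist PP.
  lra.
have [Bt|nB] := pselect (B p0 N t); first by rewrite (indicT Bt); lra.
have Pp : (P t < p0.+1)%N.
  by rewrite ltnS leqNgt; apply/negP => h; apply: nB; left.
have QN : (Q t < N.+1)%N.
  by rewrite ltnS leqNgt; apply/negP => h; apply: nB; right.
have sep : (exists n : 'I_N.+1, ~ (G' (P t) n t <-> G' (P t) n u)) -> 1 <= S.
  move=> [n nG]; rewrite /S (bigD1 (Ordinal Pp, n))//= /indic_dist.
  apply: le_trans (_ : `|\1_(G' (P t) n) t - \1_(G' (P t) n) u : R| <= _); last first.
    by rewrite lerDl sumr_ge0// => i _; exact: normr_ge0.
  have [Gt|nGt] := pselect (G' (P t) n t).
    by rewrite (indicT Gt) indicF ?subr0 ?normr1// => Gu; apply: nG.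
  rewrite (indicF nGt) indicT ?sub0r ?normrN1//.
  by apply: contrapT => nGu; apply: nG.
have [QQ|QQ] := eqVneq (Q t) (Q u).
  have -> : nat_dist Q t u = 0 by rewrite /nat_dist QQ eqxx.
  lra.
suff : 1 <= S by lra.
apply: sep; have Qt := Qin t; have Qu := Qin u; rewrite -PP in Qu.
have [Qtu|Qut] := leqP (Q t) (Q u).
  exists (Ordinal QN) => -[/(_ Qt) /= + _]; rewrite PP => /Qmin Qut.
  by move: QQ; rewrite eqn_leq Qtu Qut.
have QuN : (Q u < N.+1)%N := ltn_trans Qut QN.
exists (Ordinal QuN) => -[_ /(_ Qu) /= /Qmin].
by rewrite leqNgt Qut.
Qed.

End Step.
End NatValued.
End Selection.

(** * The Levy-Prokhorov distance *)

Section Truncation.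
Context {R : realType} {V : Type}.
Variable sigma : V -> V -> R.
Hypotheses (sxx : forall x, sigma x x = 0) (ssym : forall x y, sigma x y = sigma y x).
Hypotheses (stri : forall x y z, sigma x z <= sigma x y + sigma y z).
Hypothesis sge0 : forall x y, 0 <= sigma x y.

Lemma trunc_dist_le1 x y : trunc_dist sigma x y <= 1.
Proof. by rewrite /trunc_dist ge_min lexx. Qed.

Lemma trunc_dist_le x y : trunc_dist sigma x y <= sigma x y.
Proof. by rewrite /trunc_dist ge_min lexx orbT. Qed.

Lemma trunc_dist_lt x y e : e <= 1 -> (trunc_dist sigma x y < e) = (sigma x y < e).
Proof. by move=> e1; rewrite /trunc_dist gt_min ltNge e1. Qed.

Lemma bounded_pseudometric_trunc : bounded_pseudometric (trunc_dist sigma).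
Proof.
split.
- by move=> x; rewrite /trunc_dist sxx; apply/min_idPr.
- by move=> x y; rewrite /trunc_dist ssym.
- move=> x y z; rewrite /trunc_dist.
  have := stri x y z; have := sge0 x y; have := sge0 y z => h1 h2 h3.
  have m (a : R) : 0 <= a -> 0 <= Num.min 1 a by move=> a0; rewrite le_min ler01.
  have [xy|xy] := leP 1 (sigma x y).
    by apply: le_trans (trunc_dist_le1 x z) _; rewrite lerDl m.
  have [yz|yz] := leP 1 (sigma y z).
    by apply: le_trans (trunc_dist_le1 x z) _; rewrite lerDr.
  exact: le_trans (trunc_dist_le x z) h3.
- by move=> x y; rewrite trunc_dist_le1 andbT /trunc_dist le_min ler01 sge0.
Qed.

End Truncation.

Section LevyProkhorov.
Context {R : realType} {U : completeMetricType R}.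
Implicit Types (m : borel_probability U) (A B : set U) (x y : U) (e r eta : R).

Lemma ball_open x r : open (ball x r : set U).
Proof.
rewrite openE => y; rewrite ballEmdist/= => xy.
rewrite /interior; apply/nbhs_ballP; exists (r - mdist x y) => /=; first lra.
move=> z; rewrite !ballEmdist/= => yz; have := metric_triangle x y z; lra.
Qed.

Lemma open_borel A : open A -> measurable (A : set (borel U)).
Proof. by move=> oA; apply: sub_sigma_algebra. Qed.

Lemma ball_borel x r : measurable (ball x r : set (borel U)).
Proof. by apply: open_borel; exact: ball_open. Qed.

Lemma thicken_borel A e : measurable (thicken A e : set (borel U)).
Proof. by apply: open_borel; apply: bigcup_open => x _; exact: ball_open. Qed.

Definition mass m A : R := fine (m (A : set (borel U))).

Lemma massE m A : measurable (A : set (borel U)) -> m A = (mass m A)%:E.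
Proof. by move=> mA; rewrite /mass fineK// fin_num_measure. Qed.

Lemma le_mass m A B : measurable (A : set (borel U)) ->
  measurable (B : set (borel U)) -> A `<=` B -> mass m A <= mass m B.
Proof. by move=> mA mB AB; rewrite -lee_fin -!massE// le_measure ?inE. Qed.

Lemma mass_ge0 m A : 0 <= mass m A.
Proof. exact/fine_ge0/measure_ge0. Qed.

Lemma mass_le1 m A : measurable (A : set (borel U)) -> mass m A <= 1.
Proof. by move=> mA; rewrite -lee_fin -massE// probability_le1. Qed.

Lemma massU m A B : measurable (A : set (borel U)) ->
  measurable (B : set (borel U)) -> mass m (A `|` B) <= mass m A + mass m B.
Proof.
move=> mA mB; rewrite -lee_fin EFinD -!massE//; last exact: measurableU.
exact: measureU2.
Qed.

Lemma massC m A : measurable (A : set (borel U)) -> mass m (~` A) = 1 - mass m A.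
Proof.
move=> mA; apply: EFin_inj; rewrite EFinB -!massE//; last exact: measurableC.
exact: probability_setC.
Qed.

Lemma thickenS A e e' : e <= e' -> thicken A e `<=` thicken A e'.
Proof.
by move=> ee' y [x Ax]; rewrite ballEmdist/= => xy; exists x => //;
  rewrite ballEmdist/=; exact: lt_le_trans ee'.
Qed.

Definition lp_close m m' eta : Prop := forall A, measurable (A : set (borel U)) ->
  mass m A <= mass m' (thicken A eta) + eta.

Let lp_set m1 m2 : set R := [set eps : R | 0 < eps /\
  forall A : set (borel U), measurable A ->
    (m1 A <= m2 (thicken A eps) + eps%:E)%E /\
    (m2 A <= m1 (thicken A eps) + eps%:E)%E].

Let lp_setP m m' e : lp_set m m' e <-> [/\ 0 < e, lp_close m m' e & lp_close m' m e].
Proof.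
have E (n n' : borel_probability U) A (mA : measurable (A : set (borel U))) :
    (n A <= n' (thicken A e) + e%:E)%E = (mass n A <= mass n' (thicken A e) + e).
  by rewrite (massE n mA) (massE n' (thicken_borel A e)) -EFinD lee_fin.
split=> [[e0 he]|[e0 h1 h2]].
  by split=> // A mA; have [] := he A mA; rewrite !E.
by split=> // A mA; rewrite !E//; split; [exact: h1|exact: h2].
Qed.

Let lp_set1 m m' : lp_set m m' 1.
Proof.
apply/lp_setP; split => // A mA;
  by apply: le_trans (mass_le1 _ mA) _; rewrite lerDr mass_ge0.
Qed.

Let lp_set_lb m m' : has_lbound (lp_set m m').
Proof. by exists 0 => e [/ltW]. Qed.

Lemma levy_prokhorov_le1 m m' : levy_prokhorov m m' <= 1.
Proof. by apply: ge_inf; [exact: lp_set_lb|exact: lp_set1]. Qed.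

Lemma levy_prokhorov_ge0 m m' : 0 <= levy_prokhorov m m'.
Proof. by apply: lb_le_inf; [exists 1; exact: lp_set1|move=> e [/ltW]]. Qed.

Lemma levy_prokhorov_sym m m' : levy_prokhorov m m' = levy_prokhorov m' m.
Proof.
rewrite /levy_prokhorov; congr inf; apply/seteqP; split => e [e0 he]; split => //;
  by move=> A mA; have [] := he A mA.
Qed.

Lemma levy_prokhorov_lt m m' eta : levy_prokhorov m m' < eta -> lp_close m m' eta.
Proof.
have hi : has_inf (lp_set m m').
  by split; [exists 1; exact: lp_set1|exact: lp_set_lb].
move=> /(inf_lt hi.1)[e /lp_setP[e0 h _] lte] A mA.
apply: le_trans (h A mA) _; apply: lerD; last exact: ltW.
by apply: le_mass; try exact: thicken_borel; apply: thickenS; exact: ltW.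
Qed.

Lemma levy_prokhorov_le m m' eta : 0 < eta -> lp_close m m' eta ->
  lp_close m' m eta -> levy_prokhorov m m' <= eta.
Proof. by move=> e0 h1 h2; apply: ge_inf; [exact: lp_set_lb|exact/lp_setP]. Qed.

Lemma levy_prokhorovxx m : levy_prokhorov m m = 0.
Proof.
apply/eqP; rewrite eq_le levy_prokhorov_ge0 andbT; apply/ler_addgt0Pl => e e0.
rewrite addr0; apply: levy_prokhorov_le => // A mA;
  (apply: le_trans (_ : mass m (thicken A e) <= _); last by rewrite lerDl ltW);
  apply: le_mass => //; try exact: thicken_borel;
  by move=> x Ax; exists x => //; exact: ballxx.
Qed.

Lemma levy_prokhorov_triangle m1 m2 m3 :
  levy_prokhorov m1 m3 <= levy_prokhorov m1 m2 + levy_prokhorov m2 m3.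
Proof.
apply/ler_addgt0Pl => e e0.
pose a := levy_prokhorov m1 m2 + e / 2; pose b := levy_prokhorov m2 m3 + e / 2.
have step (n1 n2 n3 : borel_probability U) (c d : R) :
    lp_close n1 n2 c -> lp_close n2 n3 d -> lp_close n1 n3 (c + d).
  move=> h h' A mA; apply: le_trans (h A mA) _.
  apply: le_trans (lerD (h' _ (thicken_borel A c)) (lexx _)) _.
  rewrite -addrA [d + c]addrC lerD2r; apply: le_mass; try exact: thicken_borel.
  move=> z [y [x Ax xy] yz]; exists x => //; exact: ball_triangle xy yz.
have a1 : levy_prokhorov m1 m2 < a by rewrite /a; lra.
have b1 : levy_prokhorov m2 m3 < b by rewrite /b; lra.
have -> : e + (levy_prokhorov m1 m2 + levy_prokhorov m2 m3) = a + b.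
  by rewrite /a /b; field.
apply: levy_prokhorov_le.
- by have := levy_prokhorov_ge0 m1 m2; have := levy_prokhorov_ge0 m2 m3; lra.
- exact: step (levy_prokhorov_lt a1) (levy_prokhorov_lt b1).
- rewrite addrC; apply: (step _ m2); apply: levy_prokhorov_lt;
  by rewrite levy_prokhorov_sym.
Qed.

Lemma trunc_levy_prokhorov : trunc_dist (@levy_prokhorov R U) = levy_prokhorov.
Proof.
apply/funext => m; apply/funext => m'; rewrite /trunc_dist.
by apply/min_idPr; exact: levy_prokhorov_le1.
Qed.

Lemma bounded_pseudometric_levy_prokhorov :
  bounded_pseudometric (@levy_prokhorov R U).
Proof.
rewrite -trunc_levy_prokhorov; apply: bounded_pseudometric_trunc.
- exact: levy_prokhorovxx.
- exact: levy_prokhorov_sym.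
- exact: levy_prokhorov_triangle.
- exact: levy_prokhorov_ge0.
Qed.

Lemma bounded_pseudometric_trunc_mdist : bounded_pseudometric (trunc_dist (@mdist R U)).
Proof.
apply: bounded_pseudometric_trunc.
- exact: mdistxx.
- exact: metric_sym.
- exact: metric_triangle.
- exact: mdist_ge0.
Qed.

Lemma mass_bigcup m (A : (set U)^nat) e : (forall n, measurable (A n : set (borel U))) ->
  (forall n k, (n <= k)%N -> A n `<=` A k) -> \bigcup_n A n = setT -> 0 < e ->
  exists n, 1 - e < mass m (A n).
Proof.
move=> mA ndA AT e0.
have : (m \o (A : (set (borel U))^nat)) n @[n --> \oo] --> m (\bigcup_n (A n : set (borel U))).
  apply: nondecreasing_cvg_mu => //; first exact: bigcup_measurable.
  by move=> n k nk; apply/subsetPset; exact: ndA.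
rewrite AT probability_setT => /fine_cvgP[_ /cvgrPdist_lt/(_ _ e0)[N _ /(_ N (leqnn N))]].
move=> /= h; exists N; move: h; rewrite /mass ltr_norml; lra.
Qed.

Variable x : nat -> U.
Hypothesis dx : forall u e, 0 < e -> exists k, mdist u (x k) < e.

(** Each measure gives mass close to 1 to finitely many small balls, and this
    persists on a Levy-Prokhorov neighbourhood of a size depending on [kappa]
    and [r] only. Hence a set of mass [kappa] meets one of finitely many balls
    that carries a definite share of the mass. *)
Lemma uniform_heavy_ball kappa r : 0 < kappa -> 0 < r ->
  exists2 eta, 0 < eta <= 1 & forall m, exists J c, 0 < c /\
    forall m' B, levy_prokhorov m m' < eta -> measurable (B : set (borel U)) ->
      kappa < mass m' B ->
      exists2 j, (j < J)%N & c < mass m' (ball (x j) r) /\ B `&` ball (x j) r !=set0.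
Proof.
move=> k0 r0; pose eta := Num.min 1 (Num.min (r / 2) (kappa / 4)).
have eta0 : 0 < eta by rewrite /eta !lt_min ltr01/= !divr_gt0.
have etar : eta <= r / 2 by rewrite /eta !ge_min lexx !orbT.
have etak : eta <= kappa / 4 by rewrite /eta !ge_min lexx !orbT.
exists eta; first by rewrite eta0 /eta ge_min lexx.
move=> m; pose W s n : set U := \bigcup_(j in `I_n) ball (x j) s.
have mW s n : measurable (W s n : set (borel U)).
  by apply: bigcup_measurable => j _; exact: ball_borel.
have k40 : 0 < kappa / 4 by lra.
have [J hJ] : exists J, 1 - kappa / 4 < mass m (W (r / 2) J).
  apply: mass_bigcup => //.
    by move=> n k nk y [j /= jn yj]; exists j => //=; exact: leq_trans jn nk.
  apply/seteqP; split => // y _; have r20 : 0 < r / 2 by lra.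
  have [k yk] := dx y r20; exists k.+1 => //; exists k => //=.
  by rewrite ballEmdist/= metric_sym.
(* If every ball meeting [B] carried at most this share, then [B] would have mass
   at most [kappa / 2] inside the balls and less than [kappa / 2] outside. *)
exists J, (kappa / 2 / J.+1%:R); split; first by rewrite !divr_gt0.
move=> m' B mm' mB hB.
have hW : 1 - kappa / 2 < mass m' (W r J).
  have := levy_prokhorov_lt mm' (mW (r / 2) J).
  have : mass m' (thicken (W (r / 2) J) eta) <= mass m' (W r J).
    apply: le_mass; [exact: thicken_borel|exact: mW|].
    move=> z [y [j /= jJ xy] yz]; exists j => //.
    have := ball_triangle xy yz; rewrite !ballEmdist/=; lra.
  lra.
apply: contrapT => nj.
have small j : (j < J)%N -> mass m' (B `&` ball (x j) r) <= kappa / 2 / J.+1%:R.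
  move=> jJ; have mI : measurable (B `&` ball (x j) r : set (borel U)).
    by apply: measurableI => //; exact: ball_borel.
  have [BI|] := pselect (B `&` ball (x j) r !=set0); last first.
    move=> /set0P/negP/negPn/eqP ->; rewrite /mass measure0/=.
    by rewrite !divr_ge0// ltW.
  apply: le_trans (_ : mass m' (ball (x j) r) <= _).
    by apply: le_mass => //; exact: ball_borel.
  by rewrite leNgt; apply/negP => h; apply: nj; exists j.
have upto n : (n <= J)%N -> mass m' (B `&` W r n) <= n%:R * (kappa / 2 / J.+1%:R).
  elim: n => [_|n IH nJ].
    by rewrite mul0r /W II0 bigcup_set0 setI0 /mass measure0.
  have mIn : measurable (B `&` W r n : set (borel U)) by exact: measurableI.
  have mIb : measurable (B `&` ball (x n) r : set (borel U)).
    by apply: measurableI => //; exact: ball_borel.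
  apply: le_trans (_ : mass m' ((B `&` W r n) `|` (B `&` ball (x n) r)) <= _).
    apply: le_mass; [exact: measurableI|exact: measurableU|].
    move=> y [By [j /= + xy]]; rewrite ltnS leq_eqVlt => /predU1P[jn|jn].
      by right; rewrite -jn.
    by left; split => //; exists j.
  apply: le_trans (massU _ mIn mIb) _.
  by rewrite -natr1 mulrDl mul1r lerD// ?IH ?small// ltnW.
have J1 : J%:R * (kappa / 2 / J.+1%:R) <= kappa / 2.
  rewrite mulrCA -[leRHS]mulr1 ler_wpM2l//; first lra.
  by rewrite ler_pdivrMr// mul1r ler_nat.
have mIJ : measurable (B `&` W r J : set (borel U)) by exact: measurableI.
have mCJ : measurable (~` W r J : set (borel U)) by exact: measurableC.
have : mass m' B <= mass m' (B `&` W r J) + mass m' (~` W r J).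
  apply: le_trans (massU _ mIJ mCJ); apply: le_mass => //; first exact: measurableU.
  by move=> y By; have [Wy|nWy] := pselect (W r J y); [left|right].
rewrite massC//; have := le_trans (upto J (leqnn J)) J1.
by clear -hW hB; lra.
Qed.

End LevyProkhorov.

(** * Construction of the selection *)

Section Construction.
Context {R : realType} {U : completeMetricType R}.
Variables (g : R -> U) (mu : R -> borel_probability U).
Variables (x : nat -> U) (v : nat -> U * borel_probability U).
Hypothesis dx : forall u e, 0 < e -> exists k, mdist u (x k) < e.

Let sigma := max_dist (trunc_dist (@mdist R U)) (@levy_prokhorov R U).
Let z t := (g t, mu t).
Let beta t s := sigma (z t) (z s).

Hypotheses (zv : borel_separable sigma z v) (apz : weyl_ap sigma z).
Implicit Types (t s e r rho c kappa eta : R) (y : R -> U).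

Let psigma : bounded_pseudometric sigma.
Proof.
apply: bounded_pseudometric_max; first exact: bounded_pseudometric_trunc_mdist.
exact: bounded_pseudometric_levy_prokhorov.
Qed.

(** Centres of balls that move no faster than [z]. *)
Definition moderate y : Prop :=
  forall t t' eta, eta <= 1 -> beta t t' < eta -> mdist (y t) (y t') < eta.

Lemma beta_lt t t' eta : eta <= 1 -> beta t t' < eta ->
  mdist (g t) (g t') < eta /\ levy_prokhorov (mu t) (mu t') < eta.
Proof.
by move=> eta1; rewrite /beta /sigma /max_dist/= gt_max trunc_dist_lt// => /andP[].
Qed.

Lemma moderate_g : moderate g.
Proof. by move=> t t' eta e1 /(beta_lt e1)[]. Qed.

Lemma moderate_cst (u : U) : moderate (fun=> u).
Proof.
move=> t t' eta _; rewrite mdistxx; apply: le_lt_trans.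
by case: psigma => _ _ _ /(_ (z t) (z t'))/andP[].
Qed.

(** The radius grows twice as fast as the level, to absorb both the motion of
    the centre and the enlargement in the Levy-Prokhorov distance. *)
Definition mass_level y c rho s : set R :=
  [set t | c - s < mass (mu t) (ball (y t) (rho + 2 * s))].

Lemma mass_level_expanding y c rho : moderate y ->
  expanding sigma z (mass_level y c rho).
Proof.
move=> my; split.
  move=> s s' ss' t; rewrite /mass_level/= => h.
  have : mass (mu t) (ball (y t) (rho + 2 * s)) <=
      mass (mu t) (ball (y t) (rho + 2 * s')).
    apply: le_mass; try exact: ball_borel.
    by move=> w; rewrite !ballEmdist/=; lra.
  lra.
move=> s t t' eta /andP[eta0 eta1] bt; have yt := my t t' eta eta1 bt.
have [_ mt] := beta_lt eta1 bt; rewrite /mass_level/= => h.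
have := levy_prokhorov_lt mt (ball_borel (y t) (rho + 2 * s)).
have : mass (mu t') (thicken (ball (y t) (rho + 2 * s)) eta) <=
    mass (mu t') (ball (y t') (rho + 2 * (s + eta))).
  apply: le_mass; [exact: thicken_borel|exact: ball_borel|].
  move=> w [u]; rewrite !ballEmdist/= => yu uw.
  have := metric_triangle (y t') (y t) w; have := metric_triangle (y t) u w.
  by rewrite [mdist (y t') (y t)]metric_sym; lra.
lra.
Qed.

Lemma near_level_expanding (u : U) y rho : moderate y ->
  expanding sigma z (fun s => [set t | mdist u (y t) < rho + s]).
Proof.
move=> my; split; first by move=> s s' ss' t /=; lra.
move=> s t t' eta /andP[_ eta1] /(my t t' eta eta1) yt /= h.
have := metric_triangle u (y t) (y t'); lra.
Qed.

Lemma expandingI (G H : R -> set R) : expanding sigma z G ->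
  expanding sigma z H -> expanding sigma z (fun s => G s `&` H s).
Proof.
move=> [mG xG] [mH xH]; split.
  by move=> s s' ss' t [Gt Ht]; split; [exact: mG ss' _ Gt|exact: mH ss' _ Ht].
by move=> s t t' eta e bt [Gt Ht]; split; [exact: xG bt Gt|exact: xH bt Ht].
Qed.

(** A code [n] stands for a pair: a point of the dense sequence and a lower
    bound for the mass of a ball around it. *)
Definition decode n : nat * nat := odflt (0, 0)%N (unpickle n).
Definition center n : U := x (decode n).1.
Definition share n : R := (decode n).2.+1%:R^-1.

Lemma share_gt0 n : 0 < share n. Proof. by rewrite /share invr_gt0. Qed.

Lemma exists_code c : 0 < c -> exists q : nat, forall j : nat, exists2 n,
  n = pickle (j, q) & center n = x j /\ share n < c.
Proof.
move=> c0; have [q q0] : exists q, (q.+1%:R^-1 : R) < c.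
  by have [m _ /(_ m (leqnn m)) hm] := near_infty_natSinv_lt (PosNum c0); exists m.
exists q => j; exists (pickle (j, q)) => //.
by rewrite /center /share /decode pickleK.
Qed.

(** The ball around [y] carries mass; hence, by [uniform_heavy_ball], it meets one
    of finitely many balls of radius [r] that carry a definite share. This is the
    covering hypothesis of [discrete_selection]. *)
Lemma discrete_refinement (P : R -> nat) (y : nat -> R -> U) (rho kappa : nat -> R) r :
  discrete_ap sigma z P -> (forall p, moderate (y p)) -> 0 < r ->
  (forall p, 0 < kappa p) ->
  (forall t, kappa (P t) < mass (mu t) (ball (y (P t) t) (rho (P t)))) ->
  exists Q, discrete_ap sigma z Q /\ forall t,
    mdist (center (Q t)) (y (P t) t) < rho (P t) + 2 * r /\
    share (Q t) / 2 < mass (mu t) (ball (center (Q t)) (2 * r)).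
Proof.
move=> apP my r0 k0 inv.
pose G p n s := [set t | mdist (center n) (y p t) < rho p + r + s] `&`
  mass_level (fun=> center n) (share n) r s.
(* Levels below [b p n] keep the radius below [2 * r] and half of the share. *)
pose b (p n : nat) := Num.min (r / 2) (share n / 2).
have b0 p n : 0 < b p n by rewrite /b lt_min !divr_gt0// share_gt0.
have eG p n : expanding sigma z (G p n).
  apply: expandingI; first exact: near_level_expanding.
  by apply: mass_level_expanding; exact: moderate_cst.
have cover p : exists2 eta, 0 < eta & forall t, exists N,
    forall t', beta t t' < eta -> P t' = p -> exists2 n, (n <= N)%N & G p n 0 t'.
  have [eta /andP[eta0 eta1] heta] := uniform_heavy_ball dx (k0 p) r0.
  exists eta => // t; have [J [c [c0 hc]]] := heta (mu t).
  have [q hq] := exists_code c0.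
  exists (\max_(j < J) pickle (nat_of_ord j, q)) => t' bt Pt'.
  have [_ mt] := beta_lt eta1 bt.
  have := inv t'; rewrite Pt' => kt.
  have [j jJ [mj [w [yw xw]]]] := hc _ _ mt (ball_borel _ _) kt.
  have [n nE [cn sn]] := hq j; exists n.
    by rewrite nE; exact: (leq_bigmax (Ordinal jJ)).
  split; rewrite /mass_level/= !(mulr0, addr0, subr0) cn; last exact: lt_trans mj.
  move: yw xw; rewrite !ballEmdist/= => yw xw.
  have := metric_triangle (x j) w (y p t'); rewrite [mdist w _]metric_sym; lra.
have [Q [apQ hQ]] := discrete_selection psigma zv apz apP eG b0 cover.
exists Q; split=> // t; have [[/= h1 h2] _] := hQ t.
have b1 : b (P t) (Q t) <= r / 2 by rewrite /b ge_min lexx.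
have b2 : b (P t) (Q t) <= share (Q t) / 2 by rewrite /b ge_min lexx orbT.
split; first lra.
have : mass (mu t) (ball (center (Q t)) (r + 2 * b (P t) (Q t))) <=
    mass (mu t) (ball (center (Q t)) (2 * r)).
  apply: le_mass; try exact: ball_borel.
  by move=> w; rewrite !ballEmdist/=; lra.
move: h2; rewrite /mass_level/= => h2; apply: lt_le_trans.
by apply: le_lt_trans h2; move: b2; move: (share _) => S; lra.
Qed.

Variable delta : R.
Hypothesis delta01 : 0 < delta < 1.
(** The start costs [4 * r0] and the limit of the refinements [6 * rad 0]; together
    [delta]. *)
Let r0 := delta / 10.
Let r0_gt0 : 0 < r0. Proof. by case/andP: delta01 => d0 _; rewrite /r0 divr_gt0. Qed.
Let rad k : R := r0 / 2 ^+ k.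
Let rad_gt0 k : 0 < rad k. Proof. by rewrite /rad divr_gt0// exprn_gt0. Qed.
Let radS k : rad k.+1 = rad k / 2.
Proof. by rewrite /rad exprSr invfM mulrA. Qed.

Lemma mass_ball_large m (u : U) c : c < 1 ->
  exists n, c < mass m (ball u (n%:R * r0)).
Proof.
move=> c1; have c10 : 0 < 1 - c by lra.
have [|||n hn] := @mass_bigcup _ _ m (fun n => ball u (n%:R * r0)) _ _ _ _ c10.
- by move=> n; exact: ball_borel.
- move=> n k nk w; rewrite !ballEmdist/= => /lt_le_trans; apply.
  by rewrite ler_pM2r// ler_nat.
- apply/seteqP; split => // w _; exists (Num.truncn (mdist u w / r0)).+1 => //.
  rewrite ballEmdist/= -ltr_pdivrMr//.
  by have /truncn_itv/andP[] : 0 <= mdist u w / r0 by rewrite divr_ge0 ?mdist_ge0 ?ltW.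
by exists n; lra.
Qed.

(** [r_ delta] depends discontinuously on the time. It is approximated by the least
    multiple of [r0] whose ball carries mass [delta], tested at suitable levels, and
    that multiple is almost periodic. *)
Lemma exists_start : exists P, discrete_ap sigma z P /\ forall t,
  mdist (center (P t)) (g t) < r_ delta (g t) (mu t) + 4 * r0 /\
  share (P t) / 2 < mass (mu t) (ball (center (P t)) (2 * rad 0)).
Proof.
pose G (p n : nat) := mass_level g delta (n%:R * r0).
pose b (p n : nat) := Num.min (r0 / 2) (delta / 2).
have [d0 d1'] : 0 < delta /\ delta < 1 by apply/andP.
have b0 p n : 0 < b p n by rewrite /b lt_min !divr_gt0.
have eG p n : expanding sigma z (G p n).
  by apply: mass_level_expanding; exact: moderate_g.
have cover (p : nat) : exists2 eta, 0 < eta & forall t, exists N,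
    forall t', beta t t' < eta -> 0%N = p -> exists2 n, (n <= N)%N & G p n 0 t'.
  pose eta := Num.min 1 (Num.min (r0 / 2) ((1 - delta) / 2)).
  have eta0 : 0 < eta by rewrite /eta !lt_min ltr01 !divr_gt0//; lra.
  have eta1 : eta <= 1 by rewrite /eta ge_min lexx.
  have eta2 : eta <= r0 / 2 by rewrite /eta !ge_min lexx orbT.
  have eta3 : eta <= (1 - delta) / 2 by rewrite /eta !ge_min lexx !orbT.
  exists eta => // t.
  have d1 : (1 + delta) / 2 < 1 by lra.
  have [n hn] := mass_ball_large (mu t) (g t) d1.
  exists n.+1 => t' bt _; exists n.+1 => //.
  have [gt mt] := beta_lt eta1 bt.
  rewrite /G /mass_level/= !(mulr0, addr0, subr0).
  have := levy_prokhorov_lt mt (ball_borel (g t) (n%:R * r0)).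
  have : mass (mu t') (thicken (ball (g t) (n%:R * r0)) eta) <=
      mass (mu t') (ball (g t') (n.+1%:R * r0)).
    apply: le_mass; [exact: thicken_borel|exact: ball_borel|].
    move=> w [u]; rewrite !ballEmdist/= -natr1 mulrDl mul1r => gu uw.
    have := metric_triangle (g t') (g t) w; have := metric_triangle (g t) u w.
    by rewrite [mdist (g t') (g t)]metric_sym; lra.
  lra.
have [I [apI hI]] := discrete_selection psigma zv apz
  (discrete_ap_cst sigma z 0%N) eG b0 cover.
have [||||P [apP hP]] := @discrete_refinement I (fun=> g)
  (fun p => (p%:R + 1) * r0) (fun=> delta / 2) r0 apI.
- by move=> _; exact: moderate_g.
- exact: r0_gt0.
- by move=> _; lra.
- move=> t; have [h _] := hI t.
  have b1 : b 0%N (I t) <= r0 / 2 by rewrite /b ge_min lexx.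
  have b2 : b 0%N (I t) <= delta / 2 by rewrite /b ge_min lexx orbT.
  have : mass (mu t) (ball (g t) ((I t)%:R * r0 + 2 * b 0%N (I t))) <=
      mass (mu t) (ball (g t) (((I t)%:R + 1) * r0)).
    apply: le_mass; try exact: ball_borel.
    by move=> w; rewrite !ballEmdist/= mulrDl mul1r; lra.
  move: h; rewrite /G /mass_level/=; lra.
exists P; split => // t; have [h1 h2] := hP t; split; last first.
  by rewrite /rad expr0 divr1.
apply: lt_le_trans h1 _; have [_ hmin] := hI t.
have rge n : ~ delta < mass (mu t) (ball (g t) (n%:R * r0)) ->
    n%:R * r0 <= r_ delta (g t) (mu t).
  move=> /negP; rewrite -leNgt => nm; apply: lb_le_inf.
    have [|k hk] := @mass_ball_large (mu t) (g t) delta; first by case/andP: delta01.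
    exists (k.+1%:R * r0); split; first by rewrite mulr_gt0.
    rewrite (massE _ (ball_borel _ _)) lte_fin; apply: lt_le_trans hk _.
    apply: le_mass; try exact: ball_borel.
    move=> w; rewrite !ballEmdist/= => /lt_le_trans; apply.
    by rewrite ler_pM2r// ler_nat.
  move=> r [_]; rewrite (massE _ (ball_borel _ _)) lte_fin => hr.
  rewrite leNgt; apply/negP => rn.
  have : mass (mu t) (ball (g t) r) <= mass (mu t) (ball (g t) (n%:R * r0)).
    apply: le_mass; try exact: ball_borel.
    by move=> w; rewrite !ballEmdist/=; lra.
  lra.
have rd0 : 0 <= r_ delta (g t) (mu t).
  have /rge : ~ delta < mass (mu t) (ball (g t) (0%:R * r0)); last by rewrite mul0r.
  rewrite mul0r (_ : ball _ _ = set0); last first.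
    by rewrite -subset0 => w; rewrite ballEmdist/= ltNge mdist_ge0.
  by rewrite /mass measure0/=; lra.
have r0p : 0 < r0 := r0_gt0.
case E : (I t) => [|k]; first by rewrite add0r mul1r; lra.
have : k%:R * r0 <= r_ delta (g t) (mu t).
  apply: rge; have := hmin k; rewrite E ltnSn => /(_ isT).
  by rewrite /G /mass_level/= !(mulr0, addr0, subr0).
by rewrite -natr1; lra.
Qed.

Let heavy k (P : R -> nat) : Prop := discrete_ap sigma z P /\
  forall t, share (P t) / 2 < mass (mu t) (ball (center (P t)) (2 * rad k)).

(** Each step halves the radius and moves the centre by a multiple of the radius,
    which makes the centres converge uniformly in time. *)
Lemma exists_refinements : exists P : nat -> R -> nat,
  [/\ forall k, discrete_ap sigma z (P k),
      forall k t, share (P k t) / 2 < mass (mu t) (ball (center (P k t)) (2 * rad k)),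
      forall k t, mdist (center (P k.+1 t)) (center (P k t)) < 3 * rad k &
      forall t, mdist (center (P 0%N t)) (g t) < r_ delta (g t) (mu t) + 4 * r0].
Proof.
have [P0 [apP0 hP0]] := exists_start.
have step k (P : R -> nat) : exists Q : R -> nat, heavy k P -> heavy k.+1 Q /\
    forall t, mdist (center (Q t)) (center (P t)) < 3 * rad k.
  have [[apP hP]|nP] := pselect (heavy k P); last by exists P.
  have [|||Q [apQ hQ]] := @discrete_refinement P (fun p _ => center p)
    (fun=> 2 * rad k) (fun p => share p / 2) (rad k.+1) apP _ (rad_gt0 _).
  - by move=> p; exact: moderate_cst.
  - by move=> p; rewrite divr_gt0// share_gt0.
  - exact: hP.
  exists Q => _; split; first by split => // t; case: (hQ t).
  by move=> t; have [+ _] := hQ t; rewrite radS; lra.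
have [F hF] : {F : nat * (R -> nat) -> (R -> nat) & forall kP, heavy kP.1 kP.2 ->
    heavy kP.1.+1 (F kP) /\
    forall t, mdist (center (F kP t)) (center (kP.2 t)) < 3 * rad kP.1}.
  apply: (@choice _ _ (fun kP Q => heavy kP.1 kP.2 -> heavy kP.1.+1 Q /\
    forall t, mdist (center (Q t)) (center (kP.2 t)) < 3 * rad kP.1)) => kP.
  exact: step.
pose P := fix P k := if k is k'.+1 then F (k', P k') else P0.
have hP k : heavy k (P k).
  elim: k => [|k IH]; first by split => // t; case: (hP0 t).
  by have [] := hF (k, P k) IH.
exists P; split.
- by move=> k; case: (hP k).
- by move=> k; case: (hP k).
- by move=> k t; have [_] := hF (k, P k) (hP k); apply.
- by move=> t; case: (hP0 t).
Qed.

Lemma rad_small e : 0 < e -> exists k, rad k < e.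
Proof.
move=> e0; exists (Num.truncn (r0 / e)).+1; set k := _.+1.
have re0 : 0 <= r0 / e by rewrite divr_ge0// ltW.
have h : r0 / e < k%:R by case/andP: (truncn_itv re0).
rewrite /rad ltr_pdivrMr ?exprn_gt0// mulrC -ltr_pdivrMr//.
apply: lt_le_trans h _; rewrite -natrX ler_nat; exact/ltnW/ltn_expl.
Qed.

Section Limit.
Variable P : nat -> R -> nat.
Hypotheses (apP : forall k, discrete_ap sigma z (P k))
  (massP : forall k t,
    share (P k t) / 2 < mass (mu t) (ball (center (P k t)) (2 * rad k)))
  (stepP : forall k t, mdist (center (P k.+1 t)) (center (P k t)) < 3 * rad k).

Lemma refinements_cauchy k n t :
  mdist (center (P k t)) (center (P (k + n)%N t)) <= 6 * rad k.
Proof.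
have rp m : 0 < rad m := rad_gt0 m.
suff : mdist (center (P k t)) (center (P (k + n)%N t)) <= 6 * rad k - 6 * rad (k + n)%N.
  by have := rp (k + n)%N; lra.
elim: n => [|n IH]; first by rewrite addn0 mdistxx subrr.
have := metric_triangle (center (P k t)) (center (P (k + n)%N t))
  (center (P (k + n.+1)%N t)).
have := stepP (k + n)%N t; rewrite addnS [mdist (center (P (k + n).+1 t)) _]metric_sym.
rewrite radS; lra.
Qed.

Lemma refinements_limit t : exists u, forall k, mdist (center (P k t)) u <= 6 * rad k.
Proof.
pose X k := center (P k t).
have tail k e n : 6 * rad k < e -> (k <= n)%N -> ball (X k) e (X n).
  move=> ke /subnKC <-; rewrite ballEmdist/=.
  exact: le_lt_trans (refinements_cauchy k (n - k) t) ke.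
have rs e : 0 < e -> exists k, 6 * rad k < e.
  by move=> e0; have [|k hk] := @rad_small (e / 6); [lra|exists k; lra].
have cX : cauchy (X @ \oo).
  apply: cauchy_exP => e e0; have [k hk] := rs e e0.
  by exists (X k); exists k => // n /= kn; exact: tail.
have XL : X @ \oo --> lim (X @ \oo) := cauchy_cvg _ cX.
exists (lim (X @ \oo)) => k; apply/ler_addgt0Pl => e e0.
have [N _ hN] : \forall n \near \oo, ball (lim (X @ \oo)) e (X n).
  exact: XL (nbhsx_ballx _ _ e0).
have := hN (maxn N k) (leq_maxl _ _); rewrite ballEmdist/= metric_sym => h1.
have := metric_triangle (X k) (X (maxn N k)) (lim (X @ \oo)).
have := refinements_cauchy k (maxn N k - k) t.
rewrite subnKC ?leq_maxr// -/(X k) -/(X (maxn N k)); lra.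
Qed.

Variable f : R -> U.
Hypothesis fP : forall k t, mdist (center (P k t)) (f t) <= 6 * rad k.

(** The functions [center (P k t)] take countably many values, and converge
    uniformly to [f]. *)
Lemma limit_borel_separable : borel_separable (trunc_dist (@mdist R U)) f x.
Proof.
split; last first.
  move=> t e e0; have [k hk] := dx (f t) e0; exists k.
  exact: le_lt_trans (trunc_dist_le _ _ _) hk.
move=> i; rewrite /trunc_dist; apply: measurable_minr; first exact: measurable_cst.
apply: measurable_sublevels => c.
have -> : [set t | mdist (f t) (x i) < c] = \bigcup_k
    [set t | mdist (center (P k t)) (x i) + 6 * rad k < c].
  apply/seteqP; split => t /=; last first.
    move=> [k _ /=]; have := metric_triangle (f t) (center (P k t)) (x i).
    by have := fP k t; rewrite [mdist (f t) (center _)]metric_sym; lra.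
  move=> lc; have [|k hk] := @rad_small ((c - mdist (f t) (x i)) / 12); first lra.
  exists k => //=; have := metric_triangle (center (P k t)) (f t) (x i).
  by have := fP k t; lra.
apply: bigcup_measurable => k _; case: (apP k) => mPk _ _.
exact: (@measurable_nat_preimage R (P k)
  [set n | mdist (center n) (x i) + 6 * rad k < c]).
Qed.

(** Two values of [f] are within [12 * rad k] of each other whenever the codes
    [P k] agree. *)
Lemma limit_controlled :
  controlled sigma z (fun t u => trunc_dist (@mdist R U) (f t) (f u)).
Proof.
move=> e e0; have [|k hk] := @rad_small (e / 24); first lra.
have e20 : 0 < e / 2 by lra.
case: (apP k) => mPk /(_ _ e20)[gamma gamma0 [L L0 hL]] _.
have pf := @bounded_pseudometric_trunc_mdist R U.
exists gamma => //; exists L => // l tau Ll ptau.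
have l0 : 0 <= l by exact: ltW (lt_le_trans L0 Ll).
have wd := weight2_nat_dist mPk tau.
have wc : weight (cst (e / 2)) by apply: weight_cst; lra.
have hc : mean_le (cst (e / 2)) l (e / 2) by move=> xi; rewrite window_cst//; lra.
have := mean_leD wc wd l0 hc (hL l tau Ll ptau).
have -> : e / 2 + e / 2 = e by field.
apply: le_mean_le => //.
- exact: (weight_period pf limit_borel_separable).
- exact: weightD.
move=> t /=; rewrite /nat_dist; case: eqVneq => [PP|_].
  rewrite addr0; apply: le_trans (trunc_dist_le _ _ _) _.
  have := metric_triangle (f t) (center (P k t)) (f (t + tau)).
  have := fP k t; have := fP k (t + tau); rewrite -PP.
  by rewrite [mdist (f t) (center _)]metric_sym; lra.
by apply: le_trans (trunc_dist_le1 _ _ _) _; rewrite lerDr ltW.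
Qed.

(** Every neighbourhood of [f t] contains a ball of positive mass. *)
Lemma limit_supp t : supp (mu t) (f t).
Proof.
move=> O oO Of; have /nbhs_ballP[e /= e0 he] : nbhs (f t) O by exact: open_nbhs_nbhs.
have [|k hk] := @rad_small (e / 8); first lra.
have : 0 < mass (mu t) (ball (center (P k t)) (2 * rad k)).
  by apply: lt_trans (massP k t); rewrite divr_gt0// share_gt0.
move=> /lt_le_trans h; rewrite (massE _ (open_borel oO)) lte_fin; apply: h.
apply: le_mass; [exact: ball_borel|exact: open_borel|].
move=> w; rewrite ballEmdist/= => cw; apply: he; rewrite ballEmdist/=.
have := metric_triangle (f t) (center (P k t)) w; have := fP k t.
by rewrite [mdist (f t) (center _)]metric_sym; lra.
Qed.

End Limit.

Lemma exists_controlled_selection : exists f,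
  [/\ borel_separable (trunc_dist (@mdist R U)) f x,
      controlled sigma z (fun t u => trunc_dist (@mdist R U) (f t) (f u)),
      forall t, supp (mu t) (f t) &
      forall t, mdist (f t) (g t) < r_ delta (g t) (mu t) + delta].
Proof.
have [P [apP massP stepP startP]] := exists_refinements.
have [f fP] : {f : R -> U & forall t k, mdist (center (P k t)) (f t) <= 6 * rad k}.
  apply: (@choice _ _ (fun t u => forall k, mdist (center (P k t)) u <= 6 * rad k)).
  by move=> t; exact: (refinements_limit stepP t).
have {}fP k t := fP t k.
exists f; split.
- exact: (limit_borel_separable apP fP).
- exact: (limit_controlled apP fP).
- exact: (limit_supp massP fP).
move=> t; have := metric_triangle (f t) (center (P 0%N t)) (g t).
have := startP t; have := fP 0%N t; rewrite /rad expr0 divr1.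
rewrite [mdist (f t) (center _)]metric_sym.
have -> : delta = 10 * r0 by rewrite /r0; field.
lra.
Qed.

End Construction.

(** * Finite Fourier analysis *)

Section FiniteFourier.
Context {C : numClosedFieldType} {n' : nat}.
Local Notation N := n'.+1.
Variable w : C.
Hypothesis primw : N.-primitive_root w.
Implicit Types (f u : 'I_N -> C) (k m n s : 'I_N).

Let N0 : (N%:R : C) != 0. Proof. by rewrite pnatr_eq0. Qed.

(** The characters of the cyclic group of order [N]. *)
Definition wave k n : C := w ^+ (k * n).

Definition fourier f k : C := N%:R^-1 * \sum_n f n * (wave k n)^*.

Let w1 : `|w| = 1.
Proof.
apply/eqP; rewrite -(@pexpr_eq1 _ _ N)// -normrX (prim_expr_order primw).
by rewrite normr1.
Qed.

Lemma norm_wave k n : `|wave k n| = 1.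
Proof. by rewrite normrX w1 expr1n. Qed.

Lemma waveJ k n : wave k n * (wave k n)^* = 1.
Proof. by rewrite -normCK norm_wave expr1n. Qed.

Lemma waveD k n m : wave k (n + m) = wave k n * wave k m.
Proof.
rewrite /wave -exprD -mulnDr /= -(expr_mod _ (prim_expr_order primw)) modnMmr.
by rewrite expr_mod// prim_expr_order.
Qed.

Lemma wave_orthogonal n m : \sum_k wave k n * (wave k m)^* = (n == m)%:R * N%:R.
Proof.
have -> : \sum_k wave k n * (wave k m)^* = \sum_(k < N) (w ^+ n * (w ^+ m)^*) ^+ k.
  apply: eq_bigr => k _; rewrite exprMn /wave [(k * n)%N]mulnC [(k * m)%N]mulnC.
  by rewrite !exprM [in LHS]rmorphXn.
set x := _ * _; have xN : x ^+ N = 1.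
  by rewrite /x exprMn -rmorphXn -!exprM ![(_ * N)%N]mulnC !exprM
    (prim_expr_order primw) !expr1n rmorph1 mulr1.
have wm : w ^+ m * (w ^+ m)^* = 1 by rewrite -normCK normrX w1 !expr1n.
have [nm|nm] := eqVneq n m.
  rewrite /x nm wm; under eq_bigr do rewrite expr1n.
  by rewrite sumr_const card_ord mul1r.
have x1 : x - 1 != 0.
  rewrite subr_eq0; apply: contra nm => /eqP xE.
  have : w ^+ n = w ^+ m by rewrite -[LHS]mulr1 -wm mulrCA -/x xE mulr1.
  move/eqP; rewrite (eq_prim_root_expr primw) !modn_small//.
rewrite mul0r; apply: (mulfI x1); rewrite mulr0.
by have := subrX1 x N; rewrite xN subrr.
Qed.

Lemma fourier_shift f k m : fourier (fun n => f (n + m)) k = wave k m * fourier f k.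
Proof.
rewrite /fourier mulrCA; congr (_ * _).
rewrite (reindex_inj (addIr (- m)))/= mulr_sumr; apply: eq_bigr => n _.
have E : wave k n = wave k (n - m) * wave k m by rewrite -waveD subrK.
by rewrite subrK E rmorphM [RHS]mulrCA [_ * (_ * _^*)]mulrCA waveJ mulr1.
Qed.

Lemma parseval f : \sum_k `|fourier f k| ^+ 2 = N%:R^-1 * \sum_n `|f n| ^+ 2.
Proof.
have -> : \sum_k `|fourier f k| ^+ 2 = \sum_k \sum_n \sum_m
    (N%:R^-1 * N%:R^-1) * (f n * (f m)^*) * (wave k m * (wave k n)^*).
  apply: eq_bigr => k _; rewrite normCK /fourier rmorphM rmorph_sum mulrACA/=.
  have -> : (N%:R^-1 : C)^* = N%:R^-1 by rewrite fmorphV rmorph_nat.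
  rewrite big_distrlr/= mulr_sumr; apply: eq_bigr => n _.
  rewrite mulr_sumr; apply: eq_bigr => m _.
  by rewrite rmorphM/= conjCK; ring.
rewrite exchange_big/= mulr_sumr; apply: eq_bigr => n _.
rewrite exchange_big/= (bigD1 n)//= [X in _ + X]big1 ?addr0; last first.
  move=> m mn; rewrite -mulr_sumr wave_orthogonal (negbTE mn) mul0r mulr0.
  by [].
rewrite -mulr_sumr wave_orthogonal eqxx mul1r normCK.
by rewrite mulrAC -[X in X * _]mulrA mulVf// mulr1.
Qed.

Definition correlation u f s : C := N%:R^-1 * \sum_n u (n + s) * (f n)^*.

Lemma fourier_correlation u f k :
  fourier (correlation u f) k = fourier u k * (fourier f k)^*.
Proof.
rewrite {1}/fourier /correlation.
have -> : \sum_s (N%:R^-1 * (\sum_n u (n + s) * (f n)^*)) * (wave k s)^* =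
    \sum_n (f n)^* * fourier (fun s => u (s + n)) k.
  under eq_bigr do rewrite -mulrA mulr_suml mulr_sumr.
  rewrite exchange_big/=; apply: eq_bigr => n _.
  rewrite /fourier mulrCA mulr_sumr [RHS]mulr_sumr; apply: eq_bigr => s _.
  by rewrite [s + n]addrC; congr (_ * _); rewrite mulrAC mulrC.
under eq_bigr do rewrite fourier_shift mulrA.
rewrite -mulr_suml mulrA mulrC; congr (_ * _).
rewrite /fourier rmorphM rmorph_sum fmorphV rmorph_nat/=; congr (_ * _).
by apply: eq_bigr => n _; rewrite rmorphM/= conjCK.
Qed.

(** A Fourier coefficient that is not small detects the almost periods of [f],
    up to the twist [c], as approximate periods of its wave. *)
Lemma fourier_almost_period f k m (c : C) :
  `|c * wave k m - 1| * `|fourier f k| <=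
    N%:R^-1 * \sum_n `|c * f (n + m) - f n|.
Proof.
rewrite -normrM mulrBl mul1r -mulrA -fourier_shift /fourier mulrCA -mulrBr.
rewrite normrM ger0_norm ?invr_ge0 ?ler0n// ler_wpM2l ?invr_ge0 ?ler0n//.
rewrite mulr_sumr -sumrB; apply: le_trans (ler_norm_sum _ _ _) _.
apply: ler_sum => n _; rewrite mulrA -mulrBl normrM norm_conjC norm_wave mulr1.
by [].
Qed.

(** By Parseval the mean square of the correlation is a sum of products of
    Fourier weights, each family having total at most 1; hence one of the
    frequencies is significant for both functions. *)
Lemma common_wave u f : (forall n, `|u n| <= 1) -> (forall n, `|f n| <= 1) ->
  exists k, let S := N%:R^-1 * \sum_s `|correlation u f s| ^+ 2 in
    S <= 2 * `|fourier u k| /\ S <= 2 * `|fourier f k|.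
Proof.
move=> u1 f1; have iN : 0 <= (N%:R^-1 : C) by rewrite invr_ge0 ler0n.
have mean1 (h : 'I_N -> C) : (forall n, h n <= 1) -> N%:R^-1 * \sum_n h n <= 1.
  move=> h1; apply: le_trans (_ : N%:R^-1 * \sum_(n < N) 1 <= _).
    by rewrite ler_wpM2l// ler_sum.
  by rewrite sumr_const card_ord mulVf.
have fou1 h k : (forall n, `|h n| <= 1) -> `|fourier h k| <= 1.
  move=> h1; rewrite /fourier normrM ger0_norm//.
  apply: le_trans (mean1 (fun n => `|h n|) h1); rewrite ler_wpM2l//.
  apply: le_trans (ler_norm_sum _ _ _) _; apply: ler_sum => n _.
  by rewrite normrM norm_conjC norm_wave mulr1.
have sq1 h : (forall n, `|h n| <= 1) -> \sum_k `|fourier h k| ^+ 2 <= 1.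
  move=> h1; rewrite parseval; apply: mean1 => n.
  by rewrite exprn_ile1.
set S := N%:R^-1 * _; pose a k := `|fourier u k| * `|fourier f k|.
have SE : S = \sum_k a k ^+ 2.
  rewrite /S -parseval; apply: eq_bigr => k _.
  by rewrite fourier_correlation normrM norm_conjC.
have a0 k : 0 <= a k by rewrite mulr_ge0.
have S0 : 0 <= S by rewrite SE sumr_ge0// => k _; rewrite exprn_ge0.
have suma : \sum_k a k <= 1.
  have twice : 2 * \sum_k a k <= 1 + 1.
    apply: le_trans (lerD (sq1 u u1) (sq1 f f1)).
    rewrite -big_split mulr_sumr; apply: ler_sum => k _ /=.
    rewrite -subr_ge0 (_ : _ - _ = (`|fourier u k| - `|fourier f k|) ^+ 2).
      by rewrite -realEsqr rpredB// normr_real.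
    by rewrite /a; ring.
  by rewrite -(@ler_pM2l _ 2)// mulr1; rewrite -mulr2n in twice.
suff [k hk] : exists k, S <= 2 * a k.
  exists k; rewrite /a in hk; split; apply: le_trans hk _.
    by rewrite ler_wpM2l// ler_piMr// fou1.
  by rewrite ler_wpM2l// ler_piMl// fou1.
apply: contrapT => nk.
have lt k : 2 * a k < S.
  have ak0 : 0 <= 2 * a k by rewrite mulr_ge0// a0.
  rewrite real_ltNge ?(ger0_real S0) ?(ger0_real ak0)//.
  by apply/negP => h; apply: nk; exists k.
have : S + S <= S.
  have : 2 * S <= S * \sum_k a k.
    rewrite {1}SE !mulr_sumr; apply: ler_sum => j _.
    rewrite expr2 mulrA; apply: ler_wpM2r; first exact: a0.
    exact: ltW (lt j).
  have : S * \sum_k a k <= S * 1 by rewrite ler_wpM2l.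
  by rewrite mulr1 mulr_natl mulr2n => h1 h2; exact: le_trans h2 h1.
rewrite gerDl => S0'; have S00 : S = 0 by apply/le_anti/andP; split.
by have := lt ord0; rewrite S00 => /lt_geF; rewrite mulr_ge0// a0.
Qed.

End FiniteFourier.

Section Expi.
Context {R : realType}.
Implicit Types (x y h : R) (z : R[i]).
Local Notation C := R[i].
Local Notation "x %:C" := (real_complex R x).

Lemma expiD x y : expi (x + y) = expi x * expi y.
Proof.
apply/eqP; rewrite eq_complex /= cosD sinD eqxx/=.
by rewrite addrC [cos x * sin y]mulrC [sin x * _]mulrC.
Qed.

Lemma expi0 : expi (0 : R) = 1.
Proof. by rewrite /expi cos0 sin0. Qed.

Lemma expiX x n : expi x ^+ n = expi (n%:R * x).
Proof.
elim: n => [|n IH]; first by rewrite mul0r expi0.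
by rewrite exprS IH -expiD -natr1 mulrDl mul1r addrC.
Qed.

Lemma norm_expi x : `|expi x| = 1.
Proof. by rewrite normc_def /= cos2Dsin2 sqrtr1. Qed.

Lemma norm_expiB1 x : `|expi x - 1| ^+ 2 = (2 - 2 * cos x)%:C.
Proof.
rewrite -add_Re2_Im2 /=; congr (_%:C); rewrite oppr0 addr0.
by rewrite sin2cos2; ring.
Qed.

Lemma expi_neq1 x : 0 < x < 2 * pi -> expi x != 1.
Proof.
have cos_neq1 y : 0 < y <= pi -> cos y != 1.
  move=> /andP[y0 yp]; apply/eqP => c1; have : y = 0.
    apply: cos_inj; rewrite ?in_itv/=; first by rewrite (ltW y0) yp.
      by rewrite lexx pi_ge0.
    by rewrite c1 cos0.
  by move=> y0'; rewrite y0' ltxx in y0.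
move=> /andP[x0 x2]; apply/eqP => -[c1 _].
have [xp|px] := leP x pi; first by have := cos_neq1 x; rewrite x0 xp => /(_ isT); rewrite c1 eqxx.
have := cos_neq1 (2 * pi - x); rewrite subr_gt0 x2/= lerBlDr.
rewrite (_ : 2 * pi - x = - x + pi *+ 2); last by ring.
rewrite cosD2pi cosN c1 eqxx; suff -> : 2 * pi <= pi + x by move=> /(_ isT).
by move: px; lra.
Qed.

Lemma primitive_expi n : (0 < n)%N -> n.-primitive_root (expi (2 * pi / n%:R : R)).
Proof.
move=> n0; have n0R : 0 < n%:R :> R by rewrite ltr0n.
apply/andP; split => //; apply/forallP => i.
rewrite unity_rootE expiX; have [->|ni] := eqVneq i.+1 n.
  have -> : n%:R * (2 * pi / n%:R) = pi *+ 2 :> R by field; rewrite gt_eqF.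
  by rewrite /expi cos2pi sin2pi eqxx.
rewrite eqbF_neg; apply: expi_neq1; have iR : 0 < i.+1%:R :> R by rewrite ltr0n.
rewrite mulr_gt0 ?divr_gt0 ?mulr_gt0 ?pi_gt0//=.
rewrite mulrCA -[ltRHS]mulr1 ltr_pM2l ?mulr_gt0 ?pi_gt0//.
by rewrite ltr_pdivrMr// mul1r ltr_nat ltn_neqAle ni ltn_ord.
Qed.


Lemma Re_sum (I : Type) (r : seq I) (P : pred I) (F : I -> C) :
  complex.Re (\sum_(i <- r | P i) F i) = \sum_(i <- r | P i) complex.Re (F i).
Proof. by apply: (big_morph (@complex.Re R)) => //; case=> a b [c d]. Qed.

Lemma ReZ (a : R) z : complex.Re (a%:C * z) = a * complex.Re z.
Proof. by case: z => x y /=; rewrite mul0r subr0. Qed.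

Lemma sum_wrapped N m : (m < N)%N -> (\sum_(n < N | ~~ (n + m < N)%N) 1 <= m)%N.
Proof.
move=> mN; rewrite -(big_mkord (fun n => ~~ (n + m < N)%N) (fun=> 1%N)).
rewrite (@big_cat_nat _ _ _ (N - m))//= ?leq_subr// big1_seq ?add0n.
  apply: leq_trans (_ : \sum_(N - m <= n < N) 1 <= m)%N.
    by rewrite big_mkcond leq_sum// => n _; case: ifP.
  by rewrite sum_nat_const_nat muln1 subKn// ltnW.
move=> n /andP[+]; rewrite mem_index_iota => + /andP[_ nN].
by rewrite -ltn_subRL ltn_subRL addnC -ltn_subRL nN.
Qed.

(** The finite form of the splitting of frequencies. The sequence [h1] and the
    twisted sequence [expi (lam * n) * h2 n] are expanded in the waves on the
    cyclic group with [N] elements; the [2 m / N] accounts for the indices that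
    wrap around. *)
Lemma finite_common_frequency N (h1 h2 : nat -> R) (lam S : R) : (0 < N)%N ->
  (forall n, 0 <= h1 n <= 1) -> (forall n, 0 <= h2 n <= 1) ->
  0 <= S ->
  S <= N%:R^-1 * \sum_(s < N)
    (N%:R^-1 * \sum_(n < N) h1 ((n + s) %% N)%N * h2 n * cos (lam * n%:R)) ^+ 2 ->
  exists2 k, (k < N)%N & forall m, (m < N)%N ->
    let theta := 2 * pi * k%:R / N%:R in
    (2 - 2 * cos (m%:R * theta)) * (S / 2) ^+ 2 <=
      (N%:R^-1 * (\sum_(n < N | (n + m < N)%N) `|h1 (n + m)%N - h1 n|)
        + 2 * m%:R / N%:R) ^+ 2 /\
    (2 - 2 * cos (m%:R * (theta - lam))) * (S / 2) ^+ 2 <=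
      (N%:R^-1 * (\sum_(n < N | (n + m < N)%N) `|h2 (n + m)%N - h2 n|)
        + 2 * m%:R / N%:R) ^+ 2.
Proof.
case: N => // N' _; set N := N'.+1 => h101 h201 S0 hS.
pose w : C := expi (2 * pi / N%:R).
have primw : N.-primitive_root w by exact: primitive_expi.
pose u (n : 'I_N) : C := (h1 n)%:C.
pose f (n : 'I_N) : C := expi (lam * n%:R) * (h2 n)%:C.
have normR (x : R) : `|x%:C| = `|x|%:C.
  by rewrite normc_def /= expr0n/= addr0 sqrtr_sqr.
have u1 n : `|u n| <= 1.
  rewrite /u normR lecR; have /andP[h0 h1'] := h101 n; by rewrite ger0_norm.
have f1 n : `|f n| <= 1.
  rewrite /f normrM norm_expi mul1r normR lecR.
  by have /andP[h0 h1'] := h201 n; rewrite ger0_norm.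
have [k] := common_wave primw u1 f1.
set T := _ * _; rewrite -/w => -[Tu Tf]; exists k; first exact: ltn_ord.
move=> m mN theta.
have NC : (N%:R^-1 : C) = (N%:R^-1)%:C by rewrite fmorphV rmorph_nat.
have ST : S%:C <= T.
  have -> : T = (N%:R^-1 * \sum_s (complex.Re (correlation u f s) ^+ 2 +
      complex.Im (correlation u f s) ^+ 2))%:C.
    rewrite /T NC rmorphM rmorph_sum; congr (_ * _).
    by apply: eq_bigr => s _; exact/esym/add_Re2_Im2.
  rewrite lecR; apply: le_trans hS _; rewrite ler_wpM2l// ?invr_ge0 ?ler0n//.
  apply: ler_sum => s _; suff -> : complex.Re (correlation u f s) =
      N%:R^-1 * \sum_(n < N) h1 ((n + s) %% N)%N * h2 n * cos (lam * n%:R).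
    by rewrite lerDl sqr_ge0.
  rewrite /correlation NC ReZ Re_sum; congr (_ * _); apply: eq_bigr => n _.
  by rewrite /u /f /expi /=; ring.
(* Common part of the two conclusions: [q] is [u] or [f], and [c] undoes the
   twist of [f]; the indices that wrap around contribute at most 2 each. *)
have core (c : C) (q : 'I_N -> C) (h : nat -> R) (phi : R) : 
    (forall n, 0 <= h n <= 1) -> `|c| = 1 ->
    T <= 2 * `|fourier w q k| ->
    c * wave w k (inord m) = expi phi ->
    (forall n : 'I_N, `|q n| <= 1) ->
    (forall n : 'I_N, (n + m < N)%N -> `|c * q (n + inord m) - q n| =
       `|h (n + m)%N - h n|%:C) ->
    (2 - 2 * cos phi) * (S / 2) ^+ 2 <=
      (N%:R^-1 * (\sum_(n < N | (n + m < N)%N) `|h (n + m)%N - h n|)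
        + 2 * m%:R / N%:R) ^+ 2.
  move=> h01 c1 Tq cphi q1 hq.
  have := fourier_almost_period primw q k (inord m) c; rewrite cphi.
  set E := `|_ - 1|; set Q := `|fourier w q k| => EQ.
  set B := (X in _ <= X ^+ 2).
  have B0 : 0 <= B.
    apply: addr_ge0; last by rewrite divr_ge0 ?mulr_ge0 ?ler0n.
    by apply: mulr_ge0; [rewrite invr_ge0 ler0n|exact: sumr_ge0].
  have le1 : N%:R^-1 * \sum_n `|c * q (n + inord m) - q n| <= B%:C.
    rewrite (bigID (fun n : 'I_N => n + m < N)%N)/= NC.
    rewrite (eq_bigr (fun n : 'I_N => `|h (n + m)%N - h n|%:C)); last first.
      by move=> n; exact: hq.
    rewrite mulrDr /B rmorphD rmorphM rmorph_sum/= lerD2l.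
    apply: le_trans (_ : (N%:R^-1)%:C * \sum_(n < N | ~~ (n + m < N)%N) 2%:R <= _).
      rewrite ler_wpM2l//; first by rewrite -NC invr_ge0 ler0n.
      apply: ler_sum => n _; apply: le_trans (ler_normB _ _) _.
      by rewrite normrM c1 mul1r (_ : 2%:R = 1 + 1)// lerD// q1.
    have -> : \sum_(n < N | ~~ (n + m < N)%N) 2%:R =
        ((2 * \sum_(n < N | ~~ (n + m < N)%N) 1)%:R : R)%:C.
      rewrite rmorph_nat natrM natr_sum mulr_sumr.
      by apply: eq_bigr => n _; rewrite mulr1.
    rewrite -rmorphM lecR mulrC ler_wpM2r ?invr_ge0 ?ler0n//.
    by rewrite -natrM ler_nat leq_mul2l sum_wrapped.
  have E0 : 0 <= E by rewrite /E normr_ge0.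
  have SQ : (S / 2)%:C <= Q.
    rewrite -(@ler_pM2l _ 2)// (le_trans _ Tq)//; apply: le_trans ST.
    rewrite -(rmorph_nat (real_complex R)) -rmorphM lecR.
    by rewrite mulrC divfK.
  have : E * (S / 2)%:C <= B%:C.
    by apply: le_trans le1; apply: le_trans EQ; rewrite ler_wpM2l.
  move=> h'; have : (E * (S / 2)%:C) ^+ 2 <= B%:C ^+ 2.
    have sC0 : 0 <= (S / 2)%:C by rewrite ler0c divr_ge0.
    apply: lerXn2r => //; rewrite nnegrE; first by rewrite mulr_ge0.
    by rewrite ler0c.
  by rewrite exprMn norm_expiB1 -!rmorphXn -rmorphM/= lecR.
have waveE : wave w k (inord m) = expi (m%:R * theta).
  rewrite /wave /w expiX inordK// natrM /theta; congr expi; ring.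
split.
- apply: (core 1 u h1) => //.
  + by rewrite normr1.
  + by rewrite mul1r waveE.
  + move=> n nm; rewrite mul1r /u /= inordK// modn_small// -rmorphB/= normR.
    by [].
- apply: (core (expi (- (lam * m%:R))) f h2) => //.
  + exact: norm_expi.
  + by rewrite waveE -expiD; congr expi; ring.
  + move=> n nm; rewrite /f /= inordK// modn_small// natrD mulrDr mulrA.
    rewrite -expiD (_ : - (lam * m%:R) + (lam * n%:R + lam * m%:R) = lam * n%:R); last by ring.
    by rewrite -mulrBr normrM norm_expi mul1r -rmorphB/= normR.
Qed.

End Expi.

(** * Splitting of frequencies *)

Section SplitFrequency.
Context {R : realType}.
Implicit Types (phi : R -> R) (tau t s e d h a b y lam : R).

(** The properties of the distance between a Weyl almost periodic function and its
    translates. *)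
Definition is_length phi : Prop :=
  [/\ forall tau, 0 <= phi tau, forall tau, phi (- tau) = phi tau,
      forall tau tau', phi (tau + tau') <= phi tau + phi tau' &
      forall e, 0 < e -> exists2 h, 0 < h & forall s, `|s| <= h -> phi s <= e].

(** A bump around the almost periods of quality [d], Lipschitz with respect to
    [phi]. *)
Definition bump phi d tau : R := Num.max 0 (1 - phi tau / d).

Section Bump.
Variables (phi : R -> R) (d : R).
Hypotheses (lphi : is_length phi) (d0 : 0 < d).

Lemma bump01 tau : 0 <= bump phi d tau <= 1.
Proof.
case: lphi => p0 _ _ _; rewrite /bump le_max lexx/= ge_max ler01/=.
by rewrite lerBlDr lerDl divr_ge0// ltW.
Qed.

Lemma bump_support tau : bump phi d tau != 0 -> phi tau < d.
Proof.
rewrite /bump; case: (leP 0 (1 - phi tau / d)) => [h nz|_]; last by rewrite eqxx.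
have : 0 < 1 - phi tau / d by rewrite lt_def nz.
by rewrite subr_gt0 ltr_pdivrMr// mul1r.
Qed.

Lemma bump_ge_half tau : phi tau <= d / 2 -> 1 / 2 <= bump phi d tau.
Proof.
move=> h; rewrite /bump le_max; apply/orP; right.
have : phi tau / d <= 1 / 2 by rewrite ler_pdivrMr//; lra.
lra.
Qed.

Lemma bumpB tau s : `|bump phi d (tau + s) - bump phi d tau| <= phi s / d.
Proof.
case: lphi => p0 pN pD _.
have i0 : 0 < d^-1 by rewrite invr_gt0.
have h1 := ler_wpM2r (ltW i0) (pD tau s).
have h2 : phi tau / d <= (phi (tau + s) + phi s) / d.
  apply: ler_wpM2r; first exact: ltW.
  have := pD (tau + s) (- s).
  by rewrite addrK pN.
have h3 : 0 <= phi s / d by rewrite divr_ge0// ltW.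
rewrite !mulrDl in h1 h2; rewrite /bump.
move: (phi (tau + s) / d) (phi tau / d) (phi s / d) h1 h2 h3 => x y z h1 h2 h3.
rewrite /Num.max ler_norml; case: ifPn; case: ifPn; rewrite -?leNgt => hx hy;
  apply/andP; split; lra.
Qed.

End Bump.

Lemma exp2_gt0 j : 0 < (2 ^- j : R). Proof. by rewrite invr_gt0 exprn_gt0. Qed.

Lemma exp2_small e : 0 < e -> exists j0, forall j, (j0 <= j)%N -> (2 ^- j : R) < e.
Proof.
move=> e0; exists (Num.truncn e^-1).+1 => j jj.
have i0 : 0 < e^-1 by rewrite invr_gt0.
have /andP[_ h] := truncn_itv (ltW i0).
rewrite -[e]invrK ltf_pV2 ?posrE ?exprn_gt0 ?invr_gt0//.
apply: lt_le_trans h _; apply: le_trans (_ : j%:R <= _); first by rewrite ler_nat.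
by rewrite -natrX ler_nat; exact/ltnW/ltn_expl.
Qed.

Variables (phi1 phi2 : R -> R).
Hypotheses (l1 : is_length phi1) (l2 : is_length phi2).
Hypothesis dense : forall e, 0 < e ->
  relatively_dense [set tau | phi1 tau <= e /\ phi2 tau <= e].

Definition common_small e tau : bool := (phi1 tau <= e) && (phi2 tau <= e).

(** Translates of the set of common almost periods by [i * 2 ^- j0] with [i <= r]
    cover the lattice, because a lattice point can be moved in this way to within
    [2 ^- j0] of a better almost period. The term [r * 2 ^ (j - j0)] accounts for
    translates that leave the first [M] points. *)
Lemma common_small_density e : 0 < e -> exists r j0, forall j M, (j0 <= j)%N ->
  (M <= r * 2 ^ (j - j0) +
    r.+1 * \sum_(n < M) common_small e (n%:R * 2 ^- j))%N.
Proof.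
move=> e0; have e20 : 0 < e / 2 by lra.
case: (l1) => p0 pN pD pc; case: (l2) => q0 qN qD qc.
have [h1 h10 hh1] := pc _ e20; have [h2 h20 hh2] := qc _ e20.
have [a a0 ha] := dense e20.
have [|j0 hj0] := @exp2_small (Num.min h1 h2); first by rewrite lt_min h10.
have := hj0 j0 (leqnn _); rewrite lt_min => /andP[jh1 jh2].
set h0 := 2 ^- j0 in jh1 jh2; have h00 : 0 < h0 := exp2_gt0 j0.
pose r := (Num.truncn (a / h0)).+1; exists r, j0 => j M jj.
have cov t : exists2 i, (i <= r)%N & common_small e (t + i%:R * h0).
  have [tau [/=]] := ha t; rewrite in_itv/= => /andP[t1 t2] [f1 f2].
  have u0 : 0 <= (tau - t) / h0 by apply: divr_ge0; lra.
  have /andP[] := truncn_itv u0; set i := Num.truncn _ => i1 i2; exists i.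
    by apply: leqW; apply: le_truncn; rewrite ler_pM2r ?invr_gt0//; lra.
  move: i1 i2; rewrite ler_pdivlMr// ltr_pdivrMr// -natr1 => i1 i2.
  pose s := t + i%:R * h0 - tau.
  have sh : `|s| <= h0 by rewrite /s ler_norml; lra.
  have -> : t + i%:R * h0 = tau + s by rewrite /s; ring.
  apply/andP; split.
    apply: le_trans (pD _ _) _; have := hh1 s (le_trans sh (ltW jh1)); lra.
  apply: le_trans (qD _ _) _; have := hh2 s (le_trans sh (ltW jh2)); lra.
pose p := (2 ^ (j - j0))%N.
have ph : h0 = p%:R * 2 ^- j.
  have E : (2 : R) ^+ j = 2 ^+ j0 * 2 ^+ (j - j0) by rewrite -exprD subnKC.
  have nz : (2 : R) ^+ (j - j0) != 0 by rewrite expf_neq0// pnatr_eq0.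
  by rewrite /p natrX /h0 E invfM mulrCA divff// mulr1.
pose G n := common_small e (n%:R * 2 ^- j) : nat.
have covG n : (1 <= \sum_(i < r.+1) G (n + i * p))%N.
  have [i ir hi] := cov (n%:R * 2 ^- j).
  rewrite (bigD1 (Ordinal (_ : i < r.+1)%N))//=.
  have -> : G (n + i * p)%N = 1%N.
    by rewrite /G natrD natrM mulrDl -mulrA -ph hi.
  by [].
have [Mr|Mr] := leqP M (r * p); first exact: leq_trans Mr (leq_addr _ _).
rewrite -/p -leq_subLR.
apply: leq_trans (_ : \sum_(n < M - r * p) \sum_(i < r.+1) G (n + i * p) <= _)%N.
  apply: leq_trans (_ : \sum_(n < M - r * p) 1 <= _)%N.
    by rewrite sum1_card card_ord.
  by apply: leq_sum => n _; exact: covG.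
rewrite exchange_big/=; have -> : (r.+1 * \sum_(n < M) common_small e (n%:R * 2 ^- j) =
    \sum_(i < r.+1) \sum_(n < M) G n)%N by rewrite sum_nat_const card_ord.
apply: leq_sum => i _.
have iM : (i * p + (M - r * p) <= M)%N.
  rewrite addnBA; last exact: ltnW.
  by rewrite leq_subLR leq_add2r leq_mul2r -ltnS ltn_ord orbT.
rewrite -(big_mkord xpredT (fun n => G (n + i * p)%N)) -(big_mkord xpredT G).
have := @big_addn _ 0%N addn 0 (i * p + (M - r * p)) (i * p) xpredT G.
rewrite add0n addKn => <-; rewrite [leqRHS](@big_cat_nat _ _ _ (i * p))//=; last first.
  exact: leq_trans (leq_addr _ _) iM.
rewrite [X in (_ <= _ + X)%N](@big_cat_nat _ _ _ (i * p + (M - r * p)))//=.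
  by rewrite addnA addnAC leq_addl.
exact: leq_addr.
Qed.

Lemma common_small_frequency e : 0 < e -> exists r j0 : nat, forall j M,
  (j0 <= j)%N -> M%:R <= r%:R * 2 ^+ j +
    r.+1%:R * \sum_(n < M) (common_small e (n%:R * 2 ^- j))%:R :> R.
Proof.
move=> e0; have [r [j0 hr]] := common_small_density e0.
exists r; exists j0 => j M jj.
have : (M%:R : R) <= (r * 2 ^ (j - j0) +
    r.+1 * \sum_(n < M) common_small e (n%:R * 2 ^- j))%:R by rewrite ler_nat hr.
rewrite natrD !natrM natrX natr_sum => /le_trans; apply; rewrite lerD2r.
by rewrite ler_wpM2l// ler_weXn2l ?ler1n// leq_subr.
Qed.

Lemma cosD2pi_nat (x : R) n : cos (x + 2 * pi * n%:R) = cos x.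
Proof.
rewrite (_ : 2 * pi * n%:R = (pi *+ 2) *+ n); last by rewrite -(mulr_natr (pi *+ 2)) -(mulr_natr pi) [pi * _]mulrC.
exact: (periodicn (@cosD2pi R)).
Qed.

Variables (lam d : R).
Hypothesis d0 : 0 < d.
Hypothesis hlam : forall tau, phi1 tau < d -> phi2 tau < d -> 1 / 2 <= cos (lam * tau).

(** The lattices have step [2 ^- j] and [4 ^ j] points: the step tends to 0 and the
    length to infinity. *)
Let h1 n j : R := bump phi1 d (n%:R * 2 ^- j).
Let h2 n j : R := bump phi2 d (n%:R * 2 ^- j).

Lemma bump_cos_ge0 tau : 0 <= bump phi1 d tau * bump phi2 d tau * cos (lam * tau).
Proof.
have /andP[b1 _] := bump01 l1 d0 tau; have /andP[b2 _] := bump01 l2 d0 tau.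
have [->|n1] := eqVneq (bump phi1 d tau) 0; first by rewrite !mul0r.
have [->|n2] := eqVneq (bump phi2 d tau) 0; first by rewrite mulr0 mul0r.
have := hlam (bump_support d0 n1) (bump_support d0 n2).
by move=> h; apply: mulr_ge0; [exact: mulr_ge0|lra].
Qed.

Lemma bump_cos_common tau : common_small (d / 2) tau ->
  1 / 8 <= bump phi1 d tau * bump phi2 d tau * cos (lam * tau).
Proof.
move=> /andP[s1 s2]; have d0' := d0.
have b1 := bump_ge_half d0 s1; have b2 := bump_ge_half d0 s2.
have b3 : 1 / 2 <= cos (lam * tau) by apply: hlam; lra.
have b12 : 1 / 4 <= bump phi1 d tau * bump phi2 d tau by nra.
nra.
Qed.

Let corr (j s : nat) : R := (4 ^ j)%:R^-1 * \sum_(n < 4 ^ j)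
  h1 ((n + s) %% 4 ^ j)%N j * h2 n j * cos (lam * 2 ^- j * n%:R).

Let four_gt0 j : 0 < (4 ^ j)%:R :> R.
Proof. by rewrite ltr0n expn_gt0. Qed.

Let fourE j : (4 ^ j)%:R = 2 ^+ j * 2 ^+ j :> R.
Proof. by rewrite natrX -exprMn; congr (_ ^+ j); ring. Qed.

(** The summands are nonnegative, since the cosine is positive where both bumps are,
    and they are at least 1/8 at the common almost periods of quality [d / 2], which
    have positive density. *)
Lemma corr0_bounded_below : exists2 c, 0 < c <= 1 &
  exists J, forall j, (J <= j)%N -> c <= corr j 0.
Proof.
have d20 : 0 < d / 2 by exact: divr_gt0.
have [r [j0 hr]] := common_small_frequency d20.
have e0 : 0 < (1 / (2 * r.+1%:R) : R) by rewrite divr_gt0// mulr_gt0.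
have [j1 hj1] := exp2_small e0.
pose c : R := 1 / (16 * r.+1%:R); exists c.
  by rewrite /c divr_gt0 ?mulr_gt0//= ler_pdivrMr ?mulr_gt0// mul1r -natrM ler1n.
exists (maxn j0 j1) => j; rewrite geq_max => /andP[jj0 /hj1 hX].
have hc := hr j (4 ^ j)%N jj0.
set cnt := \sum_(n < _) _ in hc.
have X0 : 0 < (2 : R) ^+ j by rewrite exprn_gt0.
have r0 : 0 < (r.+1%:R : R) by rewrite ltr0n.
have hX' : 2 * r.+1%:R <= (2 : R) ^+ j.
  have : (2 ^- j : R) < (2 * r.+1%:R)^-1 by rewrite -[X in _ < X]mul1r.
  by rewrite ltf_pV2 ?posrE// ?mulr_gt0// => /ltW.
have rr : (r%:R : R) <= r.+1%:R by rewrite ler_nat.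
have hN : (4 ^ j)%:R <= 2 * r.+1%:R * cnt.
  rewrite fourE in hc *; nra.
have hcorr : cnt / 8 <= \sum_(n < 4 ^ j)
    h1 ((n + 0) %% 4 ^ j)%N j * h2 n j * cos (lam * 2 ^- j * n%:R).
  rewrite mulr_suml; apply: ler_sum => n _; rewrite addn0 modn_small//.
  have -> : lam * 2 ^- j * n%:R = lam * (n%:R * 2 ^- j) by rewrite -mulrA [2 ^- j * _]mulrC.
  rewrite /h1 /h2.
  case hg : (common_small _ _); first exact: bump_cos_common.
  by rewrite mul0r bump_cos_ge0.
rewrite /corr mulrC ler_pdivlMr//; apply: le_trans hcorr.
rewrite /c -mulrA mul1r mulrC ler_pdivrMr ?mulr_gt0//; lra.
Qed.

(** Shifting by a common almost period changes the correlation little, hence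
    its mean square is bounded below. *)
Lemma corr_mean_square : exists2 S, 0 < S & exists J, forall j, (J <= j)%N ->
  S <= (4 ^ j)%:R^-1 * \sum_(s < 4 ^ j) corr j s ^+ 2.
Proof.
have [c /andP[c0 c1] [J1 hJ1]] := corr0_bounded_below.
have e0 : 0 < d * c / 4 by rewrite divr_gt0// mulr_gt0.
have [r [j0 hr]] := common_small_frequency e0.
pose q : R := 16 * r.+1%:R / c.
have r0 : 0 < (r.+1%:R : R) by rewrite ltr0n.
have q0 : 0 < q by rewrite /q divr_gt0// mulr_gt0.
have iq0 : 0 < q^-1 by rewrite invr_gt0.
have [j1 hj1] := exp2_small iq0.
exists (c / (16 * r.+1%:R) * (c / 2) ^+ 2).
  by rewrite mulr_gt0 ?exprn_gt0 ?divr_gt0 ?mulr_gt0.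
exists (maxn J1 (maxn j0 j1)) => j; rewrite !geq_max => /and3P[/hJ1 hc jj0 hX].
have X0 : 0 < (2 : R) ^+ j by rewrite exprn_gt0.
have {}hX : q <= (2 : R) ^+ j.
  by have := hj1 j hX; rewrite ltf_pV2 ?posrE// => /ltW.
(* Shifts below [M] make only a fraction [c / 4] of the indices wrap around. *)
pose M := Num.truncn (c / 4 * (4 ^ j)%:R).
have Mle : M%:R <= c / 4 * (4 ^ j)%:R.
  have /truncn_itv/andP[] : 0 <= c / 4 * (4 ^ j)%:R by rewrite mulr_ge0 ?ltW ?divr_gt0.
  by [].
have Mge : c / 4 * (4 ^ j)%:R - 1 <= M%:R.
  have /truncn_itv/andP[_] : 0 <= c / 4 * (4 ^ j)%:R by rewrite mulr_ge0 ?ltW ?divr_gt0.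
  by rewrite -/M -natr1; lra.
have MN : (M <= 4 ^ j)%N.
  rewrite -(ler_nat R); apply: le_trans Mle _; rewrite ler_piMl//; lra.
have := hr j M jj0; set cnt := \sum_(n < _) _ => hcnt.
have cX : 16 * r.+1%:R <= c * 2 ^+ j.
  by rewrite -ler_pdivrMl// mulrC.
have cntN : c / (16 * r.+1%:R) * (4 ^ j)%:R <= cnt.
  have -> : c / (16 * r.+1%:R) * (4 ^ j)%:R = (c / 16 * (4 ^ j)%:R) / r.+1%:R.
    by field; rewrite gt_eqF.
  rewrite ler_pdivrMr//.
  have cXX : 16 * r.+1%:R * 2 ^+ j <= c * (4 ^ j)%:R.
    by rewrite fourE mulrA ler_wpM2r// ltW.
  have rE : r.+1%:R = r%:R + 1 :> R by rewrite -natr1.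
  have r00 : 0 <= r%:R :> R by rewrite ler0n.
  have X1 : 1 <= (2 : R) ^+ j by rewrite exprn_ege1// ler1n.
  rewrite rE in cXX hcnt *; nra.
have close (s : 'I_M) : common_small (d * c / 4) (s%:R * 2 ^- j) -> c / 2 <= corr j s.
  move=> /andP[hs _]; have sN : (s < 4 ^ j)%N := leq_trans (ltn_ord s) MN.
  have sN' : s%:R <= c / 4 * (4 ^ j)%:R.
    by apply: le_trans Mle; rewrite ler_nat ltnW.
  have hs' : phi1 (s%:R * 2 ^- j) / d <= c / 4.
    by rewrite ler_pdivrMr//; lra.
  pose w (n : nat) : R := if (n + s < 4 ^ j)%N then c / 4 else 1.
  have term n : (n < 4 ^ j)%N ->
      h1 ((n + 0) %% 4 ^ j)%N j * h2 n j * cos (lam * 2 ^- j * n%:R) - w n <=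
      h1 ((n + s) %% 4 ^ j)%N j * h2 n j * cos (lam * 2 ^- j * n%:R).
    move=> nN; rewrite addn0 modn_small// lerBlDr -lerBlDl -!mulrBl.
    have k01 : `|h2 n j * cos (lam * 2 ^- j * n%:R)| <= 1.
      rewrite normrM; have /andP[b1 b2] := bump01 l2 d0 (n%:R * 2 ^- j).
      by rewrite mulr_ile1 ?normr_ge0 ?cos_max// /h2 ger0_norm.
    have a01 m : 0 <= h1 m j <= 1 by exact: bump01.
    apply: le_trans (ler_norm _) _; rewrite -mulrA normrM.
    apply: le_trans (ler_piMr (normr_ge0 _) k01) _; rewrite /w; case: ifP => ns.
      rewrite modn_small// distrC /h1 natrD mulrDl.
      exact: le_trans (bumpB l1 d0 _ _) hs'.
    have := a01 n; have := a01 ((n + s) %% 4 ^ j)%N; rewrite ler_norml; lra.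
  have sumw : \sum_(n < 4 ^ j) w n <= c / 2 * (4 ^ j)%:R.
    rewrite (bigID (fun n : 'I_(4 ^ j) => (n + s < 4 ^ j)%N))/=.
    have e1 : \sum_(n < 4 ^ j | (n + s < 4 ^ j)%N) w n <= c / 4 * (4 ^ j)%:R.
      apply: le_trans (_ : \sum_(n < 4 ^ j) c / 4 <= _); last first.
        by rewrite sumr_const card_ord -[_ *+ (4 ^ j)]mulr_natr.
      rewrite [leRHS](bigID (fun n : 'I_(4 ^ j) => (n + s < 4 ^ j)%N))/=.
      apply: ler_wpDr; first by apply: sumr_ge0 => n _; rewrite divr_ge0 ?ltW.
      by apply: ler_sum => n ns; rewrite /w ns.
    have e2 : \sum_(n < 4 ^ j | ~~ (n + s < 4 ^ j)%N) w n <= c / 4 * (4 ^ j)%:R.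
      apply: le_trans sN'; rewrite (eq_bigr (fun=> 1%:R)); last first.
        by move=> n; rewrite /w => /negbTE ->.
      by rewrite -natr_sum ler_nat sum_wrapped.
    lra.
  have : corr j 0 - c / 2 <= corr j s; last by lra.
  have -> : c / 2 = (4 ^ j)%:R^-1 * (c / 2 * (4 ^ j)%:R).
    by field; rewrite gt_eqF.
  rewrite /corr -mulrBr ler_wpM2l ?invr_ge0 ?ler0n//.
  apply: le_trans (_ : \sum_(n < 4 ^ j) (h1 ((n + 0) %% 4 ^ j)%N j * h2 n j *
    cos (lam * 2 ^- j * n%:R) - w n) <= _); last by apply: ler_sum => n _; exact: term.
  by rewrite sumrB lerB.
rewrite [leRHS]mulrC ler_pdivlMr//.
apply: le_trans (_ : cnt * (c / 2) ^+ 2 <= _).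
  by rewrite mulrAC ler_wpM2r// exprn_ge0// divr_ge0 ?ltW.
rewrite mulr_suml (big_ord_widen _ (fun n => (common_small (d * c / 4)
  (n%:R * 2 ^- j))%:R * (c / 2) ^+ 2) MN).
rewrite [leRHS](bigID (fun s : 'I_(4 ^ j) => (s < M)%N))/=.
apply: ler_wpDr; first by apply: sumr_ge0 => s _; exact: sqr_ge0.
apply: ler_sum => s sM; case hg : (common_small _ _); last by rewrite mul0r sqr_ge0.
rewrite mul1r lerXn2r ?nnegrE//; first by rewrite divr_ge0 ?ltW.
  by apply: le_trans (close (Ordinal sM) hg); rewrite divr_ge0 ?ltW.
exact: (close (Ordinal sM)).
Qed.

(** The wave of frequency [y] is nearly invariant under the translations
    [m * 2 ^- j] for which [phi] is small; the last term is the error due to the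
    finite lattice. *)
Definition frequency_bound phi S j y : Prop := forall m, (m < 4 ^ j)%N ->
  (2 - 2 * cos (m%:R * 2 ^- j * y)) * (S / 2) ^+ 2 <=
    (phi (m%:R * 2 ^- j) / d + 2 * (m%:R * 2 ^- j) * 2 ^- j) ^+ 2.

Lemma bump_variation phi j m : is_length phi -> (m < 4 ^ j)%N ->
  0 <= (4 ^ j)%:R^-1 * (\sum_(n < 4 ^ j | (n + m < 4 ^ j)%N)
    `|bump phi d ((n + m)%:R * 2 ^- j) - bump phi d (n%:R * 2 ^- j)|) +
    2 * m%:R / (4 ^ j)%:R <=
  phi (m%:R * 2 ^- j) / d + 2 * (m%:R * 2 ^- j) * 2 ^- j.
Proof.
move=> lphi mN; have [p0 _ _ _] := lphi; apply/andP; split.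
  apply: addr_ge0; last by rewrite divr_ge0 ?mulr_ge0 ?ler0n.
  by apply: mulr_ge0; [rewrite invr_ge0 ler0n|exact: sumr_ge0].
have pd : 0 <= phi (m%:R * 2 ^- j) / d by rewrite divr_ge0// ltW.
apply: lerD.
  rewrite mulrC ler_pdivrMr//.
  apply: le_trans (_ : \sum_(n < 4 ^ j) phi (m%:R * 2 ^- j) / d <= _); last first.
    by rewrite sumr_const card_ord -[_ *+ (4 ^ j)]mulr_natr.
  rewrite [leRHS](bigID (fun n : 'I_(4 ^ j) => (n + m < 4 ^ j)%N))/=.
  apply: ler_wpDr; first exact: sumr_ge0.
  by apply: ler_sum => n _; rewrite natrD mulrDl; exact: bumpB.
by rewrite fourE invfM -!mulrA.
Qed.

(** The finite Fourier argument gives an angle [theta] per lattice step; [y] is the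
    frequency of its representative in the interval from [- pi] to [pi]. *)
Lemma lattice_frequency : exists2 S, 0 < S & exists J, forall j, (J <= j)%N ->
  exists y, [/\ `|y| * 2 ^- j <= pi, frequency_bound phi1 S j y &
                frequency_bound phi2 S j (y - lam)].
Proof.
have [S S0 [J hJ]] := corr_mean_square; exists S => //; exists J => j /hJ hS.
have N0 : (0 < 4 ^ j)%N by rewrite expn_gt0.
have [k kN hk] := finite_common_frequency N0 (fun n => bump01 l1 d0 (n%:R * 2 ^- j))
  (fun n => bump01 l2 d0 (n%:R * 2 ^- j)) (ltW S0) hS.
pose theta : R := 2 * pi * k%:R / (4 ^ j)%:R.
have th0 : 0 <= theta by rewrite /theta divr_ge0 ?mulr_ge0 ?ler0n ?pi_ge0.
have th2 : theta <= 2 * pi.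
  rewrite /theta ler_pdivrMr// ler_wpM2l ?mulr_ge0 ?pi_ge0//.
  by rewrite ler_nat ltnW.
have X0 : 0 < (2 : R) ^+ j by rewrite exprn_gt0.
have [y ypi [yc1 yc2]] : exists2 y, `|y| * 2 ^- j <= pi &
    (forall m, cos (m%:R * 2 ^- j * y) = cos (m%:R * theta)) /\
    (forall m, cos (m%:R * 2 ^- j * (y - lam)) =
      cos (m%:R * (theta - lam * 2 ^- j))).
  have nz : (2 : R) ^+ j != 0 by rewrite gt_eqF.
  have [tp|tp] := leP theta pi.
    exists (theta * 2 ^+ j).
      by rewrite ger0_norm ?mulfK// mulr_ge0// ltW.
    by split=> m; congr cos; field.
  exists ((theta - 2 * pi) * 2 ^+ j).
    by rewrite normrM (gtr0_norm X0) mulfK// ler_norml; lra.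
  split=> m; rewrite -[LHS](cosD2pi_nat _ m); congr cos; field => //.
exists y; split => // m mN; have [b1 b2] := hk m mN.
  rewrite yc1; apply: le_trans b1 _.
  have /andP[h0 hle] := bump_variation l1 mN.
  by rewrite lerXn2r ?nnegrE//; exact: le_trans hle.
rewrite yc2; apply: le_trans b2 _.
have /andP[h0 hle] := bump_variation l2 mN.
by rewrite lerXn2r ?nnegrE//; exact: le_trans hle.
Qed.

(** The frequencies found on finer and finer lattices stay bounded, because
    [phi1] is small near 0: no multiple of the step may turn the wave by more
    than a quarter of a period. *)
Lemma frequency_bounded S : 0 < S -> exists B J, forall j y, (J <= j)%N ->
  `|y| * 2 ^- j <= pi -> frequency_bound phi1 S j y -> `|y| <= B.
Proof.
move=> S0; have [p0 _ _ pc] := l1; have S40 : 0 < S / 4 by lra.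
have [eta eta0 heta] := pc _ (mulr_gt0 d0 S40).
have [j3 hj3] := exp2_small eta0.
have [j4 hj4] := exp2_small (divr_gt0 S40 (ltr0n R 2)).
exists (pi / 2 * 2 ^+ j3); exists (maxn j3 (maxn j4 1)) => j y.
rewrite !geq_max => /and3P[jj3 jj4 j0] ypi yb.
have X0 : 0 < (2 : R) ^- j := exp2_gt0 j.
have X3 : (2 : R) ^- j3 <= 1 by rewrite invf_le1 ?exprn_gt0// exprn_ege1// ler1n.
have cos_pos m : (m <= 2 ^ (j - j3))%N -> 0 < cos (m%:R * (`|y| * 2 ^- j)).
  move=> mj; have m4 : (m < 4 ^ j)%N.
    apply: leq_ltn_trans mj _; apply: leq_ltn_trans (_ : 2 ^ j < _)%N.
      by rewrite leq_exp2l// leq_subr.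
    by rewrite ltn_exp2r.
  have := yb m m4; set tau := m%:R * 2 ^- j => yb'.
  have tau0 : 0 <= tau by rewrite /tau mulr_ge0// ltW.
  have tau3 : tau <= 2 ^- j3.
    rewrite /tau ler_pdivrMr ?exprn_gt0//.
    have E : (2 : R) ^+ j = 2 ^+ j3 * 2 ^+ (j - j3) by rewrite -exprD subnKC.
    rewrite E mulrA mulVf ?mul1r ?expf_neq0 ?pnatr_eq0//.
    by rewrite -natrX ler_nat.
  have f1 : phi1 tau / d <= S / 4.
    rewrite ler_pdivrMr// mulrC; apply: heta; rewrite ger0_norm//.
    exact: le_trans tau3 (ltW (hj3 _ (leqnn _))).
  have f2 : 2 * tau * 2 ^- j <= S / 4 by have := hj4 j jj4; nra.
  have f0 : 0 <= phi1 tau / d + 2 * tau * 2 ^- j.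
    apply: addr_ge0; first by rewrite divr_ge0// ltW.
    by rewrite !mulr_ge0// ltW.
  have sq : (phi1 tau / d + 2 * tau * 2 ^- j) ^+ 2 <= (S / 2) ^+ 2.
    by rewrite lerXn2r ?nnegrE//; lra.
  have S20 : 0 < (S / 2) ^+ 2 by rewrite exprn_gt0// divr_gt0.
  have : 2 - 2 * cos (tau * y) <= 1.
    rewrite -(ler_pM2r S20) mul1r; exact: le_trans yb' sq.
  have -> : cos (m%:R * (`|y| * 2 ^- j)) = cos (tau * y).
    rewrite -[RHS]cos_norm normrM (ger0_norm tau0); congr cos.
    by rewrite /tau mulrAC mulrA.
  lra.
set th := `|y| * 2 ^- j in cos_pos ypi.
have th0 : 0 <= th by rewrite /th mulr_ge0// ltW.
have pi0 := @pi_gt0 R.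
(* A step of the multiples of [th] is too short to jump over the zone where the
   cosine is not positive. *)
have quarter x : 0 <= x <= pi -> 0 < cos x -> x < pi / 2.
  move=> /andP[x0 xp] cx; rewrite ltNge; apply/negP => px.
  move: cx; rewrite ltNge -cos_pihalf => /negP; apply.
  have [->//|px'] := eqVneq x (pi / 2).
  have plt : pi / 2 < x by rewrite lt_neqAle eq_sym px' px.
  apply: ltW; rewrite ltr_cos// in_itv/= ?x0 ?xp//.
  by apply/andP; split; lra.
have thq : th < pi / 2.
  apply: quarter; first by rewrite th0.
  by rewrite -[th]mul1r -[1]/(1%:R); apply: (cos_pos 1%N); rewrite expn_gt0.
have all m : (m <= 2 ^ (j - j3))%N -> m%:R * th < pi / 2.
  elim: m => [|m IH] mj; first by rewrite mul0r divr_gt0.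
  have := IH (ltnW mj) => hm; apply: quarter; last exact: cos_pos.
  by rewrite mulr_ge0//= -natr1 mulrDl mul1r; lra.
have := all _ (leqnn _); rewrite natrX => /ltW h.
have E : (2 : R) ^+ j = 2 ^+ j3 * 2 ^+ (j - j3) by rewrite -exprD subnKC.
have nz i : (2 : R) ^+ i != 0 by rewrite expf_neq0// pnatr_eq0.
have -> : `|y| = 2 ^+ (j - j3) * th * 2 ^+ j3 by rewrite /th E; field; rewrite !nz.
by rewrite ler_wpM2r// exprn_ge0.
Qed.

Lemma bounded_cluster (y : nat -> R) B n0 : (forall j, (n0 <= j)%N -> `|y j| <= B) ->
  exists a, forall e n, 0 < e -> exists2 j, (n <= j)%N & `|y j - a| < e.
Proof.
move=> yB; have cpt : compact `[- B, B] := @segment_compact R (- B) B.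
have [|a [_ ca]] := cpt (y @ \oo) _.
  by exists n0 => // j /= /yB; rewrite in_itv/= ler_norml.
exists a => e n e0.
have yn : (y @ \oo) [set y j | j in [set j | (n <= j)%N]].
  by exists n => // j /= nj; exists j.
have [_ [[j /= nj <-] hb]] := ca _ _ yn (nbhsx_ballx a e e0).
by exists j => //; rewrite distrC.
Qed.

(** A time [tau] is approximated by lattice points, and the bounds there pass to the
    limit along frequencies [y j] that tend to [a]. *)
Lemma frequency_limit phi S (y : nat -> R) J a c : is_length phi -> 0 < S ->
  (forall e n, 0 < e -> exists2 j, (n <= j)%N & `|y j - a| < e) ->
  (forall j, (J <= j)%N -> frequency_bound phi S j (y j - c)) ->
  forall tau, (2 - 2 * cos (tau * (a - c))) * (S / 2) ^+ 2 <= (phi tau / d) ^+ 2.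
Proof.
move=> [p0 pN pD pc] S0 ca hy.
suff pos tau : 0 <= tau ->
    (2 - 2 * cos (tau * (a - c))) * (S / 2) ^+ 2 <= (phi tau / d) ^+ 2.
  move=> tau; have [t0|t0] := leP 0 tau; first exact: pos.
  by have := pos (- tau); rewrite mulNr cosN pN oppr_ge0; apply; exact: ltW.
move=> t0; set x := phi tau / d; set K := (S / 2) ^+ 2.
have K0 : 0 < K by rewrite exprn_gt0// divr_gt0.
have x0 : 0 <= x by rewrite divr_ge0// ltW.
rewrite leNgt; apply/negP => gap.
set A := _ * K in gap; pose g := (A - x ^+ 2) / 2.
have g0 : 0 < g by rewrite /g; lra.
pose e1 : R := Num.min 1 (g / (2 * x + 1)).
have e10 : 0 < e1 by rewrite /e1 lt_min ltr01/= divr_gt0//; lra.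
have e1x : (x + e1) ^+ 2 <= x ^+ 2 + g.
  have le1 : e1 <= 1 by rewrite /e1 ge_min lexx.
  have le2 : e1 * (2 * x + 1) <= g.
    by rewrite -ler_pdivlMr; [rewrite /e1 ge_min lexx orbT|lra].
  nra.
have eps0 : 0 < g / (2 * K) by rewrite divr_gt0// mulr_gt0.
have := @continuous_cos R (tau * (a - c)) => /cvgrPdist_lt/(_ _ eps0).
move=> /nbhs_ballP[dl /= dl0 hdl].
have de0 : 0 < d * (e1 / 2) by rewrite mulr_gt0// divr_gt0.
have [eta eta0 heta] := pc _ de0.
have q1 : 0 < Num.min eta (Num.min (dl / (2 * (`|a - c| + 1)))
    (Num.min (e1 / (4 * (tau + 1))) (1 / (tau + 1)))).
  have ac1 : 0 < `|a - c| + 1 by rewrite ltr_wpDl.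
  have tau1 : 0 < tau + 1 by lra.
  by rewrite !lt_min eta0 !divr_gt0// mulr_gt0.
have [j0 hj0] := exp2_small q1.
have dl1 : 0 < dl / (2 * (tau + 1)) by rewrite divr_gt0// mulr_gt0//; lra.
have [j] := ca _ (maxn J j0) dl1; rewrite geq_max => /andP[jJ jj0] yja.
have := hj0 j jj0; rewrite !lt_min => /and4P[b1 b2 b3 b4].
have h0 := exp2_gt0 j; set h := 2 ^- j in b1 b2 b3 b4 h0.
(* [m * h] is the lattice point just below [tau]; it is within the first [4 ^ j]
   points because [tau < 2 ^ j]. *)
have u0 : 0 <= tau / h by rewrite divr_ge0// ltW.
have /andP[] := truncn_itv u0; set m := Num.truncn _.
rewrite ler_pdivlMr// ltr_pdivrMr// -natr1 => m1 m2.
have m4 : (m < 4 ^ j)%N.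
  rewrite -(ltr_nat R) fourE.
  have hX : h * 2 ^+ j = 1 by rewrite /h mulVf// expf_neq0// pnatr_eq0.
  have X0 : 0 < (2 : R) ^+ j by rewrite exprn_gt0.
  have b4' : h * (tau + 1) < 1 by rewrite -ltr_pdivlMr//; lra.
  have : m%:R <= tau * 2 ^+ j.
    by have := ler_wpM2r (ltW X0) m1; rewrite -mulrA hX mulr1.
  have : (tau + 1) < 2 ^+ j.
    by rewrite -(ltr_pM2l h0) hX.
  nra.
have := hy j jJ m m4; rewrite -/h -/K; set tj := m%:R * h in m1 *.
have tj0 : 0 <= tj by rewrite /tj mulr_ge0// ltW.
have tjt : `|tj - tau| <= h by rewrite ler_norml; move: m2; rewrite mulrDl mul1r -/tj; lra.
have r1 : phi tj / d <= x + e1 / 2.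
  have : phi tj <= phi tau + d * (e1 / 2).
    rewrite -[tj](subrKC tau); apply: le_trans (pD _ _) _; rewrite lerD2l.
    by apply: heta; apply: le_trans tjt (ltW b1).
  move=> /(ler_wpM2r (ltW (_ : 0 < d^-1))); rewrite invr_gt0 => /(_ d0).
  by rewrite mulrDl -/x mulrAC divff ?mul1r// gt_eqF.
have r2 : 2 * tj * h <= e1 / 2.
  have : h * (4 * (tau + 1)) < e1 by rewrite -ltr_pdivlMr//; lra.
  nra.
have r0 : 0 <= phi tj / d by rewrite divr_ge0// ltW.
have rsq : (phi tj / d + 2 * tj * h) ^+ 2 <= (x + e1) ^+ 2.
  have : 0 <= 2 * tj * h by rewrite !mulr_ge0// ltW.
  by move=> *; rewrite lerXn2r ?nnegrE//; lra.
have arg : ball (tau * (a - c)) dl (tj * (y j - c)).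
  rewrite /ball/= distrC.
  have -> : tj * (y j - c) - tau * (a - c) = tj * (y j - a) + (tj - tau) * (a - c).
    by ring.
  apply: le_lt_trans (ler_normD _ _) _; rewrite (normrM tj) (normrM (tj - tau)) (ger0_norm tj0).
  have s1 : `|y j - a| * (2 * (tau + 1)) < dl by rewrite -ltr_pdivlMr//; lra.
  have a0 : 0 <= `|a - c| by [].
  have s2 : h * (2 * (`|a - c| + 1)) < dl by rewrite -ltr_pdivlMr//; lra.
  have y0 : 0 <= `|y j - a| by [].
  have s3 : tj * `|y j - a| <= tau * `|y j - a| by rewrite ler_wpM2r.
  have s4 : `|tj - tau| * `|a - c| <= h * `|a - c| by rewrite ler_wpM2r.
  nra.
have := hdl _ arg; rewrite /= ltr_norml => /andP[k1 k2].
have k3 : g / (2 * K) * (2 * K) = g by rewrite divfK// gt_eqF// mulr_gt0.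
move=> fin.
set C2 := cos (tj * _) in fin k1 k2; have A1 : A = (2 - 2 * cos (tau * (a - c))) * K by [].
have g1 : 2 * g = A - x ^+ 2 by rewrite /g; lra.
clearbody g A C2 K; move: A1 k1 k2; set C1 := cos _ => A1 k1 k2.
have k4 : (C2 - C1) * (2 * K) < g.
  by rewrite -ltr_pdivlMr ?mulr_gt0//; lra.
nra.
Qed.

(** By [lattice_frequency] there are, on every fine lattice, a frequency [y]
    controlled by [phi1] such that [y - lam] is controlled by [phi2]. By
    [frequency_bounded] they have a cluster point [a]. *)
Theorem split_frequency : exists a b, lam = a + b /\ exists C, forall tau,
  2 - 2 * cos (tau * a) <= C * phi1 tau ^+ 2 /\
  2 - 2 * cos (tau * b) <= C * phi2 tau ^+ 2.
Proof.
have [S S0 [J hJ]] := lattice_frequency.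
have [B [J' hB]] := frequency_bounded S0.
have [y hy] : {y : nat -> R & forall j, (J <= j)%N ->
    [/\ `|y j| * 2 ^- j <= pi, frequency_bound phi1 S j (y j) &
        frequency_bound phi2 S j (y j - lam)]}.
  apply: (@choice _ _ (fun j y => (J <= j)%N -> [/\ `|y| * 2 ^- j <= pi,
    frequency_bound phi1 S j y & frequency_bound phi2 S j (y - lam)])) => j.
  have [/hJ[y hy]|_] := leqP J j; first by exists y.
  by exists 0.
have [a ca] : exists a, forall e n, 0 < e -> exists2 j, (n <= j)%N & `|y j - a| < e.
  apply: (@bounded_cluster y B (maxn J J')) => j; rewrite geq_max => /andP[jJ jJ'].
  by have [h1' h2' _] := hy j jJ; exact: hB h2'.
exists a, (lam - a); split; first by rewrite subrKC.
have k0 : 0 < (S / 2) ^+ 2 * d ^+ 2 by rewrite mulr_gt0// exprn_gt0// divr_gt0.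
exists ((S / 2) ^+ 2 * d ^+ 2)^-1 => tau.
have conv (u p : R) : u * (S / 2) ^+ 2 <= (p / d) ^+ 2 ->
    u <= ((S / 2) ^+ 2 * d ^+ 2)^-1 * p ^+ 2.
  have d20 : 0 < d ^+ 2 by rewrite exprn_gt0.
  rewrite [leRHS]expr_div_n ler_pdivlMr// -mulrA => h.
  by rewrite [leRHS]mulrC ler_pdivlMr.
split; apply: conv.
  rewrite -[a]subr0; apply: (frequency_limit (J := J) l1 S0 ca) => j /hy[_ h _].
  by rewrite subr0.
rewrite -[lam - a]opprB mulrN cosN.
by apply: (frequency_limit (J := J) l2 S0 ca) => j /hy[].
Qed.

End SplitFrequency.

(** * The Weyl length of a translation *)

Section WeylLength.
Context {R : realType} {V : Type}.
Variables (sigma : V -> V -> R) (f : R -> V) (v : nat -> V).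
Hypotheses (psigma : bounded_pseudometric sigma) (fv : borel_separable sigma f v).
Implicit Types (l L A e tau s : R).

(** The distance between [f] and its translate, in terms of windows; see
    [Dp_weyl_length]. *)
Definition weyl_length tau : R :=
  inf [set A | exists2 l, 0 < l & period_le sigma f l A tau].

Let wp := weight_period psigma fv.

Lemma period_le1 l tau : 0 <= l -> period_le sigma f l 1 tau.
Proof.
move=> l0 xi; rewrite -(@window_cst _ 1 xi l)//.
apply: (le_window _ (wp tau) (weight_cst ler01) l0).
by move=> t; have [_ _ _ /(_ (f t) (f (t + tau)))/andP[]] := psigma.
Qed.

Let lb tau : has_lbound [set A | exists2 l, 0 < l & period_le sigma f l A tau].
Proof. by exists 0 => A [l l0 /(mean_le_ge0 (wp tau) l0)]. Qed.

Let ne tau : [set A | exists2 l, 0 < l & period_le sigma f l A tau] !=set0.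
Proof. by exists 1, 1 => //; exact: period_le1. Qed.

Lemma weyl_length_le l A tau : 0 < l -> period_le sigma f l A tau ->
  weyl_length tau <= A.
Proof. by move=> l0 h; apply: ge_inf => //; exists l. Qed.

Lemma weyl_length_lt e tau : weyl_length tau < e ->
  exists2 L, 0 < L & forall l, L <= l -> period_le sigma f l e tau.
Proof.
move=> /(inf_lt (ne tau))[A [l l0 h] Ae].
have eA : 0 < e - A by rewrite subr_gt0.
have [L L0 hL] := mean_le_eventually (wp tau) l0 eA h.
by exists L => // l' /hL; rewrite subrKC.
Qed.

Lemma weyl_length_ge0 tau : 0 <= weyl_length tau.
Proof.
apply: lb_le_inf => // A [l l0]; exact: (mean_le_ge0 (wp tau) l0).
Qed.

(** Bounds for two translations hold for a common window length, because they
    persist for all large lengths. *)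
Lemma weyl_length_is_length : weyl_ap sigma f -> is_length weyl_length.
Proof.
move=> apf; split; first exact: weyl_length_ge0.
- suff le tau : weyl_length (- tau) <= weyl_length tau.
    by move=> tau; apply/eqP; rewrite eq_le le -{1}[tau]opprK le.
  apply: lb_le_inf => // A [l l0 h]; apply: (weyl_length_le l0).
  exact: period_leN psigma fv _ _ _ (ltW l0) h.
- move=> tau tau'; apply/ler_addgt0Pr => e e0; have e20 : 0 < e / 2 by rewrite divr_gt0.
  have [|L L0 hL] := @weyl_length_lt (weyl_length tau + e / 2) tau; first by lra.
  have [|L' L'0 hL'] := @weyl_length_lt (weyl_length tau' + e / 2) tau'; first by lra.
  set l := Num.max L L'; have Ll : L <= l by rewrite le_max lexx.
  have L'l : L' <= l by rewrite le_max lexx orbT.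
  have l0 : 0 < l := lt_le_trans L0 Ll.
  have := period_leD psigma fv (ltW l0) (hL _ Ll) (hL' _ L'l).
  by move=> /(weyl_length_le l0); lra.
- move=> e /(weyl_translation_continuous psigma fv apf)[l l0 [h h0 hs]].
  by exists h => // s /hs; exact: weyl_length_le.
Qed.

End WeylLength.

Section JointLength.
Context {R : realType} {V1 V2 : Type}.
Variables (sigma1 : V1 -> V1 -> R) (f1 : R -> V1) (v1 : nat -> V1).
Variables (sigma2 : V2 -> V2 -> R) (f2 : R -> V2) (v2 : nat -> V2).
Hypotheses (p1 : bounded_pseudometric sigma1) (fv1 : borel_separable sigma1 f1 v1).
Hypotheses (p2 : bounded_pseudometric sigma2) (fv2 : borel_separable sigma2 f2 v2).
Implicit Types (e d tau : R).
Let sigma := max_dist sigma1 sigma2.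
Let z t := (f1 t, f2 t).

Lemma weyl_length_dense : weyl_ap sigma z -> forall e, 0 < e ->
  relatively_dense [set tau |
    weyl_length sigma1 f1 tau <= e /\ weyl_length sigma2 f2 tau <= e].
Proof.
have [v zv] := borel_separable_max fv1 fv2.
have ps := bounded_pseudometric_max p1 p2.
move=> apz e /apz[l l0 [a a0 ha]]; exists a => // xi; have [tau [xt ht]] := ha xi.
exists tau; split=> //.
have wz := weight_period ps zv tau.
split.
- apply: (weyl_length_le p1 fv1 l0); apply: le_mean_le ht => //.
  + exact: weight_period p1 fv1 tau.
  + exact: ltW.
  + by move=> t; rewrite /sigma /max_dist/= le_max lexx.
- apply: (weyl_length_le p2 fv2 l0); apply: le_mean_le ht => //.
  + exact: weight_period p2 fv2 tau.
  + exact: ltW.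
  + by move=> t; rewrite /sigma /max_dist/= le_max lexx orbT.
Qed.

Lemma controlled_small (K : R -> R -> R) : controlled sigma z K -> forall e, 0 < e ->
  exists2 d, 0 < d & forall tau,
    weyl_length sigma1 f1 tau < d -> weyl_length sigma2 f2 tau < d ->
    exists2 L, 0 < L & forall l, L <= l -> mean_le (fun t => K t (t + tau)) l e.
Proof.
have [v zv] := borel_separable_max fv1 fv2.
have ps := bounded_pseudometric_max p1 p2.
move=> hK e /hK[gamma gamma0 [L L0 hL]]; exists (gamma / 2) => [|tau].
  by rewrite divr_gt0.
move=> /(weyl_length_lt p1 fv1)[L1 L10 h1] /(weyl_length_lt p2 fv2)[L2 L20 h2].
exists (Num.max L (Num.max L1 L2)) => [|l]; first by rewrite lt_max L0.
rewrite !ge_max => /and3P[Ll L1l L2l]; apply: hL => //.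
have l0 : 0 <= l by apply: le_trans Ll; exact: ltW.
have w1 := weight_period p1 fv1 tau; have w2 := weight_period p2 fv2 tau.
apply: (le_mean_le (weight_period ps zv tau) (weightD w1 w2) l0).
  move=> t; rewrite /sigma /max_dist/= ge_max.
  by rewrite lerDl lerDr (weight_ge0 _ w1) (weight_ge0 _ w2).
rewrite [gamma]splitr; exact: (mean_leD w1 w2 l0 (h1 _ L1l) (h2 _ L2l)).
Qed.

End JointLength.

(** * Null sets and Borel versions *)

Section NullSets.
Context d (T : measurableType d) (R : realType) (m : {measure set T -> \bar R}).
Local Open Scope ereal_scope.
Implicit Types (D N : set T) (F G : T -> \bar R).

Import HBNNSimple.

Let le_integral_off_null D N F G : measurable N -> m N = 0 ->
  (forall t, D t -> 0 <= F t) -> (forall t, D t -> 0 <= G t) ->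
  (forall t, ~ N t -> F t = G t) ->
  \int[m]_(t in D) F t <= \int[m]_(t in D) G t.
Proof.
move=> mN N0 F0 G0 FG; rewrite !ge0_integralE//; apply: ge_ereal_sup => _ [h /= hF <-].
have mNC : measurable (~` N) by exact: measurableC.
have -> : sintegral m h = sintegral m (proj_nnsfun h mNC).
  rewrite -!integralT_nnsfun; apply: ge0_ae_eq_integral => //.
  - by apply/measurable_EFinP.
  - by apply/measurable_EFinP.
  - by move=> t _; rewrite lee_fin.
  - by move=> t _; rewrite lee_fin.
  exists N; split=> // t /= H; apply: contrapT => Nt.
  apply: H; move=> *; by rewrite mindicE mem_set// mulr1.
apply: ereal_sup_ubound; exists (proj_nnsfun h mNC) => //= t.
have [Nt|Nt] := pselect (N t).
  have tN : (t \in ~` N) = false by apply: memNset => /(_ Nt).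
  rewrite mindicE tN mulr0.
  by rewrite erestrict_ge0// => s; exact: G0.
by rewrite mindicE mem_set// mulr1; apply: le_trans (hF t) _; rewrite /patch FG.
Qed.

(** The integrands may be nonmeasurable: simple functions can be set to zero on
    the null set without changing their integrals. *)
Lemma integral_eq_off_null D N F G : measurable N -> m N = 0 ->
  (forall t, D t -> 0 <= F t) -> (forall t, D t -> 0 <= G t) ->
  (forall t, ~ N t -> F t = G t) ->
  \int[m]_(t in D) F t = \int[m]_(t in D) G t.
Proof.
move=> mN N0 F0 G0 FG; apply/eqP; rewrite eq_le.
by rewrite !(le_integral_off_null mN)// => t /FG.
Qed.

End NullSets.

Lemma countable_sequence (T : Type) (S : set T) (x0 : T) : countable S ->
  exists v : nat -> T, forall x, S x -> exists k, v k = x.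
Proof.
move=> /countable_injP[e einj].
have [v hv] : {v : nat -> T & forall n,
    (exists2 x, S x & e x = n) -> S (v n) /\ e (v n) = n}.
  apply: (@choice _ _ (fun n y => (exists2 x, S x & e x = n) -> S y /\ e y = n)) => n.
  have [[x Sx ex]|no] := pselect (exists2 x, S x & e x = n); last by exists x0.
  by exists x.
exists v => x Sx; exists (e x).
have [|Sv ev] := hv (e x); first by exists x.
by apply: einj; rewrite ?inE.
Qed.

Section BorelVersion.
Context {R : realType} {V : Type}.
Variable sigma : V -> V -> R.
Hypothesis psigma : bounded_pseudometric sigma.
Implicit Types (f : R -> V) (N : set R) (l A e tau : R).

Definition null_set N : Prop := measurable N /\ @lebesgue_measure R N = 0.

Lemma null_setU N N' : null_set N -> null_set N' -> null_set (N `|` N').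
Proof.
move=> [mN N0] [mN' N'0]; split; first exact: measurableU.
by rewrite measureU0.
Qed.

Lemma null_set_shift N tau : null_set N -> null_set [set t | N (t + tau)].
Proof.
move=> [mN N0]; split; first exact: measurable_shift.
by rewrite lebesgue_measure_shift.
Qed.

(** Off a null Borel set [f] is a pointwise limit of simple functions; their
    countably many values are dense in its range. On the null set [f] may be
    replaced by one of these values. *)
Lemma strongly_measurable_borel f : strongly_measurable sigma f ->
  exists N fb v, [/\ null_set N, forall t, ~ N t -> f t = fb t &
                     borel_separable sigma fb v].
Proof.
have [sxx ssym stri s01] := psigma.
move=> [s [fin ms [N [mN N0 hN]]]].
have cvg t : ~ N t -> sigma (s n t) (f t) @[n --> \oo] --> (0 : R).
  by move=> Nt; apply: contrapT => nc; apply: Nt; exact: hN.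
pose c0 := s 0%N 0; pose fb t := if t \in N then c0 else f t.
have [v hv] : exists v : nat -> V, forall x, (exists n t, x = s n t) -> exists k, v k = x.
  apply: (@countable_sequence _ [set x | exists n t, x = s n t] c0).
  have -> : [set x | exists n t, x = s n t] = \bigcup_n range (s n).
    apply/seteqP; split => [x [n [t ->]]|x [n _ [t _ <-]]]; first by exists n => //; exists t.
    by exists n, t.
  by apply: bigcup_countable => // n _; exact: finite_set_countable.
exists N, fb, v; split=> //.
  by move=> t Nt; rewrite /fb memNset.
split=> [k|t e e0]; last first.
  rewrite /fb; case: ifPn => [tN|].
    by have [|k vk] := hv c0; [exists 0%N, 0|exists k; rewrite vk sxx].
  rewrite notin_setE => /cvg/cvgrPdist_lt/(_ _ e0)[n _ /(_ n (leqnn _))].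
  rewrite sub0r normrN ger0_norm; last by have /andP[] := s01 (s n t) (f t).
  by have [|k vk] := hv (s n t); [exists n, t|exists k; rewrite vk ssym].
pose h n t := if t \in N then sigma c0 (v k) else sigma (s n t) (v k).
apply: (@measurable_fun_cvg _ _ _ _ h) => [n|t _].
  move=> _ Y mY; rewrite setTI.
  pose Z := [set w | range (s n) w /\ Y (sigma w (v k))].
  have -> : h n @^-1` Y = (N `&` [set t | Y (sigma c0 (v k))]) `|`
      (~` N `&` \bigcup_(w in Z) s n @^-1` [set w]).
    apply/seteqP; split => t; rewrite /h /preimage/=.
      case: ifPn; rewrite (inE, notin_setE) => Nt yt; [by left|right].
      by split=> //; exists (s n t) => //; split=> //; exists t.
    case: ifPn; rewrite (inE, notin_setE) => Nt [[]//|[]//].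
    by move=> _ [w [_ yw] /= ->].
  apply: measurableU; apply: measurableI => //.
  - have [yes|no] := pselect (Y (sigma c0 (v k))).
      by rewrite (_ : [set t | _] = setT)//; apply/seteqP; split.
    by rewrite (_ : [set t | _] = set0)//; apply/seteqP; split.
  - exact: measurableC.
  - apply: fin_bigcup_measurable => [|w _]; last exact: ms.
    by apply: (sub_finite_set _ (fin n)) => w [].
rewrite /h /fb; case: ifPn => [_|]; first exact: cvg_cst.
rewrite notin_setE => /cvg/cvgrPdist_lt ct; apply/cvgrPdist_lt => e /ct.
apply: filterS => n; rewrite sub0r normrN ger0_norm; last first.
  by have /andP[] := s01 (s n t) (f t).
apply: le_lt_trans; rewrite ler_norml.
have := stri (f t) (s n t) (v k); have := stri (s n t) (f t) (v k).
by rewrite (ssym (f t) (s n t)); lra.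
Qed.

End BorelVersion.

Section Distances.
Context {R : realType} {V : Type}.
Variables (sigma : V -> V -> R) (f fb : R -> V) (v : nat -> V) (N : set R).
Hypotheses (psigma : bounded_pseudometric sigma) (nullN : null_set N).
Hypotheses (ffb : forall t, ~ N t -> f t = fb t) (fbv : borel_separable sigma fb v).
Implicit Types (l A e tau : R).

Let s01 x y : 0 <= sigma x y <= 1. Proof. by case: psigma. Qed.
Let wp := weight_period psigma fbv.

Lemma integral_shift_window tau xi l : 0 <= l ->
  (\int[@lebesgue_measure R]_(t in `[xi, (xi + l)%R])
      ((sigma (f t) (translate f tau t)) `^ 1)%:E)%E =
  (window (fun t => sigma (fb t) (fb (t + tau))) xi l)%:E.
Proof.
move=> l0; rewrite (windowE _ (wp tau) l0).
have [mN N0] := null_setU nullN (null_set_shift tau nullN).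
refine (@integral_eq_off_null _ _ _ lebesgue_measure _ _ _ _ mN N0 _ _ _).
- by move=> t _; rewrite lee_fin powR_ge0.
- by move=> t _; rewrite lee_fin; have /andP[] := s01 (fb t) (fb (t + tau)).
move=> t /not_orP[Nt Nts]; rewrite powRr1; last by case/andP: (s01 (f t) (translate f tau t)).
by rewrite /translate !ffb.
Qed.

Lemma Dpl_leP l A tau : 0 < l ->
  (Dpl sigma 1 l f (translate f tau) <= A%:E)%E <-> period_le sigma fb l A tau.
Proof.
move=> l0; rewrite /Dpl invr1 poweRe1; last first.
  apply: le_trans (ereal_sup_ubound _); last by exists 0.
  by rewrite integral_shift_window ?(ltW l0)// -EFinM lee_fin mulr_ge0 ?invr_ge0 ?(ltW l0)//
    window_ge0.
split=> [h xi|h].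
  have := le_trans (ereal_sup_ubound _) h.
  move=> /(_ _ (ex_intro2 _ _ xi I erefl)).
  by rewrite integral_shift_window ?(ltW l0)// -EFinM lee_fin mulrC ler_pdivrMr.
apply: ge_ereal_sup => _ [xi _ <-].
by rewrite integral_shift_window ?(ltW l0)// -EFinM lee_fin mulrC ler_pdivrMr.
Qed.

Lemma weyl_length_le_Dpl l tau : 0 < l ->
  ((weyl_length sigma fb tau)%:E <= Dpl sigma 1 l f (translate f tau))%E.
Proof.
move=> l0; have := fun A => Dpl_leP A tau l0; case: Dpl => [r||] H.
- by rewrite lee_fin; apply: (weyl_length_le psigma fbv l0); apply/H.
- by rewrite leey.
- have /H/(mean_le_ge0 (wp tau) l0) : (-oo <= (-1)%:E :> \bar R)%E by rewrite leNye.
  by rewrite lerNr oppr0 ler10.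
Qed.

(** A mean bound for one window length persists, with an arbitrarily small loss, for
    all large ones; hence the limit is an infimum. *)
Lemma Dp_weyl_length tau :
  Dp sigma 1 f (translate f tau) = (weyl_length sigma fb tau)%:E.
Proof.
apply/cvg_lim => //; set w := weyl_length sigma fb tau.
have bounds e : 0 < e -> exists2 L, 0 < L & forall l, L <= l ->
    (w%:E <= Dpl sigma 1 l f (translate f tau) <= (w + e)%:E)%E.
  move=> e0; have [|L L0 hL] := @weyl_length_lt _ _ _ _ _ psigma fbv (w + e) tau.
    by rewrite ltrDl.
  exists L => // l Ll; have l0 := lt_le_trans L0 Ll.
  by apply/andP; split; [exact: weyl_length_le_Dpl|apply/(Dpl_leP _ _ l0); exact: hL].
apply/fine_cvgP; split.
  have [L L0 hL] := bounds 1 ltr01; exists L; split; first exact: num_real.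
  move=> l /ltW/hL/andP[a b]; rewrite ge0_fin_numE.
      by apply: le_lt_trans b _; rewrite ltry.
  by apply: le_trans a; rewrite lee_fin; exact: (weyl_length_ge0 psigma fbv).
apply/cvgrPdist_le => e /bounds[L L0 hL]; exists L; split; first exact: num_real.
move=> l /ltW/hL/=; case: Dpl => [r|/andP[]|/andP[]]//=.
by rewrite !lee_fin distrC ler_norml => /andP[a b]; apply/andP; split; lra.
Qed.

End Distances.

(** * Weyl spaces in terms of Borel functions *)

Section FromWeyl.
Context {R : realType} {V : Type}.
Variables (sigma : V -> V -> R) (f fb : R -> V) (v : nat -> V) (N : set R).
Hypotheses (psigma : bounded_pseudometric sigma) (nullN : null_set N).
Hypotheses (ffb : forall t, ~ N t -> f t = fb t) (fbv : borel_separable sigma fb v).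

Lemma weyl_ap_Wp v0 : Wp sigma v0 1 f -> weyl_ap sigma fb.
Proof.
move=> [_ ap] e /ap[l l0 [a a0 ha]]; exists l => //; exists a => // xi.
have [tau [xt ht]] := ha xi; exists tau; split=> //.
by apply/(Dpl_leP psigma nullN ffb fbv _ _ l0)/ltW.
Qed.

Lemma Dp_weyl_lengthP (tau : nat -> R) :
  Dp sigma 1 f (translate f (tau j)) @[j --> \oo] --> 0%E <->
  weyl_length sigma fb (tau j) @[j --> \oo] --> (0 : R).
Proof.
have -> : (fun j => Dp sigma 1 f (translate f (tau j))) =
    (fun j => (weyl_length sigma fb (tau j))%:E).
  by apply/funext => j; exact: (Dp_weyl_length psigma nullN ffb fbv).
split=> [/fine_cvgP[] //|h]; apply/fine_cvgP; split=> //.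
exact: nearW.
Qed.

End FromWeyl.

Section ToWeyl.
Context {R : realType} {V : Type}.
Variables (sigma : V -> V -> R) (f : R -> V) (x : nat -> V).
Hypotheses (psigma : bounded_pseudometric sigma) (fx : borel_separable sigma f x).
Implicit Types (t : R) (n : nat).

(** The index of a point nearest to [f t] among the first [n.+1] points of the
    sequence; these points are the simple functions that approximate [f]. *)
Fixpoint nearest n t : nat :=
  if n is n'.+1 then
    if sigma (f t) (x n'.+1) < sigma (f t) (x (nearest n' t)) then n'.+1
    else nearest n' t
  else 0%N.

Lemma nearest_le n t : (nearest n t <= n)%N.
Proof. by elim: n => //= n IH; case: ifP => // _; exact: leqW. Qed.

Lemma nearest_min n k t : (k <= n)%N ->
  sigma (f t) (x (nearest n t)) <= sigma (f t) (x k).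
Proof.
elim: n => [|n IH]; first by rewrite leqn0 => /eqP ->.
rewrite leq_eqVlt => /predU1P[->|]/=; first by case: ltP.
by rewrite ltnS => /IH h; case: ltP => // /ltW h'; exact: le_trans h' h.
Qed.

Lemma nearest_measurable n i : measurable [set t | nearest n t = i].
Proof.
elim: n i => [|n IH] i /=.
  have [->|i0] := eqVneq i 0%N.
    by rewrite (_ : [set t | _] = setT)//; apply/seteqP; split.
  rewrite (_ : [set t | _] = set0)//; apply/seteqP; split => // t /= /esym/eqP.
  by rewrite (negbTE i0).
pose L := \bigcup_j ([set t | nearest n t = j] `&`
  [set t | sigma (f t) (x n.+1) < sigma (f t) (x j)]).
have mL : measurable L.
  apply: bigcup_measurable => j _; apply: measurableI => //.
  by apply: measurable_lt; exact: fx.1.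
have LP t : L t <-> sigma (f t) (x n.+1) < sigma (f t) (x (nearest n t)).
  by split=> [[j _ [/= -> //]]|h]; exists (nearest n t).
have [->|ni] := eqVneq i n.+1.
  rewrite (_ : [set t | _] = L)//; apply/seteqP; split => t /=.
    case: ifPn => [/LP//|_ e]; by have := nearest_le n t; rewrite e ltnn.
  by move=> /LP ->.
rewrite (_ : [set t | _] = [set t | nearest n t = i] `\` L); last first.
  apply/seteqP; split => t /=.
    case: ifPn => [_ /esym/eqP|/negP h e]; first by rewrite (negbTE ni).
    by split=> // /LP.
  by move=> [e nL]; case: ifPn => // /LP.
exact: measurableD.
Qed.

Lemma borel_strongly_measurable : strongly_measurable sigma f.
Proof.
have [_ ssym _ s01] := psigma.
exists (fun n t => x (nearest n t)); split.
- move=> n; apply: (@sub_finite_set _ _ (x @` `I_n.+1)).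
    by move=> _ [t _ <-]; exists (nearest n t) => //=; rewrite ltnS nearest_le.
  by apply: finite_image; exact: finite_II.
- move=> n w; apply: (@measurable_nat_preimage _ (nearest n) [set i | x i = w]) => i.
  exact: nearest_measurable.
exists set0; split; [exact: measurable0|exact: measure0|].
move=> t /=; apply; apply/cvgrPdist_lt => e e0.
have [k hk] := fx.2 t e e0; exists k => // n /= kn.
rewrite sub0r normrN ger0_norm; last first.
  by have /andP[] := s01 (x (nearest n t)) (f t).
by rewrite ssym; apply: le_lt_trans hk; exact: nearest_min.
Qed.

Lemma borel_dist w : measurable_fun [set: R] (fun t => sigma (f t) w).
Proof.
have [_ ssym stri _] := psigma.
apply: measurable_sublevels => c.
apply: (measurable_open_pullback psigma fx) => t /= h.
exists (c - sigma (f t) w); first by rewrite subr_gt0.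
by move=> s; have := stri (f s) (f t) w; rewrite (ssym (f s) (f t)) => *; lra.
Qed.

Lemma Wp_weyl_ap v0 : weyl_ap sigma f -> Wp sigma v0 1 f.
Proof.
have [_ _ _ s01] := psigma; move=> ap; split.
  split; first exact: borel_strongly_measurable.
  apply: (@le_lt_trans _ _ (1%:E)); last by rewrite ltry.
  apply: ge_ereal_sup => _ [xi _ <-].
  have wf : weight (fun t => sigma (f t) v0).
    by split; [exact: borel_dist|exists 1 => t; exact: s01].
  rewrite (_ : (\int[_]_(t in _) _)%E = (window (fun t => sigma (f t) v0) xi 1)%:E).
    rewrite lee_fin -[leRHS]mulr1 -(@window_cst R 1 xi 1)//.
    apply: (le_window _ wf (weight_cst ler01) ler01) => t.
    by have /andP[] := s01 (f t) v0.
  rewrite windowE//; apply: eq_integral => t _; rewrite powRr1//.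
  by have /andP[] := s01 (f t) v0.
have null0 : null_set (set0 : set R) by split=> //; rewrite measure0.
move=> e e0; have e20 : 0 < e / 2 by rewrite divr_gt0.
have [l l0 [a a0 ha]] := ap _ e20; exists l => //; exists a => // xi.
have [tau [xt ht]] := ha xi; exists tau; split=> //.
apply: (@le_lt_trans _ _ (e / 2)%:E).
  by apply/(Dpl_leP psigma null0 (fun=> fun=> erefl) fx _ _ l0).
by rewrite lte_fin; lra.
Qed.

End ToWeyl.

(** * Modules of frequencies, and the selection theorem *)

Section ModSplit.
Context {R : realType}.
Implicit Types (phi : R -> R) (tau : nat -> R) (a b lam C e d : R).
Local Notation "x %:C" := (real_complex R x).

(** For [phi] the Weyl length of a function, these are the elements of its [Mod]. *)
Definition sequentially_controlled phi lam : Prop := forall tau : nat -> R,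
  phi (tau j) @[j --> \oo] --> (0 : R) ->
  expi (lam * tau j) @[j --> \oo] --> (1 : (R[i] : numFieldType)).

Lemma expi_cvg1 (u : nat -> R) :
  expi (u j) @[j --> \oo] --> (1 : (R[i] : numFieldType)) <->
  forall e, 0 < e -> \forall j \near \oo, 2 - 2 * cos (u j) < e.
Proof.
have pos (r : R) : 0 < r -> 0 < r%:C by rewrite -(rmorph0 (real_complex R)) ltcR.
have key (r : R) j : 0 < r -> (`|1 - expi (u j)| < r%:C) = (2 - 2 * cos (u j) < r ^+ 2).
  move=> r0; rewrite distrC -(@ltr_pXn2r _ 2)// ?nnegrE//; last exact/ltW/pos.
  by rewrite norm_expiB1 -rmorphXn/= ltcR.
split=> [/(@cvgrPdist_lt (R[i] : numFieldType) (R[i] : numFieldType)) h e e0|h].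
  have s0 : 0 < Num.sqrt e by rewrite sqrtr_gt0.
  have := h _ (pos _ s0); apply: filterS => j.
  by rewrite key// sqr_sqrtr// ltW.
apply/(@cvgrPdist_lt (R[i] : numFieldType) (R[i] : numFieldType)) => e e0.
have eE : e = (complex.Re e)%:C by rewrite RRe_real// gtr0_real.
have r0 : 0 < complex.Re e by move: e0; rewrite {1}eE -(rmorph0 (real_complex R)) ltcR.
rewrite eE; have := h _ (exprn_gt0 2 r0); apply: filterS => j.
by rewrite key.
Qed.

Lemma quadratic_control phi a C : (forall t, 0 <= phi t) ->
  (forall t, 2 - 2 * cos (t * a) <= C * phi t ^+ 2) -> sequentially_controlled phi a.
Proof.
move=> p0 h tau /cvgrPdist_lt ht; apply/expi_cvg1 => e e0.
have C0 : 0 < `|C| + 1 by rewrite ltr_wpDl.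
pose d := Num.min 1 (e / (`|C| + 1)).
have d0 : 0 < d by rewrite lt_min ltr01 divr_gt0.
have dC : d * (`|C| + 1) <= e by rewrite -ler_pdivlMr// ge_min lexx orbT.
have d1 : d <= 1 by rewrite ge_min lexx.
have := ht _ d0; apply: filterS => j.
rewrite sub0r normrN ger0_norm// => hj.
rewrite [a * _]mulrC; apply: le_lt_trans (h _) _.
have := p0 (tau j); move: (phi (tau j)) hj => p pd pp.
have s1 : p ^+ 2 <= d by rewrite expr2; nra.
have s2 : C * p ^+ 2 <= `|C| * p ^+ 2 by rewrite ler_wpM2r ?exprn_ge0// ler_norm.
have s3 : `|C| * p ^+ 2 <= `|C| * d by rewrite ler_wpM2l.
by move: dC; rewrite mulrDr mulr1 [d * _]mulrC; lra.
Qed.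

Variables phi1 phi2 : R -> R.
Hypotheses (l1 : is_length phi1) (l2 : is_length phi2).
Hypothesis dense : forall e, 0 < e ->
  relatively_dense [set tau | phi1 tau <= e /\ phi2 tau <= e].

(** Otherwise [lam] fails along a sequence of translations for which both lengths
    tend to 0. *)
Lemma control_uniform lam : (forall tau : nat -> R,
    phi1 (tau j) @[j --> \oo] --> (0 : R) -> phi2 (tau j) @[j --> \oo] --> (0 : R) ->
    expi (lam * tau j) @[j --> \oo] --> (1 : (R[i] : numFieldType))) ->
  exists2 d, 0 < d & forall t, phi1 t < d -> phi2 t < d -> 1 / 2 <= cos (lam * t).
Proof.
move=> hlam; apply: contrapT => nd.
have [tau htau] : {tau : nat -> R & forall j,
    [/\ phi1 (tau j) < j.+1%:R^-1, phi2 (tau j) < j.+1%:R^-1 &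
        cos (lam * tau j) < 1 / 2]}.
  apply: (@choice _ _ (fun j t => [/\ phi1 t < j.+1%:R^-1, phi2 t < j.+1%:R^-1 &
        cos (lam * t) < 1 / 2])) => j.
  apply: contrapT => no; apply: nd; exists j.+1%:R^-1; first by rewrite invr_gt0.
  move=> t h1 h2; rewrite leNgt; apply/negP => h3; by apply: no; exists t.
have cv phi : (forall t, 0 <= phi t) -> (forall j, phi (tau j) < j.+1%:R^-1) ->
    phi (tau j) @[j --> \oo] --> (0 : R).
  move=> p0 pj; apply: (@squeeze_cvgr _ _ _ _ (cst 0) (@harmonic R)).
  - by apply: nearW => j /=; rewrite p0/= /harmonic ltW.
  - exact: cvg_cst.
  - exact: cvg_harmonic.
have [p10 _ _ _] := l1; have [p20 _ _ _] := l2.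
have c1 := cv _ p10 (fun j => let: And3 h _ _ := htau j in h).
have c2 := cv _ p20 (fun j => let: And3 _ h _ := htau j in h).
have /expi_cvg1/(_ 1 ltr01)[n _ /(_ n (leqnn _))/=] := hlam tau c1 c2.
by have [_ _] := htau n; lra.
Qed.

Lemma sequential_split lam : (forall tau : nat -> R,
    phi1 (tau j) @[j --> \oo] --> (0 : R) -> phi2 (tau j) @[j --> \oo] --> (0 : R) ->
    expi (lam * tau j) @[j --> \oo] --> (1 : (R[i] : numFieldType))) ->
  exists a b, [/\ lam = a + b, sequentially_controlled phi1 a &
                  sequentially_controlled phi2 b].
Proof.
move=> /control_uniform[d d0 hd].
have [a [b [lamE [C hC]]]] := split_frequency l1 l2 dense d0 hd.
have [p10 _ _ _] := l1; have [p20 _ _ _] := l2.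
exists a, b; split=> //.
- by apply: (@quadratic_control _ _ C p10) => t; have [] := hC t.
- by apply: (@quadratic_control _ _ C p20) => t; have [] := hC t.
Qed.

End ModSplit.

Lemma cvg0_lt {R : realType} (u : nat -> R) d :
  u j @[j --> \oo] --> (0 : R) -> 0 < d -> \forall j \near \oo, u j < d.
Proof.
move=> /cvgrPdist_lt h /h; apply: filterS => j; rewrite distrC subr0.
exact: le_lt_trans (ler_norm _).
Qed.

Lemma separable_sequence {R : realType} {U : completeMetricType R} (v0 : U) :
  separable U ->
  exists x : nat -> U, forall u (e : R), 0 < e -> exists k, mdist u (x k) < e.
Proof.
move=> [S /(countable_sequence v0)[x hx] dS]; exists x => u e e0.
have [|w [uw Sw]] := dS (ball u e) _ (ball_open u e).
  by exists u; exact: ballxx.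
have [k kw] := hx w Sw; exists k; rewrite kw; move: uw; rewrite ballEmdist; exact.
Qed.

Theorem theorem2 (R : realType) (U : completeMetricType R)
    (sepU : separable U)
    (v0 : U) (m0 : borel_probability U)
    (g : R -> U) (Wg : W mdist v0 g)
    (mu : R -> borel_probability U) (Wmu : Wp levy_prokhorov m0 1 mu)
    (delta : R) (delta01 : 0 < delta < 1) :
  exists f : R -> U,
    [/\ W mdist v0 f,
        Mod mdist f `<=` sum_set (Mod mdist g) (Mod levy_prokhorov mu),
        {ae @lebesgue_measure R, forall t, supp (mu t) (f t)} &
        {ae @lebesgue_measure R, forall t,
           mdist (f t) (g t) < r_ delta (g t) (mu t) + delta}].
Proof.
have pU := @bounded_pseudometric_trunc_mdist R U.
have pM := @bounded_pseudometric_levy_prokhorov R U.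
have [Ng [gb [vg [nullg gE sg]]]] := strongly_measurable_borel pU Wg.1.1.
have [Nm [mb [vm [nullm mE sm]]]] := strongly_measurable_borel pM Wmu.1.1.
have apg := weyl_ap_Wp pU nullg gE sg Wg.
have apm := weyl_ap_Wp pM nullm mE sm Wmu.
have apz := weyl_ap_max pU sg pM sm apg apm.
have [x dx] := separable_sequence v0 sepU.
have [v zv] := borel_separable_max sg sm.
have [f [fx fc fs fr]] := exists_controlled_selection dx zv apz delta01.
have lg := weyl_length_is_length pU sg apg.
have lm := weyl_length_is_length pM sm apm.
have dense := weyl_length_dense pU sg pM sm apz.
have small := controlled_small pU sg pM sm fc.
have null0 : null_set (set0 : set R) by split=> //; rewrite measure0.
exists f; split.
- apply: (Wp_weyl_ap pU fx) => e e0.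
  have [gamma gamma0 [L L0 hL]] := fc e e0.
  have [l l0 [a a0 ha]] := apz _ (divr_gt0 gamma0 (ltr0n R 2)).
  exists (Num.max L l); first by rewrite lt_max L0.
  exists a => // xi; have [tau [xt ht]] := ha xi; exists tau; split=> //.
  have pz := bounded_pseudometric_max pU pM.
  apply: hL; rewrite ?le_max ?lexx// -[gamma](divfK (_ : 2 != 0)) 1?mulrC//.
  by apply: (mean_le_double (weight_period pz zv tau) l0 _ ht); rewrite le_max lexx orbT.
- move=> lam hlam.
  have [|a [b [lamE ha hb]]] := @sequential_split _ _ _ lg lm dense lam.
    (* A sequence that is returning for [g] and for [mu] is returning for [f]. *)
    move=> tau cg cm; apply: hlam.
    apply/(Dp_weyl_lengthP pU null0 (fun=> fun=> erefl) fx)/cvgrPdist_lt => e e0.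
    have e20 : 0 < e / 2 by rewrite divr_gt0.
    have [d d0 hd] := small _ e20.
    have := cvg0_lt cg d0; have := cvg0_lt cm d0.
    apply: filterS2 => j hm hg; have [L L0 hL] := hd (tau j) hg hm.
    rewrite distrC subr0 ger0_norm; last exact: (weyl_length_ge0 pU fx).
    have := weyl_length_le pU fx L0 (hL _ (lexx _)); lra.
  exists a; first by move=> tau /(Dp_weyl_lengthP pU nullg gE sg tau).1 /ha.
  exists b; last exact: esym lamE.
  move=> tau; rewrite /returning trunc_levy_prokhorov.
  by move=> /(Dp_weyl_lengthP pM nullm mE sm tau).1 /hb.
- case: nullm => mN N0; exists Nm; split=> // t /= h; apply: contrapT => Nt.
  by apply: h; rewrite mE.
- have [mN N0] := null_setU nullg nullm.
  exists (Ng `|` Nm); split=> // t /= h; apply: contrapT => /not_orP[Nt Nt'].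
  by apply: h; rewrite mE// gE.
Qed.
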